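(* Let $G$ be a locally compact group such that every nonzero left ideal $I$ in $M(G)$ contains a minimal left ideal, and let $\mathrm{Soc}(M(G))$ be closed in $M(G)$. Then $G$ is finite.
   Context: $M(G)$ denotes the usual measure algebra of $G$ (with convolution and the total variation norm). For a Banach algebra $A$, $\mathrm{Soc}(A)$ denotes the left socle of $A$: if $A$ has minimal left ideals, it is the smallest left ideal of $A$ containing all of them (i.e. their sum); if $A$ has no minimal left ideals, $\mathrm{Soc}(A) = (0)$. Closed means closed in the norm topology. Ideals are not assumed closed unless stated. *)

(* Defs.v *)
From HB Require Import structures.
From mathcomp Require Import all_boot all_order all_algebra.
From mathcomp Require Import all_classical all_reals all_analysis.
From mathcomp Require Import complex.
Import Order.TTheory GRing.Theory Num.Theory.
Import numFieldNormedType.Exports.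

Set Implicit Arguments.
Unset Strict Implicit.
Unset Printing Implicit Defensive.

Local Open Scope classical_set_scope.
Local Open Scope ring_scope.
Local Open Scope complex_scope.

Local Notation Re := complex.Re.
Local Notation Im := complex.Im.

HB.mixin Record PointedTopological_isTopologicalGroup G
    of PointedTopological G & Group G := {
  mulg_continuous : continuous (fun x : G * G => (x.1 * x.2)%g) ;
  invg_continuous : continuous (fun x : G => (x^-1)%g)
}.

(* The distinguished point of Pointed, which the measurable structures of the
   library ask for, plays no role. *)
#[short(type="topologicalGroupType")]
HB.structure Definition TopologicalGroup :=
  {G of PointedTopological G & Group G
      & PointedTopological_isTopologicalGroup G}.

HB.mixin Record TopologicalGroup_isLocallyCompact G of TopologicalGroup G := {
  lcgroup_hausdorff : hausdorff_space G ;
  lcgroup_locally_compact : locally_compact [set: G]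
}.

#[short(type="lcGroupType")]
HB.structure Definition LCGroup :=
  {G of TopologicalGroup G & TopologicalGroup_isLocallyCompact G}.

Section complex_measure.
Context d (T : measurableType d) (R : realType).
Implicit Types (mu nu : set T -> R[i]) (E : set T).

(* A complex measure is a function on measurable sets; requiring the value 0
   on the other sets makes extensional equality the equality of measures. *)
Definition is_complex_measure mu :=
  [/\ mu set0 = 0,
      forall E, ~ measurable E -> mu E = 0 &
      forall F : nat -> set T, (forall k, measurable (F k)) ->
        trivIset setT F ->
        (fun n => \sum_(0 <= k < n) mu (F k) : R[i]^o) @ \oo
          --> (mu (\bigcup_k F k) : R[i]^o)].

(* The norm of R[i] takes values in R[i], hence Re `|_| for the real modulus. *)
Definition total_variation mu E : \bar R := ereal_sup
  [set x | exists n (A : 'I_n -> set T),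
    [/\ forall i, measurable (A i), trivIset setT A, \bigcup_i A i = E &
        x = (\sum_i Re `|mu (A i)|)%:E]].

Lemma cvg_Re (u : nat -> R[i]) (l : R[i]) :
  (u : nat -> R[i]^o) @ \oo --> (l : R[i]^o) ->
  (fun n => Re (u n)) @ \oo --> Re l.
Proof.
move=> /cvgrPdist_lt ul; apply/cvgrPdist_lt => e e0.
have /ul : 0 < e%:C :> R[i] by rewrite ltcR.
apply: filterS => n; rewrite -ltcR; apply: le_lt_trans.
by rewrite -raddfB /=; exact: normc_ge_Re.
Qed.

Lemma cvg_Im (u : nat -> R[i]) (l : R[i]) :
  (u : nat -> R[i]^o) @ \oo --> (l : R[i]^o) ->
  (fun n => Im (u n)) @ \oo --> Im l.
Proof.
have ImE (z : R[i]) : Im z = Re ((0 -i* 1) * z).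
  by case: z => a b /=; rewrite mul0r sub0r mulN1r opprK.
move=> ul; rewrite ImE; under eq_fun do rewrite ImE.
by apply: (@cvg_Re (fun n => (0 -i* 1) * u n)); exact: (@cvgZl_tmp _ R[i]^o).
Qed.

Definition charge_Re mu of is_complex_measure mu :=
  fun E => (Re (mu E))%:E.
Definition charge_Im mu of is_complex_measure mu :=
  fun E => (Im (mu E))%:E.

Section charges.
Variables (mu : set T -> R[i]) (mu_cm : is_complex_measure mu).

Let charge_Re0 : charge_Re mu_cm set0 = 0%E.
Proof. by rewrite /charge_Re; have [-> _ _] := mu_cm. Qed.

Let charge_Re_fin E : measurable E -> charge_Re mu_cm E \is a fin_num.
Proof. by []. Qed.

Let charge_Re_sigma_additive : semi_sigma_additive (charge_Re mu_cm).
Proof.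
move=> F mF tF _; have [_ _ /(_ F mF tF)/cvg_Re muF] := mu_cm.
rewrite /charge_Re; under eq_fun do rewrite sumEFin -raddf_sum.
by apply: cvg_comp muF _.
Qed.

HB.instance Definition _ := isCharge.Build _ _ _ (charge_Re mu_cm)
  charge_Re0 charge_Re_fin charge_Re_sigma_additive.

Let charge_Im0 : charge_Im mu_cm set0 = 0%E.
Proof. by rewrite /charge_Im; have [-> _ _] := mu_cm. Qed.

Let charge_Im_fin E : measurable E -> charge_Im mu_cm E \is a fin_num.
Proof. by []. Qed.

Let charge_Im_sigma_additive : semi_sigma_additive (charge_Im mu_cm).
Proof.
move=> F mF tF _; have [_ _ /(_ F mF tF)/cvg_Im muF] := mu_cm.
rewrite /charge_Im; under eq_fun do rewrite sumEFin -raddf_sum.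
by apply: cvg_comp muF _.
Qed.

HB.instance Definition _ := isCharge.Build _ _ _ (charge_Im mu_cm)
  charge_Im0 charge_Im_fin charge_Im_sigma_additive.

End charges.

Section charge_integral.
Variable nu : {charge set T -> \bar R}.

Definition hahn_pos := sval (cid (Hahn_decomposition nu)).
Definition hahn_neg := sval (cid (svalP (cid (Hahn_decomposition nu)))).
Definition hahn_posneg : hahn_decomposition nu hahn_pos hahn_neg :=
  svalP (cid (svalP (cid (Hahn_decomposition nu)))).

(* The value does not depend on the Hahn decomposition. *)
Definition charge_integral (f : T -> R) : R :=
  Rintegral (jordan_pos hahn_posneg) setT f -
  Rintegral (jordan_neg hahn_posneg) setT f.

End charge_integral.

Definition complex_integral mu (mu_cm : is_complex_measure mu)
    (f : T -> R[i]) : R[i] :=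
  (charge_integral (charge_Re mu_cm) (fun x => Re (f x)) -
   charge_integral (charge_Im mu_cm) (fun x => Im (f x))) +i*
  (charge_integral (charge_Re mu_cm) (fun x => Im (f x)) +
   charge_integral (charge_Im mu_cm) (fun x => Re (f x))).

End complex_measure.

Section Re_norm.
Variable R : realType.

Lemma normRe (z : R[i]) : `|z| = (Re `|z|)%:C.
Proof. by rewrite normc_def. Qed.

Lemma normRe_ge0 (z : R[i]) : 0 <= Re `|z|.
Proof. by rewrite -lecR -normRe; exact: normr_ge0. Qed.

Lemma normReD (z w : R[i]) : Re `|z + w| <= Re `|z| + Re `|w|.
Proof. by rewrite -lecR rmorphD/= -!normRe ler_normD. Qed.

Lemma normReM (z w : R[i]) : Re `|z * w| = Re `|z| * Re `|w|.
Proof. by apply: complexI; rewrite rmorphM/= -!normRe normrM. Qed.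

Lemma normRe_le (z : R[i]) : Re `|z| <= `|Re z| + `|Im z|.
Proof.
case: z => a b; have -> : a +i* b = a%:C + (0 +i* b) :> R[i].
  by rewrite [RHS]/= /GRing.add/= addr0 add0r.
apply: le_trans (normReD _ _) _.
by rewrite !normc_def/= expr0n/= addr0 !add0r addr0 !sqrtr_sqr.
Qed.

End Re_norm.

Section total_variation_lemmas.
Context d (T : measurableType d) (R : realType).
Implicit Types (mu nu : set T -> R[i]) (E F : set T).

Lemma le_total_variation1 mu E :
  measurable E -> ((Re `|mu E|)%:E <= total_variation mu E)%E.
Proof.
move=> mE; apply: ereal_sup_ubound; exists 1%N, (fun=> E); split => //.
- by apply/trivIsetP => i j _ _; rewrite !ord1.
- by apply/seteqP; split => [x [i _]//|x Ex]; exists ord0.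
- by rewrite big_ord1.
Qed.

Lemma total_variation_ge0 mu E : measurable E -> (0 <= total_variation mu E)%E.
Proof.
move=> mE; apply: le_trans (le_total_variation1 _ mE).
by rewrite lee_fin normRe_ge0.
Qed.

Lemma le_total_variation mu E F : measurable E -> measurable F ->
  E `<=` F -> (total_variation mu E <= total_variation mu F)%E.
Proof.
move=> mE mF EF; apply: ge_ereal_sup => _ [n [A [mA tA AE ->]]].
pose B (i : 'I_n.+1) :=
  if unlift ord0 i is Some j then A j else F `\` E.
apply: (@le_trans _ _ (\sum_i Re `|mu (B i)|)%:E).
  rewrite lee_fin big_ord_recl/=; under [in leRHS]eq_bigr do rewrite /B liftK.
  by rewrite lerDr; exact: normRe_ge0.
apply: ereal_sup_ubound; exists n.+1, B; split => //.
- by move=> i; rewrite /B; case: unliftP => [j _|_]; [exact: mA|exact: measurableD].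
- apply/trivIsetP => i j _ _; rewrite /B.
  have AFE k : A k `&` (F `\` E) = set0.
    rewrite -AE setDE setIC -setIA (_ : _ `&` A k = set0) ?setI0//.
    by apply/seteqP; split => // x [nAx Akx]; apply: nAx; exists k.
  case: unliftP => [i' ->|->]; case: unliftP => [j' ->|->]; rewrite ?eqxx// => ij.
  + by move/trivIsetP : tA; apply => //; apply: contra ij => /eqP ->.
  + by rewrite setIC.
- apply/seteqP; split => [x [i _]|x Fx]; rewrite /B.
    case: unliftP => [j _ Ajx|_ []//]; apply: EF.
    by rewrite -AE; exists j.
  have [|nEx] := pselect (E x).
    by rewrite -AE => -[j _ Ajx]; exists (lift ord0 j); rewrite ?liftK.
  by exists ord0 => //; rewrite unlift_none.
Qed.

Lemma total_variationD mu nu E : measurable E ->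
  (total_variation (mu + nu)%R E <= total_variation mu E + total_variation nu E)%E.
Proof.
move=> mE; apply: ge_ereal_sup => _ [n [A [mA tA AE ->]]].
apply: (@le_trans _ _
  ((\sum_i Re `|mu (A i)|)%:E + (\sum_i Re `|nu (A i)|)%:E)%E).
  by rewrite -EFinD lee_fin -big_split/= ler_sum// => i _; exact: normReD.
by apply: leeD; apply: ereal_sup_ubound; exists n, A.
Qed.

Lemma total_variationZ_le (a : R[i]) mu E : measurable E ->
  (total_variation (a *: mu)%R E <= (Re `|a|)%:E * total_variation mu E)%E.
Proof.
move=> mE; apply: ge_ereal_sup => _ [n [A [mA tA AE ->]]].
apply: (@le_trans _ _ ((Re `|a|)%:E * (\sum_i Re `|mu (A i)|)%:E)%E).
  by rewrite -EFinM lee_fin mulr_sumr ler_sum// => i _; rewrite -normReM.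
apply: lee_wpmul2l; first by rewrite lee_fin normRe_ge0.
by apply: ereal_sup_ubound; exists n, A.
Qed.

Lemma total_variation_fin_num mu E : is_complex_measure mu -> measurable E ->
  total_variation mu E \is a fin_num.
Proof.
move=> mu_cm mE; rewrite ge0_fin_numE ?total_variation_ge0//.
pose vR : {measure set T -> \bar R} := charge_variation (hahn_posneg (charge_Re mu_cm)).
pose vI : {measure set T -> \bar R} := charge_variation (hahn_posneg (charge_Im mu_cm)).
apply: (@le_lt_trans _ _ (vR E + vI E)%E); last first.
  by rewrite lte_add_pinfty// -ge0_fin_numE//; exact: fin_num_measure.
apply: ge_ereal_sup => _ [n [A [mA tA AE ->]]].
have sumE (f : 'I_n -> \bar R) : (\sum_(i \in setT) f i = \sum_i f i)%E.
  rewrite (_ : [set: 'I_n] = [set` index_enum 'I_n]); last first.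
    by apply/seteqP; split => // i _; exact: mem_index_enum.
  by rewrite -fsbig_seq// index_enum_uniq.
have vE (v : {measure set T -> \bar R}) : v E = (\sum_i v (A i))%E.
  by rewrite -AE measure_fin_bigcup//; exact: finite_finset.
rewrite (vE vR) (vE vI) -big_split/= -sumEFin lee_sum// => i _.
apply: le_trans (leeD (abse_charge_variation _ (mA i))
                      (abse_charge_variation _ (mA i))).
by rewrite /charge_Re /charge_Im/= -EFinD lee_fin; exact: normRe_le.
Qed.

Lemma total_variationZ (a : R[i]) mu E : is_complex_measure mu ->
  measurable E ->
  total_variation (a *: mu)%R E = ((Re `|a|)%:E * total_variation mu E)%E.
Proof.
move=> mu_cm mE; apply/le_anti/andP; split; first exact: total_variationZ_le.
have [->|a0] := eqVneq a 0.
  by rewrite normr0 mul0e total_variation_ge0.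
have na0 : 0 < Re `|a| by rewrite -ltcR -normRe normr_gt0.
rewrite -{1}[mu](scalerK a0).
apply: (@le_trans _ _ ((Re `|a|)%:E * ((Re `|a^-1|)%:E *
                        total_variation (a *: mu)%R E))%E).
  by rewrite lee_pmul2l ?lte_fin// total_variationZ_le.
by rewrite muleA -EFinM -normReM mulfV// normr1 mul1e.
Qed.

End total_variation_lemmas.

Section measure_algebra.
Context (R : realType) (G : lcGroupType).

Local Notation borel := (g_sigma_algebraType (@open G)).
Local Notation mborel := (@open G).-sigma.-measurable.

Implicit Types mu nu : set borel -> R[i].

Definition is_regular mu := forall E : set G, mborel E ->
  forall e : R, 0 < e -> exists K U : set G,
    [/\ compact K, open U, K `<=` E, E `<=` U &
        (total_variation mu (U `\` K) < e%:E)%E].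

Definition regular_complex_measure : {pred (set borel -> R[i])} :=
  mem [set mu | is_complex_measure mu /\ is_regular mu].

Lemma borel_open (U : set G) : open U -> mborel U.
Proof. exact: sub_sigma_algebra. Qed.

Lemma borel_compact (K : set G) : compact K -> mborel K.
Proof.
move=> /(compact_closed lcgroup_hausdorff) cK; rewrite -(setCK K).
by apply: measurableC; apply: borel_open; rewrite openC.
Qed.

Lemma regular_complex_measure_submod : submod_closed regular_complex_measure.
Proof.
split=> [|a mu nu].
  rewrite inE; split; first split => //.
    move=> F _ _; rewrite (_ : (fun n => _) = cst 0); first exact: cvg_cst.
    by apply/funext => n /=; rewrite big1.
  move=> E mE e e0; exists set0, setT; split => //.
  - exact: compact0.
  - exact: openT.
  rewrite setD0 -(scale0r (0 : set borel -> R[i])).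
  apply: le_lt_trans (total_variationZ_le _ _ measurableT) _.
  by rewrite normr0 mul0e lte_fin.
rewrite !inE => -[[mu0 mun muF] mur] [[nu0 nun nuF] nur].
split; first split.
- by change (a * mu set0 + nu set0 = 0); rewrite mu0 nu0 mulr0 addr0.
- move=> E nE; change (a * mu E + nu E = 0).
  by rewrite mun// nun// mulr0 addr0.
- move=> F mF tF.
  rewrite (_ : (fun n => _) = (fun n => a *: (\sum_(0 <= k < n) mu (F k) : R[i]^o) +
      (\sum_(0 <= k < n) nu (F k) : R[i]^o))); last first.
    by apply/funext => n; rewrite scaler_sumr -big_split.
  apply: (@cvgD _ R[i]^o); last exact: nuF.
  by apply: (@cvgZl_tmp _ R[i]^o); exact: muF.
move=> E mE e e0.
have a0 : 0 <= Re `|a| by exact: normRe_ge0.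
have d0 : 0 < e / (Re `|a| + 1) / 2 by rewrite !divr_gt0// ltr_wpDl.
have [K1 [U1 [cK1 oU1 K1E EU1 tv1]]] := mur E mE _ d0.
have e20 : 0 < e / 2 by rewrite divr_gt0.
have [K2 [U2 [cK2 oU2 K2E EU2 tv2]]] := nur E mE _ e20.
exists (K1 `|` K2), (U1 `&` U2); split.
- exact: compactU.
- exact: openI.
- by rewrite subUset.
- by rewrite subsetI.
have mUK (K U : set G) : compact K -> open U -> mborel (U `\` K).
  by move=> cK oU; apply: measurableD; [exact: borel_open|exact: borel_compact].
have mU : mborel ((U1 `&` U2) `\` (K1 `|` K2)).
  by apply: mUK; [exact: compactU|exact: openI].
apply: le_lt_trans (total_variationD _ _ mU) _.
have : (total_variation (a *: mu)%R ((U1 `&` U2) `\` (K1 `|` K2)) <= (e / 2)%:E)%E.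
  apply: le_trans (total_variationZ_le _ _ mU) _.
  apply: (@le_trans _ _ ((Re `|a|)%:E * (e / (Re `|a| + 1) / 2)%:E)%E).
    apply: lee_pmul => //; first exact: total_variation_ge0.
    apply: le_trans (ltW tv1); apply: le_total_variation => //.
      exact: mUK.
    by move=> x [[U1x _] nK]; split => // K1x; apply: nK; left.
  rewrite -EFinM lee_fin mulrA ler_pM2r// mulrA ler_pdivrMr ?ltr_wpDl//.
  by rewrite mulrC ler_pM2l// lerDl.
have : (total_variation nu ((U1 `&` U2) `\` (K1 `|` K2)) < (e / 2)%:E)%E.
  apply: le_lt_trans tv2; apply: le_total_variation => //.
    exact: mUK.
  by move=> x [[_ U2x] nK]; split => // K2x; apply: nK; right.
move=> h1 h2; rewrite [e in ltRHS]splitr EFinD.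
by apply: lee_ltD => //; rewrite ge0_fin_numE ?total_variation_ge0//; apply: le_lt_trans h2 _; rewrite ltry.
Qed.

HB.instance Definition _ := GRing.isSubmodClosed.Build _ _
  regular_complex_measure regular_complex_measure_submod.

Record measure_algebra := MeasureAlgebra {
  cmeasure :> set borel -> R[i] ;
  cmeasureP : cmeasure \in regular_complex_measure }.

HB.instance Definition _ := [isSub for cmeasure].
HB.instance Definition _ := [Choice of measure_algebra by <:].
HB.instance Definition _ := [SubChoice_isSubLmodule of measure_algebra by <:].

Lemma cmeasure_complex (mu : measure_algebra) : is_complex_measure mu.
Proof. by have := cmeasureP mu; rewrite inE => -[]. Qed.

Definition tv_norm (mu : measure_algebra) : R[i] :=
  (fine (total_variation mu setT))%:C.

Let tv_fin (mu : measure_algebra) : total_variation mu setT \is a fin_num.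
Proof. by apply: total_variation_fin_num => //; exact: cmeasure_complex. Qed.

Lemma tv_norm_ler_normD (mu nu : measure_algebra) :
  tv_norm (mu + nu) <= tv_norm mu + tv_norm nu.
Proof.
rewrite -rmorphD/= lecR -fineD ?tv_fin//.
have tvD : (total_variation (mu + nu)%R setT <=
    total_variation mu setT + total_variation nu setT)%E.
  exact: (@total_variationD _ _ _ mu nu).
by rewrite fine_le ?fin_numD ?tv_fin//=.
Qed.

Lemma tv_normZ (a : R[i]) (mu : measure_algebra) :
  tv_norm (a *: mu) = `|a| * tv_norm mu.
Proof.
rewrite /tv_norm [total_variation _ _](@total_variationZ _ _ _ a mu) //;
  last exact: cmeasure_complex.
by rewrite fineM ?tv_fin// [fine (Re _)%:E]/= rmorphM [LHS]/= -normRe.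
Qed.

Lemma tv_norm0_eq0 (mu : measure_algebra) : tv_norm mu = 0 -> mu = 0.
Proof.
move=> mu0; apply: val_inj; apply/funext => E /=.
have [mE|nE] := pselect (mborel E); last by have [_ ->] := cmeasure_complex mu.
have tv0 : (total_variation mu setT <= 0)%E.
  rewrite -(@fineK _ (total_variation mu setT)) ?tv_fin//.
  by rewrite (_ : fine _ = 0)//; exact: (@complexI R).
apply/eqP; rewrite -normr_eq0 normc_def; apply/eqP; congr (_%:C).
apply/eqP; rewrite eq_le sqrtr_ge0 andbT -lee_fin.
apply: le_trans tv0; apply: le_trans (le_total_variation mu mE _ _) => //.
by have := le_total_variation1 mu mE; rewrite normc_def.
Qed.

HB.instance Definition _ := Lmodule_isNormed.Build R[i] measure_algebra
  tv_norm_ler_normD tv_normZ tv_norm0_eq0.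

(* (mu * nu)(E) is the integral of 1_E(xy) with respect to mu(dx), then nu(dy);
   x |-> 1_E(xy) and, by regularity of mu, y |-> mu(E y^-1) are Borel. *)
Definition convolution_fun (mu nu : measure_algebra) : set borel -> R[i] :=
  fun E => if `[< mborel E >] then
    complex_integral (cmeasure_complex nu) (fun y =>
      complex_integral (cmeasure_complex mu) (fun x =>
        (\1_E ((x : G) * (y : G))%g)%:C))
  else 0.

(* The convolution of two regular complex measures is one, so that the default
   value 0 is never taken. *)
Definition convolution (mu nu : measure_algebra) : measure_algebra :=
  insubd 0 (convolution_fun mu nu).

Definition left_ideal (I : set measure_algebra) :=
  [/\ I 0,
      forall (a : R[i]) (mu nu : measure_algebra), I mu -> I nu -> I (a *: mu + nu) &
      forall mu nu : measure_algebra, I nu -> I (convolution mu nu)].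

Definition minimal_left_ideal (I : set measure_algebra) :=
  [/\ left_ideal I, I <> [set 0] &
      forall J, left_ideal J -> J `<=` I -> J = [set 0] \/ J = I].

(* Without minimal left ideals this is the smallest left ideal, namely 0. *)
Definition left_socle : set measure_algebra :=
  smallest left_ideal (\bigcup_(I in minimal_left_ideal) I).

End measure_algebra.

Arguments left_socle : clear implicits.

(* Main.v *)
From HB Require Import structures.
Require Import Defs.
From mathcomp Require Import all_boot all_order all_algebra.
From mathcomp Require Import all_classical all_reals all_analysis.
From mathcomp Require Import measurable_realfun complex ring lra.
Import Order.TTheory GRing.Theory Num.Theory.
Import numFieldNormedType.Exports.

(** Write [M] for the measure algebra of [G]. The argument has two halves:
    the hypotheses force the unit of [M], the point mass at the identity, into
    the socle, and a unit in the socle forces [G] to be finite.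

    The first half is ring theory once [M] is known to be semiprime, that is,
    [nu * mu * nu = 0] for all [mu] only if [nu = 0]
    ([measure_algebra_semiprime]). Every minimal left ideal then contains a
    nonzero idempotent. If the unit were not in the socle, an idempotent [p] of
    the socle would always leave room for a further one orthogonal to it, since
    the nonzero left ideal generated by [1 - p] contains a minimal one; this
    gives an infinite sequence of orthogonal idempotents [e_i] in the socle. A
    norm-convergent sum
    [s = sum c_i e_i] with [c_i > 0] stays in the closed socle
    ([orthogonal_limit]), so [s] is a finite sum of elements of minimal left
    ideals. But [e_i s e_j] is [c_i e_i] for [i = j] and [0] otherwise, and
    finitely many minimal left ideals cannot support such an infinite diagonal
    ([no_infinite_diagonal], [one_in_socle]).

    For the second half ([unit_in_socle_finite]), the unit is a finite sum of
    elements [nu_i] of minimal left ideals [L_i]. If a left ideal [I] misses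
    the unit, then it misses some [nu_i], and [L_i] meets [I] in [0]. Take first
    for [I] the measures without atoms: [m * nu_i] is in both [L_i] and [I] when
    [m] is in [I], hence it is [0], and looking at it near an atom of [nu_i]
    shows that [m = 0] ([diffuse_annihilates]). So every nonzero measure has an
    atom. Take then for [I] the measures of total mass [0]: it contains
    [(delta x - 1) * nu_i], so [nu_i] is left invariant. All points have the
    same mass under [nu_i], this mass is not [0], and the variation of [nu_i] is
    finite; therefore [G] is finite.

    Semiprimeness is the analytic core. Let [T h (z)] be the integral of
    [x |-> h (z x)] against [nu]. If [nu * delta t * nu = 0] for all [t], then
    [T S T = 0] for every superposition [S] of right translations, in particular
    for the adjoint [T'] of [T] with respect to a right Haar functional. From
    [T T' T = 0] follow [|T' T f|^2 = <T T' T f, T f> = 0] and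
    [|T f|^2 = <T' T f, f> = 0], so that [nu = 0]. Finite combinations of point
    masses take the place of [nu] here, which keeps every operator a finite sum
    of translations and makes the two identities approximate
    ([discrete_sandwich], [ip_act_bound]). The Haar functional is Weil's limit
    of covering numbers ([right_haar_functional]).

    It remains that [M] is a ring in which suitable series converge: the
    convolution of two regular measures is regular ([radon_conv]), it satisfies
    Fubini's formula ([J_convolution]), and Cauchy sequences for the total
    variation have limits ([tvn_limit]). *)

Set Implicit Arguments.
Unset Strict Implicit.
Unset Printing Implicit Defensive.

Local Open Scope classical_set_scope.
Local Open Scope ring_scope.
Local Open Scope complex_scope.

Local Notation Re := complex.Re.
Local Notation Im := complex.Im.
Local Notation total_variation := Defs.total_variation.

(** * Idempotents in the socle of a semiprime ring *)
Section socle.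
Variable A : nzRingType.
Implicit Types (I J L : set A) (x y a : A).

Definition lideal I := [/\ I 0, forall x y, I x -> I y -> I (x + y) &
  forall a x, I x -> I (a * x)].

Definition minimal_lideal L := [/\ lideal L, L <> [set 0] &
  forall J, lideal J -> J `<=` L -> J = [set 0] \/ J = L].

(** Sums over lists rather than over families of ideals, so that adding two of
    them is concatenation. *)
Definition socle x := exists2 s : seq A,
  (forall y, y \in s -> exists2 L, minimal_lideal L & L y) & x = \sum_(y <- s) y.

Lemma lidealN I x : lideal I -> I x -> I (- x).
Proof. by move=> [_ _ IM] Ix; rewrite -mulN1r; exact: IM. Qed.

Lemma lidealB I x y : lideal I -> I x -> I y -> I (x - y).
Proof. by move=> hI Ix Iy; case: (hI) => _ ID _; apply: ID => //; exact: lidealN. Qed.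

Lemma lidealI I J : lideal I -> lideal J -> lideal (I `&` J).
Proof.
move=> [I0 ID IM] [J0 JD JM]; split => //.
  by move=> x y [? ?] [? ?]; split; [exact: ID|exact: JD].
by move=> a x [? ?]; split; [exact: IM|exact: JM].
Qed.

Lemma principal_lideal x : lideal (range (fun a => a * x)).
Proof.
split; first by exists 0 => //; rewrite mul0r.
  by move=> _ _ [a _ <-] [b _ <-]; exists (a + b) => //; rewrite mulrDl.
by move=> b _ [a _ <-]; exists (b * a) => //; rewrite mulrA.
Qed.

Lemma lideal_nz I : lideal I -> I <> [set 0] -> exists2 x, I x & x != 0.
Proof.
move=> [I0 _ _] nI; apply: contrapT => h; apply: nI; apply/seteqP; split => [x Ix|_ ->//].
by apply/eqP; apply: contrapT => /negP x0; apply: h; exists x.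
Qed.

Lemma minimal_generated L x : minimal_lideal L -> L x -> x != 0 ->
  L = range (fun a => a * x).
Proof.
move=> [hL _ minL] Lx x0; case: (minL _ (principal_lideal x)) => //.
- by move=> _ [a _ <-]; case: hL => _ _; apply.
- move=> h; have : [set 0] x by rewrite -h; exists 1 => //; rewrite mul1r.
  by move=> /eqP; rewrite (negbTE x0).
Qed.

Lemma socle0 : socle 0.
Proof. by exists [::]; rewrite ?big_nil. Qed.

Lemma socleD x y : socle x -> socle y -> socle (x + y).
Proof.
move=> [s hs ->] [t ht ->]; exists (s ++ t); last by rewrite big_cat.
by move=> z; rewrite mem_cat => /orP[]; [exact: hs|exact: ht].
Qed.

Lemma socleM a x : socle x -> socle (a * x).
Proof.
move=> [s hs ->]; exists [seq a * y | y <- s]; last by rewrite big_map mulr_sumr.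
move=> _ /mapP[y /hs[L mL Ly] ->]; exists L => //.
by case: mL => -[_ _ +] _ _; apply.
Qed.

Lemma socle_minimal L x : minimal_lideal L -> L x -> socle x.
Proof.
move=> mL Lx; exists [:: x]; last by rewrite big_seq1.
by move=> y; rewrite inE => /eqP ->; exists L.
Qed.

Lemma socle_lideal : lideal socle.
Proof. by split; [exact: socle0|exact: socleD|exact: socleM]. Qed.

(** Brauer's argument. By minimality [L y = L], so [y = e y] for some [e] in
    [L]; then [e^2 - e] kills [y], while the elements of [L] killing [y] form a
    left ideal that misses [e] and is therefore [0]. *)
Lemma minimal_idempotent L x y : minimal_lideal L -> L x -> L y -> x * y != 0 ->
  exists e, [/\ L e, e != 0 & e * e = e].
Proof.
move=> mL Lx Ly xy0; have hL : lideal L by case: mL.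
have [_ _ LM] := hL; have Lxy : L (x * y) by exact: LM.
have Lr : lideal [set z | exists2 w, L w & z = w * y].
  split; first by exists 0; [case: hL|rewrite mul0r].
    by move=> _ _ [u Lu ->] [v Lv ->]; exists (u + v); [case: hL => _ + _; apply|rewrite mulrDl].
  by move=> a _ [u Lu ->]; exists (a * u); [exact: LM|rewrite mulrA].
have y0 : y != 0 by apply: contraNneq xy0 => ->; rewrite mulr0.
have [e Le ey] : exists2 e, L e & y = e * y.
  suff : [set z | exists2 w, L w & z = w * y] y by case=> e; exists e.
  have [|h|->//] := (let: And3 _ _ m := mL in m) _ Lr.
    by move=> _ [u Lu ->]; exact: LM.
  have : [set 0] (x * y) by rewrite -h; exists x.
  by move=> /eqP; rewrite (negbTE xy0).
have e0 : e != 0 by apply: contraNneq y0 => e0; rewrite ey e0 mul0r.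
exists e; split => //; apply/eqP; rewrite -subr_eq0; apply/eqP.
have annL : lideal [set z | L z /\ z * y = 0].
  split; first by split; [case: hL|rewrite mul0r].
    by move=> u v [Lu uy] [Lv vy]; split; [case: hL => _ + _; apply|rewrite mulrDl uy vy addr0].
  by move=> a u [Lu uy]; split; [exact: LM|rewrite -mulrA uy mulr0].
have [|h|h] := (let: And3 _ _ m := mL in m) _ annL; first by move=> z [].
  have : [set z | L z /\ z * y = 0] (e * e - e).
    split; first by apply: lidealB => //; exact: LM.
    by rewrite mulrBl -mulrA -ey -ey subrr.
  by rewrite h.
have : L e by []. rewrite -h => -[_ ey0].
by move: y0; rewrite ey ey0 eqxx.
Qed.

Hypothesis semiprime : forall x, x != 0 -> exists y, x * y * x != 0.

(** Semiprimeness provides a nonzero product [x (y x)] of two elements of [L]. *)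
Lemma minimal_has_idempotent L : minimal_lideal L -> exists e, [/\ L e, e != 0 & e * e = e].
Proof.
move=> mL; have [hL nL _] := mL; have [x Lx x0] := lideal_nz hL nL.
have [y xyx] := semiprime x0; apply: (@minimal_idempotent L x (y * x)) => //.
  by case: hL => _ _; apply.
by rewrite mulrA.
Qed.

Hypothesis essential : forall I, lideal I -> I <> [set 0] ->
  exists2 L, minimal_lideal L & L `<=` I.

(** A minimal left ideal inside [A (1 - p)] has an idempotent [e], and
    [e p = 0]; passing to [(1 - p) e] also gives orthogonality on the other
    side and keeps idempotency, because [e (1 - p) = e]. *)
Lemma next_idempotent p : p * p = p -> p != 1 ->
  exists e, [/\ socle e, e != 0, e * e = e, e * p = 0 & p * e = 0].
Proof.
move=> pp p1; pose f := 1 - p.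
have ff : f * f = f by rewrite mulrBl mul1r mulrBr mulr1 pp subrr subr0.
have f0 : f != 0 by rewrite subr_eq0 eq_sym.
have fp : f * p = 0 by rewrite mulrBl mul1r pp subrr.
have pf : p * f = 0 by rewrite mulrBr mulr1 pp subrr.
have [|L mL Lf] := essential (principal_lideal f).
  move=> h; have : [set 0] f by rewrite -h; exists 1 => //; rewrite mul1r.
  by move=> /eqP; rewrite (negbTE f0).
have [e [Le e0 ee]] := minimal_has_idempotent mL.
have ef : e * f = e by have [a _ <-] := Lf _ Le; rewrite -mulrA ff.
exists (f * e); split.
- by apply: socleM; exact: socle_minimal Le.
- by apply: contraNneq e0 => h; rewrite -ee -{1}ef -mulrA h mulr0.
- by rewrite mulrA -(mulrA f e f) ef -mulrA ee.
- by rewrite -mulrA -ef -mulrA fp !mulr0.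
- by rewrite mulrA pf mul0r.
Qed.

(** The partial sums of the sequence are idempotents of the socle, hence never
    [1], and each new term is chosen orthogonal to the partial sum before it. *)
Lemma orthogonal_sequence : ~ socle 1 -> exists e : nat -> A,
  [/\ forall i, socle (e i), forall i, e i != 0, forall i, e i * e i = e i &
     forall i j, i != j -> e i * e j = 0].
Proof.
move=> n1.
pose T := {p : A | socle p /\ p * p = p}.
have step (p : T) : exists e, [/\ socle e, e != 0, e * e = e, e * sval p = 0 & sval p * e = 0].
  case: p => p /= [Sp pp]; apply: next_idempotent => //.
  by apply/eqP => p1; apply: n1; rewrite -p1.
have [nx hnx] := choice step.
have nxt (p : T) : socle (sval p + nx p) /\ (sval p + nx p) * (sval p + nx p) = sval p + nx p.
  have [Se e0 ee ep pe] := hnx p; have [Sp pp] := svalP p.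
  by split; [exact: socleD|rewrite mulrDl !mulrDr pp ee ep pe addr0 add0r].
pose p0 : T := exist _ 0 (conj socle0 (mul0r 0)).
pose P (n : nat) : T := iter n (fun p => exist _ (sval p + nx p) (nxt p)) p0.
have PS n : sval (P n.+1) = sval (P n) + nx (P n) by [].
have Pe n i : (i < n)%N -> sval (P n) * nx (P i) = nx (P i) /\ nx (P i) * sval (P n) = nx (P i).
  elim: n => // n IH; rewrite PS ltnS leq_eqVlt => /orP[/eqP ->|/[dup] lt /IH[h1 h2]].
    by have [_ _ ee ep pe] := hnx (P n); rewrite mulrDl mulrDr ee ep pe add0r.
  have [_ _ ee ep pe] := hnx (P n).
  rewrite mulrDl mulrDr h1 h2 -[in nx (P n) * _]h1 mulrA ep mul0r.
  by rewrite -[in _ * nx (P n)]h2 -mulrA pe mulr0 !addr0.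
exists (fun n => nx (P n)); split.
- by move=> i; case: (hnx (P i)).
- by move=> i; case: (hnx (P i)).
- by move=> i; case: (hnx (P i)).
- move=> i j; rewrite neq_ltn => /orP[] lt.
    by have [_ <-] := Pe _ _ lt; rewrite -mulrA; case: (hnx (P j)) => _ _ _ _ ->; rewrite mulr0.
  by have [<- _] := Pe _ _ lt; rewrite mulrA; case: (hnx (P i)) => _ _ _ -> _; rewrite mul0r.
Qed.

(** Induction on the number of summands of [x]. If [e_i l <> 0] for a summand
    [l], then [l = a e_i l] for some [a] by minimality, so that multiplication
    by [1 - a e_i] on the left removes [l]; it changes no entry [e_j x e_k] with
    [j, k > i], since [e_i x e_k = 0]. If [e_i l = 0] for all [i], then [l] can
    be dropped. The induction hypothesis concerns the entries beyond some [m],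
    which grows with each removal. *)
Lemma no_infinite_diagonal (e : nat -> A) x : socle x ->
  (forall i, e i * x * e i != 0) -> (forall i j, i != j -> e i * x * e j = 0) -> False.
Proof.
move=> [s hs ->].
suff : forall (s : seq A) m, (forall y, y \in s -> exists2 L, minimal_lideal L & L y) ->
   (forall i, (m <= i)%N -> e i * (\sum_(y <- s) y) * e i != 0) ->
   (forall i j, (m <= i)%N -> (m <= j)%N -> i != j -> e i * (\sum_(y <- s) y) * e j = 0) -> False.
  by move=> /(_ s 0%N hs) h d0 dn; apply: h => *; [exact: d0|exact: dn].
move=> {hs} {}s; elim: {s}(size s) {-2}s (erefl (size s)) => [|n IH] s sn m hs d0 dn.
  by move: (d0 m (leqnn m)); rewrite (size0nil sn) big_nil mulr0 mul0r eqxx.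
case: s sn hs d0 dn => // l s [sn] hs d0 dn.
have hs' y : y \in s -> exists2 L, minimal_lideal L & L y.
  by move=> ys; apply: hs; rewrite inE ys orbT.
have [[i mi eil]|ne] := pselect (exists2 i, (m <= i)%N & e i * l != 0); last first.
  have el i : (m <= i)%N -> e i * l = 0.
    by move=> mi; apply/eqP; apply: contrapT => /negP h; apply: ne; exists i.
  apply: (IH s sn m hs') => [i mi|i j mi mj ij].
    by have := d0 i mi; rewrite big_cons mulrDr el// add0r.
  by have := dn i j mi mj ij; rewrite big_cons mulrDr el// add0r.
have [L mL Ll] : exists2 L, minimal_lideal L & L l by apply: hs; rewrite inE eqxx.
have LM : forall a x, L x -> L (a * x) by case: mL => -[].
have [a ael] : exists a, a * (e i * l) = l.
  have : L l by []. rewrite {1}(minimal_generated mL (LM _ _ Ll) eil).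
  by move=> [a _ al]; exists a.
pose b := 1 - a * e i.
have bl : b * l = 0 by rewrite mulrBl mul1r -mulrA ael subrr.
have bs : \sum_(y <- [seq b * y | y <- s]) y = b * \sum_(y <- l :: s) y.
  by rewrite big_map big_cons mulrDr bl add0r mulr_sumr.
have ebs j k : (i < j)%N -> (i < k)%N ->
    e j * (b * \sum_(y <- l :: s) y) * e k = e j * (\sum_(y <- l :: s) y) * e k.
  move=> ij ik; set S := \sum_(y <- _) y.
  rewrite mulrBl mul1r mulrBr mulrBl -[a * _ * S]mulrA -[RHS]subr0; congr (_ - _).
  rewrite -!mulrA [e i * (S * e k)]mulrA dn ?mulr0//; first exact: leq_trans (ltnW ik).
  by rewrite neq_ltn ik.
apply: (IH [seq b * y | y <- s] _ i.+1) => [|y /mapP[z zs ->]|j ij|j k ij ik jk].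
- by rewrite size_map.
- by have [L' mL' L'z] := hs' z zs; exists L' => //; case: mL' => -[_ _ +] _ _; apply.
- by rewrite bs ebs//; apply: d0; exact: leq_trans (ltnW ij).
- by rewrite bs ebs//; apply: dn => //; [exact: leq_trans (ltnW ij)|exact: leq_trans (ltnW ik)].
Qed.

(** The hypothesis stands for completeness: in a normed algebra with closed
    socle, [s] is a weighted sum of the [e i]. *)
Theorem one_in_socle :
  (forall e : nat -> A, (forall i, socle (e i)) -> (forall i, e i != 0) ->
    (forall i, e i * e i = e i) -> (forall i j, i != j -> e i * e j = 0) ->
    exists2 s, socle s & (forall i, e i * s * e i != 0) /\
      (forall i j, i != j -> e i * s * e j = 0)) ->
  socle 1.
Proof.
move=> limit; apply: contrapT => /orthogonal_sequence[e [Se e0 ee eo]].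
have [s Ss [d0 dn]] := limit e Se e0 ee eo.
exact: no_infinite_diagonal Ss d0 dn.
Qed.

End socle.

(** * Bounded measurable functions *)
Section real_bounded.
Context d (T : measurableType d) (R : realType).
Implicit Types (f g : T -> R) (p : {finite_measure set T -> \bar R})
  (nu : {charge set T -> \bar R}).

Definition bounded_measurable f :=
  measurable_fun setT f /\ exists M, forall x, `|f x| <= M.

Lemma bounded_integrable p f :
  bounded_measurable f -> p.-integrable setT (EFin \o f).
Proof.
move=> [mf [M fM]]; apply: measurable_bounded_integrable => //.
- by apply: fin_num_fun_lty; exact: fin_num_measure.
- exists M; split; first by rewrite num_real.
  by move=> y My x _; apply: le_trans (fM x) (ltW My).
Qed.

Lemma bounded_measurableD f g : bounded_measurable f -> bounded_measurable g ->
  bounded_measurable (fun x => f x + g x).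
Proof.
move=> [mf [M fM]] [mg [N gN]]; split; first exact: measurable_funD.
by exists (M + N) => x; apply: le_trans (ler_normD _ _) _; exact: lerD.
Qed.

Lemma bounded_measurableM f g : bounded_measurable f -> bounded_measurable g ->
  bounded_measurable (fun x => f x * g x).
Proof.
move=> [mf [M fM]] [mg [N gN]]; split; first exact: measurable_funM.
by exists (M * N) => x; rewrite normrM ler_pM.
Qed.

Lemma bounded_measurable_cst (r : R) : bounded_measurable (fun=> r).
Proof. by split; [exact: measurable_cst|exists `|r|]. Qed.

Lemma bounded_measurableZ (r : R) f : bounded_measurable f ->
  bounded_measurable (fun x => r * f x).
Proof. by move=> fb; apply: bounded_measurableM => //; exact: bounded_measurable_cst. Qed.

Lemma bounded_measurableN f : bounded_measurable f ->
  bounded_measurable (fun x => - f x).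
Proof.
by move=> [mf [M fM]]; split; [exact: measurableT_comp|exists M => x; rewrite normrN].
Qed.

Lemma bounded_measurable_indic E : measurable E ->
  bounded_measurable (\1_E : T -> R).
Proof.
move=> mE; split; first exact: measurable_indic.
by exists 1 => x; rewrite indicE ger0_norm; case: (_ \in _).
Qed.

Lemma charge_integralD nu f g : bounded_measurable f -> bounded_measurable g ->
  charge_integral nu (fun x => f x + g x) =
  charge_integral nu f + charge_integral nu g.
Proof.
move=> fb gb; rewrite /charge_integral !RintegralD//;
  try exact: bounded_integrable.
by rewrite opprD addrACA.
Qed.

Lemma charge_integralZ nu r f : bounded_measurable f ->
  charge_integral nu (fun x => r * f x) = r * charge_integral nu f.
Proof.
move=> fb; rewrite /charge_integral !RintegralZl//;
  try exact: bounded_integrable.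
by rewrite mulrBr.
Qed.

Lemma Rintegral_indicT p E : measurable E ->
  Rintegral p setT (\1_E : T -> R) = fine (p E).
Proof. by move=> mE; rewrite /Rintegral integral_indic// setIT. Qed.

Lemma charge_integral_indic nu E : measurable E ->
  charge_integral nu (\1_E : T -> R) = fine (nu E).
Proof.
move=> mE; rewrite /charge_integral !Rintegral_indicT//.
rewrite (jordan_decomp (hahn_posneg nu) mE) /cadd/= cscaleN1 fineB//;
  exact: fin_num_measure.
Qed.

Lemma le_Rintegral_ext p f (h : T -> \bar R) : bounded_measurable f ->
  measurable_fun setT h -> (forall x, `|f x|%:E <= h x)%E ->
  (`|Rintegral p setT f|%:E <= \int[p]_x h x)%E.
Proof.
move=> fb mh fh; have fi := bounded_integrable p fb.
apply: (@le_trans _ _ (\int[p]_x `|(f x)%:E|)%E).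
  rewrite /Rintegral -fine_abse; last exact: integrable_fin_num.
  rewrite fineK; last by rewrite abse_fin_num integrable_fin_num.
  by apply: le_abse_integral => //; apply/measurable_EFinP; case: fb.
apply: ge0_le_integral => //.
  by apply/measurableT_comp => //; apply/measurable_EFinP; case: fb.
by move=> x _; rewrite abse_EFin; exact: fh.
Qed.

End real_bounded.

Section complex_bounded.
Context d (T : measurableType d) (R : realType).
Implicit Types (f g : T -> R[i]).

Definition cbounded_measurable g :=
  bounded_measurable (fun x => Re (g x)) /\
  bounded_measurable (fun x => Im (g x)).

Lemma Re_add (z w : R[i]) : Re (z + w) = Re z + Re w.
Proof. exact: raddfD. Qed.
Lemma Im_add (z w : R[i]) : Im (z + w) = Im z + Im w.
Proof. exact: raddfD. Qed.
Lemma Re_mul (z w : R[i]) : Re (z * w) = Re z * Re w - Im z * Im w.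
Proof. by case: z w => [a b] [c e]. Qed.
Lemma Im_mul (z w : R[i]) : Im (z * w) = Re z * Im w + Im z * Re w.
Proof. by case: z w => [a b] [c e]. Qed.

Lemma abs_Re_le (z : R[i]) : `|Re z| <= Re `|z|.
Proof.
case: z => a b; rewrite normc_def/= -sqrtr_sqr ler_wsqrtr//.
by rewrite lerDl sqr_ge0.
Qed.

Lemma abs_Im_le (z : R[i]) : `|Im z| <= Re `|z|.
Proof.
case: z => a b; rewrite normc_def/= -sqrtr_sqr ler_wsqrtr//.
by rewrite lerDr sqr_ge0.
Qed.

Lemma normRe_real (x : R) : Re `|x%:C| = `|x|.
Proof. by rewrite normc_def/= expr0n addr0 sqrtr_sqr. Qed.

Lemma cbounded_measurableD f g : cbounded_measurable f ->
  cbounded_measurable g -> cbounded_measurable (fun x => f x + g x).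
Proof.
move=> [f1 f2] [g1 g2]; split.
  by under eq_fun do rewrite Re_add; exact: bounded_measurableD.
by under eq_fun do rewrite Im_add; exact: bounded_measurableD.
Qed.

Lemma cbounded_measurableZ (a : R[i]) f : cbounded_measurable f ->
  cbounded_measurable (fun x => a * f x).
Proof.
move=> [f1 f2]; split.
  under eq_fun do rewrite Re_mul; apply: bounded_measurableD.
    exact: bounded_measurableZ.
  by apply: bounded_measurableN; exact: bounded_measurableZ.
under eq_fun do rewrite Im_mul.
by apply: bounded_measurableD; exact: bounded_measurableZ.
Qed.

Lemma cbounded_measurable_real (f : T -> R) : bounded_measurable f ->
  cbounded_measurable (fun x => (f x)%:C).
Proof. by move=> fb; split => //; exact: bounded_measurable_cst. Qed.

Lemma cbounded_measurable_indic E : measurable E ->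
  cbounded_measurable (fun x => (\1_E x : R)%:C).
Proof. by move=> mE; apply/cbounded_measurable_real/bounded_measurable_indic. Qed.

Lemma cbounded_measurable_bound g : cbounded_measurable g ->
  exists M, forall x, Re `|g x| <= M.
Proof.
move=> [[_ [M gM]] [_ [N gN]]]; exists (M + N) => x.
by apply: le_trans (normRe_le _) _; exact: lerD.
Qed.

Lemma cbounded_measurableP g : measurable_fun setT (fun x => Re (g x)) ->
  measurable_fun setT (fun x => Im (g x)) ->
  (exists M, forall x, Re `|g x| <= M) -> cbounded_measurable g.
Proof.
move=> m1 m2 [M gM]; split; split => //; exists M => x.
  exact: le_trans (abs_Re_le _) (gM x).
exact: le_trans (abs_Im_le _) (gM x).
Qed.

(** The number of [k < N] with [k + 1 <= y] is the integer part of [y] when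
    [y <= N], hence within [1] of [y]. *)
Lemma step_count (y : R) N : 0 <= y ->
  (N%:R <= y -> \sum_(k < N) ((k.+1%:R <= y)%R : nat)%:R = N%:R :> R) /\
  (y <= N%:R -> y - 1 <= \sum_(k < N) ((k.+1%:R <= y)%R : nat)%:R <= y).
Proof.
move=> y0; elim: N => [|N [IH1 IH2]].
  rewrite big_ord0; split => // yle; have -> : y = 0 by apply/le_anti/andP.
  by rewrite sub0r lerN10 lexx.
rewrite big_ord_recr/=; split => [Ny|yN].
  rewrite Ny IH1; first by rewrite natr1.
  by apply: le_trans Ny; rewrite ler_nat.
have [yleN|Nlty] := leP y N%:R.
  have -> : (N.+1%:R <= y) = false.
    by apply/negbTE; rewrite -ltNge; apply: le_lt_trans yleN _; rewrite ltr_nat.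
  by rewrite addr0 IH2.
rewrite IH1 ?(ltW Nlty)//; have [Sy|Sy] := leP N.+1%:R y.
  by rewrite natr1 (le_trans _ Sy)//= lerBlDr (le_trans yN)// lerDl.
by rewrite addr0 (ltW Nlty) andbT lerBlDr natr1.
Qed.

Section induction.
Variable P : (T -> R[i]) -> Prop.
Hypothesis P_indic : forall E, measurable E -> P (fun x => (\1_E x : R)%:C).
Hypothesis P_lin : forall a f g, cbounded_measurable f ->
  cbounded_measurable g -> P f -> P g -> P (fun x => a * f x + g x).
Hypothesis P_lim : forall f, cbounded_measurable f ->
  (forall e : R, 0 < e -> exists g,
     [/\ cbounded_measurable g, P g & forall x, Re `|f x - g x| <= e]) -> P f.

Let P0 : P (fun=> 0).
Proof.
have := P_indic measurable0.
by congr P; apply/funext => x; rewrite indicE in_set0.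
Qed.

Let cb0 : cbounded_measurable (fun=> 0 : R[i]).
Proof. by split; exact: bounded_measurable_cst. Qed.

Let PZ a f : cbounded_measurable f -> P f -> P (fun x => a * f x).
Proof.
move=> fb Pf; have := P_lin a fb cb0 Pf P0.
by congr P; apply/funext => x; rewrite addr0.
Qed.

Let P_pos (f : T -> R) : bounded_measurable f -> (forall x, 0 <= f x) ->
  P (fun x => (f x)%:C).
Proof.
move=> fb f0; apply: P_lim; first exact: cbounded_measurable_real.
move=> e e0; have [mf [M fM]] := fb.
have [n en] : exists n : nat, n.+1%:R^-1 < e.
  by exists (Num.truncn e^-1); rewrite -[ltRHS]invrK ltf_pV2 ?posrE ?invr_gt0// truncnS_gt.
have [N NM] : exists N : nat, n.+1%:R * M <= N%:R.
  by exists (Num.truncn (n.+1%:R * M)).+1; rewrite ltW// truncnS_gt.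
pose A k := [set x | k.+1%:R <= n.+1%:R * f x].
have mA k : measurable (A k).
  rewrite -[A k]setTI; apply: measurable_fun_le => //.
  by apply: measurable_funM.
have kl m : cbounded_measurable (fun x => \sum_(k < m) (\1_(A k) x : R)%:C) /\
    P (fun x => \sum_(k < m) (\1_(A k) x : R)%:C).
  elim: m => [|m [IH1 IH2]].
    by split; under eq_fun do rewrite big_ord0.
  have bA := cbounded_measurable_indic (mA m).
  split; under eq_fun do rewrite big_ord_recr/=.
    exact: cbounded_measurableD.
  have := P_lin 1 IH1 bA IH2 (P_indic (mA m)).
  by congr P; apply/funext => x; rewrite mul1r.
exists (fun x => (n.+1%:R^-1)%:C * \sum_(k < N) (\1_(A k) x : R)%:C); split.
- by apply: cbounded_measurableZ; case: (kl N).
- by case: (kl N) => *; exact: PZ.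
move=> x; rewrite -rmorph_sum -rmorphM -rmorphB normRe_real.
have nf0 : 0 <= n.+1%:R * f x by rewrite mulr_ge0.
have [_] := step_count N nf0.
have -> : \sum_(k < N) \1_(A k) x =
   \sum_(k < N) ((k.+1%:R <= n.+1%:R * f x)%R : nat)%:R :> R.
  by apply: eq_bigr => k _; rewrite indicE; congr (nat_of_bool _)%:R;
     apply/idP/idP; rewrite inE.
set S := \sum_(k < N) _ => /(_ _)/andP[].
  by apply: le_trans NM; rewrite ler_pM2l// (le_trans (ler_norm _)).
move=> S1 S2; have n0 : 0 < n.+1%:R :> R by [].
have -> : f x - n.+1%:R^-1 * S = n.+1%:R^-1 * (n.+1%:R * f x - S).
  by rewrite mulrBr mulrA mulVf ?mul1r// lt0r_neq0.
rewrite normrM gtr0_norm ?invr_gt0//; apply: le_trans (ltW en).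
rewrite ler_piMr ?invr_ge0// ger0_norm ?subr_ge0//.
by rewrite lerBlDr -lerBlDl.
Qed.

Let P_real (f : T -> R) : bounded_measurable f -> P (fun x => (f x)%:C).
Proof.
move=> fb; have [mf [M fM]] := fb.
have cM : bounded_measurable (fun _ : T => M) by exact: bounded_measurable_cst.
have fMb : bounded_measurable (fun x => f x + M) by exact: bounded_measurableD.
have p1 : P (fun x => (f x + M)%:C).
  by apply: P_pos => // x; rewrite -lerBlDr sub0r; have := fM x; rewrite ler_norml => /andP[].
have [T0|/contrapT[t _]] := pselect (~ exists t : T, True).
  by have := P0; congr P; apply/funext => x; exfalso; apply: T0; exists x.
have p2 : P (fun _ : T => M%:C).
    by apply: P_pos => // x; exact: le_trans (fM x).
  have := P_lin (-1) (cbounded_measurable_real cM) (cbounded_measurable_real fMb) p2 p1.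
  by congr P; apply/funext => x; rewrite mulN1r rmorphD addrC addrK.
Qed.

(** Uniform limits suffice because the functions are bounded: a nonnegative [f]
    is within [1 / (n + 1)] of the function counting the levels
    [(k + 1) / (n + 1)] that it exceeds. *)
Lemma cbounded_measurable_ind f : cbounded_measurable f -> P f.
Proof.
move=> [f1 f2]; have := P_lin 'i (cbounded_measurable_real f2)
  (cbounded_measurable_real f1) (P_real f2) (P_real f1).
congr P; apply/funext => x; rewrite addrC; case: (f x) => a b.
by apply/eqP; rewrite eq_complex/= !(mul0r,mulr0,mul1r,addr0,add0r,subr0) !eqxx.
Qed.

End induction.
End complex_bounded.

(** * Integration against a complex measure *)
Section complex_integral_theory.
Context d (T : measurableType d) (R : realType).
Implicit Types (mu nu : set T -> R[i]) (f g : T -> R[i]) (E : set T).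

Section one_measure.
Variables (mu : set T -> R[i]) (cm : is_complex_measure mu).

(** The sum of the four Jordan parts. It plays the role of the total variation,
    which it exceeds by at most a factor [4], and is a measure by construction. *)
Definition dominant : {measure set T -> \bar R} :=
  measure_add
    (measure_add (jordan_pos (hahn_posneg (charge_Re cm)))
                 (jordan_neg (hahn_posneg (charge_Re cm))))
    (measure_add (jordan_pos (hahn_posneg (charge_Im cm)))
                 (jordan_neg (hahn_posneg (charge_Im cm)))).

Lemma dominantE E : dominant E =
  (jordan_pos (hahn_posneg (charge_Re cm)) E +
   jordan_neg (hahn_posneg (charge_Re cm)) E +
   (jordan_pos (hahn_posneg (charge_Im cm)) E +
    jordan_neg (hahn_posneg (charge_Im cm)) E))%E.
Proof.
rewrite /dominant; etransitivity; first exact: measure_addE.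
by congr (_ + _)%E; exact: measure_addE.
Qed.

Lemma dominant_fin E : measurable E -> dominant E \is a fin_num.
Proof.
by move=> mE; rewrite dominantE !fin_numD !fin_num_measure.
Qed.

Lemma abs_charge_integral_le (nu : {charge set T -> \bar R}) (f : T -> R)
    (h : T -> \bar R) : bounded_measurable f -> measurable_fun setT h ->
  (forall x, `|f x|%:E <= h x)%E ->
  (`|charge_integral nu f|%:E <=
   \int[jordan_pos (hahn_posneg nu)]_x h x +
   \int[jordan_neg (hahn_posneg nu)]_x h x)%E.
Proof.
move=> fb mh fh; rewrite /charge_integral.
apply: (@le_trans _ _ (`|Rintegral (jordan_pos (hahn_posneg nu)) setT f|%:E +
  `|Rintegral (jordan_neg (hahn_posneg nu)) setT f|%:E)%E).
  by rewrite -EFinD lee_fin ler_normB.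
by apply: leeD; exact: le_Rintegral_ext.
Qed.

(** The factor [2] comes from each Jordan part integrating both the real and
    the imaginary part of [f]. *)
Lemma complex_integral_le f (h : T -> \bar R) : cbounded_measurable f ->
  measurable_fun setT h -> (forall x, (Re `|f x|)%:E <= h x)%E ->
  ((Re `|complex_integral cm f|)%:E <= 2%:E * \int[dominant]_x h x)%E.
Proof.
move=> [f1 f2] mh fh.
have h0 x : (0 <= h x)%E by apply: le_trans (fh x); rewrite lee_fin normRe_ge0.
have fh1 x : (`|Re (f x)|%:E <= h x)%E.
  by apply: le_trans (fh x); rewrite lee_fin abs_Re_le.
have fh2 x : (`|Im (f x)|%:E <= h x)%E.
  by apply: le_trans (fh x); rewrite lee_fin abs_Im_le.
rewrite !ge0_integral_measure_add//.
apply: (@le_trans _ _ (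
  (`|charge_integral (charge_Re cm) (fun x => Re (f x))|%:E +
  `|charge_integral (charge_Im cm) (fun x => Im (f x))|%:E) +
  (`|charge_integral (charge_Re cm) (fun x => Im (f x))|%:E +
  `|charge_integral (charge_Im cm) (fun x => Re (f x))|%:E))%E).
  rewrite -!EFinD lee_fin; apply: le_trans (normRe_le _) _.
  by apply: lerD; [exact: ler_normB|exact: ler_normD].
rewrite [(2%:E)%E](_ : _ = (1 + 1)%E)// ge0_muleDl// !mul1e.
by apply: leeD; apply: leeD; exact: abs_charge_integral_le.
Qed.

Lemma complex_integralD f g : cbounded_measurable f -> cbounded_measurable g ->
  complex_integral cm (fun x => f x + g x) =
  complex_integral cm f + complex_integral cm g.
Proof.
move=> [f1 f2] [g1 g2]; rewrite /complex_integral.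
have e1 : (fun x => Re (f x + g x)) = (fun x => Re (f x) + Re (g x)).
  by apply/funext => x; rewrite Re_add.
have e2 : (fun x => Im (f x + g x)) = (fun x => Im (f x) + Im (g x)).
  by apply/funext => x; rewrite Im_add.
rewrite e1 e2 !charge_integralD//; apply/eqP; rewrite eq_complex/=.
by rewrite opprD addrACA eqxx addrACA eqxx.
Qed.

Lemma complex_integralZ (a : R[i]) f : cbounded_measurable f ->
  complex_integral cm (fun x => a * f x) = a * complex_integral cm f.
Proof.
move=> [f1 f2]; rewrite /complex_integral.
have e1 : (fun x => Re (a * f x)) = (fun x => Re a * Re (f x) + (- Im a) * Im (f x)).
  by apply/funext => x; rewrite Re_mul mulNr.
have e2 : (fun x => Im (a * f x)) = (fun x => Re a * Im (f x) + Im a * Re (f x)).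
  by apply/funext => x; rewrite Im_mul.
rewrite e1 e2 !charge_integralD ?charge_integralZ//;
  try exact: bounded_measurableZ.
case: a {e1 e2} => a b; apply/eqP; rewrite eq_complex/=.
by apply/andP; split; apply/eqP; ring.
Qed.

Lemma complex_integral_indic E : measurable E ->
  complex_integral cm (fun x => (\1_E x : R)%:C) = mu E.
Proof.
move=> mE; rewrite /complex_integral/=.
have e0 (nu : {charge set T -> \bar R}) : charge_integral nu (fun _ : T => 0 : R) = 0.
  have := @charge_integral_indic _ _ _ nu _ measurable0; rewrite charge0/= => e; rewrite -[RHS]e.
  by congr charge_integral; apply/funext => x; rewrite indicE in_set0.
rewrite !e0 !charge_integral_indic// subr0 add0r /charge_Re /charge_Im/=.
by case: (mu E).
Qed.

Lemma dominant_ge E : measurable E -> ((Re `|mu E|)%:E <= dominant E)%E.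
Proof.
move=> mE; rewrite dominantE.
have := abse_charge_variation (hahn_posneg (charge_Re cm)) mE.
have := abse_charge_variation (hahn_posneg (charge_Im cm)) mE.
move=> h1 h2; apply: le_trans (leeD h2 h1).
by rewrite /charge_Re /charge_Im/= -EFinD lee_fin normRe_le.
Qed.

End one_measure.

Lemma total_variation_le_measure mu (rho : {measure set T -> \bar R}) E :
  (forall A, measurable A -> ((Re `|mu A|)%:E <= rho A)%E) -> measurable E ->
  (total_variation mu E <= rho E)%E.
Proof.
move=> le mE; apply: ge_ereal_sup => _ [n [A [mA tA AE ->]]].
have sumE (f : 'I_n -> \bar R) : (\sum_(i \in setT) f i = \sum_i f i)%E.
  rewrite (_ : [set: 'I_n] = [set` index_enum 'I_n]); last first.
    by apply/seteqP; split => // i _; exact: mem_index_enum.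
  by rewrite -fsbig_seq// index_enum_uniq.
have vE : rho E = (\sum_i rho (A i))%E.
  by rewrite -AE measure_fin_bigcup//; exact: finite_finset.
by rewrite vE -sumEFin lee_sum// => i _; exact: le.
Qed.

(** Up to sign, each Jordan part of [E] is the real or imaginary part of
    the value of [mu] on the intersection of [E] with a Hahn set. *)
Lemma dominant_le mu (cm : is_complex_measure mu) E (c : \bar R) : measurable E ->
  (forall A, measurable A -> A `<=` E -> ((Re `|mu A|)%:E <= c)%E) ->
  (dominant cm E <= c + c + (c + c))%E.
Proof.
move=> mE le; rewrite dominantE.
apply: leeD; apply: leeD.
- have [[mP _] _ _ _] := hahn_posneg (charge_Re cm).
  rewrite jordan_posE cjordan_posE /crestr0 mem_set// /crestr /charge_Re/=.
  apply: le_trans (le _ (measurableI _ _ mE mP) (@subIsetl _ _ _)).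
  by rewrite lee_fin (le_trans (ler_norm _))// abs_Re_le.
- have [_ [mP _] _ _] := hahn_posneg (charge_Re cm).
  rewrite jordan_negE cjordan_negE /crestr0 mem_set// /crestr /charge_Re/=.
  apply: le_trans (le _ (measurableI _ _ mE mP) (@subIsetl _ _ _)).
  by rewrite lee_fin (le_trans (ler_norm _))// normrN abs_Re_le.
- have [[mP _] _ _ _] := hahn_posneg (charge_Im cm).
  rewrite jordan_posE cjordan_posE /crestr0 mem_set// /crestr /charge_Im/=.
  apply: le_trans (le _ (measurableI _ _ mE mP) (@subIsetl _ _ _)).
  by rewrite lee_fin (le_trans (ler_norm _))// abs_Im_le.
- have [_ [mP _] _ _] := hahn_posneg (charge_Im cm).
  rewrite jordan_negE cjordan_negE /crestr0 mem_set// /crestr /charge_Im/=.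
  apply: le_trans (le _ (measurableI _ _ mE mP) (@subIsetl _ _ _)).
  by rewrite lee_fin (le_trans (ler_norm _))// normrN abs_Im_le.
Qed.

Lemma dominant_le_total_variation mu (cm : is_complex_measure mu) E : measurable E ->
  (dominant cm E <= total_variation mu E + total_variation mu E +
    (total_variation mu E + total_variation mu E))%E.
Proof.
move=> mE; apply: dominant_le => // A mA AE.
by apply: le_trans (le_total_variation mu mA mE AE); exact: le_total_variation1.
Qed.

Lemma complex_integral_sup mu (cm : is_complex_measure mu) f (e : R) :
  cbounded_measurable f -> (forall x, Re `|f x| <= e) ->
  Re `|complex_integral cm f| <= 2 * e * fine (dominant cm setT).
Proof.
move=> fb fe; have := @complex_integral_le _ cm f (fun=> e%:E) fb.
move=> /(_ (measurable_cst _)) h; rewrite -lee_fin.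
have {}h := h (fun x => _); apply: le_trans (h _) _.
  by move=> x; rewrite lee_fin fe.
by rewrite integral_cst// EFinM EFinM fineK ?dominant_fin// muleA.
Qed.

End complex_integral_theory.

(** * Compact subsets of a locally compact group *)
Lemma open_nbhsP (X : topologicalType) (A : set X) :
  (forall x, A x -> nbhs x A) -> open A.
Proof. by rewrite openE. Qed.

Section topology.
Context (G : lcGroupType).
Implicit Types (K U C : set G) (x y : G).

Lemma mulgr_continuous y : continuous (fun x : G => (x * y)%g).
Proof.
move=> x; apply: (@cvg_comp G (G * G)%type G (fun x => (x, y))
  (fun z => (z.1 * z.2)%g) (nbhs x) (nbhs (x, y)) (nbhs (x * y)%g)).
  by apply: cvg_pair; [exact: cvg_id|exact: cvg_cst].
exact: (@mulg_continuous G (x, y)).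
Qed.

Lemma mulgl_continuous y : continuous (fun x : G => (y * x)%g).
Proof.
move=> x; apply: (@cvg_comp G (G * G)%type G (fun x => (y, x))
  (fun z => (z.1 * z.2)%g) (nbhs x) (nbhs (y, x)) (nbhs (y * x)%g)).
  by apply: cvg_pair; [exact: cvg_cst|exact: cvg_id].
exact: (@mulg_continuous G (y, x)).
Qed.

(** The tube lemma, with a filter in place of the second space. *)
Lemma compact_uniform_near (K : set G) (I : Type) (F : set_system I) (P : I -> G -> Prop) :
  Filter F -> compact K ->
  (forall x, K x -> \forall x' \near x & i \near F, P i x') ->
  \forall i \near F, forall x, K x -> P i x.
Proof. by move=> FF /compact_near_coveringP cK /(cK I F P FF). Qed.

Lemma closed_compact K : compact K -> closed K.
Proof. by apply: compact_closed; exact: lcgroup_hausdorff. Qed.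

Lemma compactD_open K U : compact K -> open U -> compact (K `\` U).
Proof.
move=> cK oU; rewrite setDE; apply: compact_closedI => //.
exact: open_closedC.
Qed.

Lemma compact_nbhs x U : nbhs x U -> exists2 C, compact C /\ C `<=` U & nbhs x C.
Proof.
move=> xU.
have [V xV [cV clV]] := @lcgroup_locally_compact G x I.
have xV' : nbhs x V.
  have h : nbhs x [set z | [set: G] z -> V z] := xV.
  by apply: filterS h => z; exact.
have /(_ xV') reg := @compact_regular G x V lcgroup_hausdorff cV.
have [W xW WUV] := reg _ (filterI xU xV').
exists (closure W); last by apply: filterS xW; exact: subset_closure.
split; last by move=> z /WUV[].
apply: (subclosed_compact _ cV); first exact: closed_closure.
by move=> z /WUV[].
Qed.

(** Replaces the extraction of finite subcovers: directedness merges the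
    finitely many indices of a cover into one. *)
Lemma compact_directed (T : Type) (D : set T) (P : T -> G -> Prop) (K : set G) :
  compact K -> D !=set0 ->
  (forall a b, D a -> D b -> exists2 c, D c & forall x, P a x \/ P b x -> P c x) ->
  (forall x, K x -> exists2 a, D a & \forall x' \near x, P a x') ->
  exists2 a, D a & forall x, K x -> P a x.
Proof.
move=> cK D0 dir loc.
pose F := filter_from D (fun a => [set b | D b /\ forall x, P a x -> P b x]).
have FF : ProperFilter F.
  apply: filter_from_proper; last by move=> a Da; exists a.
  apply: filter_from_filter => // a b Da Db; have [c Dc abc] := dir a b Da Db.
  by exists c => // d [Dd cd]; split; split => // x h; apply: cd; apply: abc; [left|right].
have [|a Da /(_ a) h] := @compact_uniform_near K T F P _ cK.
  move=> x /loc[a Da xa]; exists ([set x' | P a x'], [set b | D b /\ forall x, P a x -> P b x]).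
    by split => //; exists a.
  by move=> [x' b] [/= ax' [_]]; apply.
by exists a => //; apply: h.
Qed.

Lemma compact_interior K U : compact K -> open U -> K `<=` U ->
  exists C, [/\ compact C, C `<=` U & K `<=` C^°].
Proof.
move=> cK oU KU.
have [||x Kx|C [cC CU] KC] := @compact_directed (set G)
    [set C | compact C /\ C `<=` U] (fun C x => C^° x) K cK.
- by exists set0; split; [exact: compact0|].
- move=> C D [cC CU] [cD DU]; exists (C `|` D).
    by split; [exact: compactU|move=> x []; [exact: CU|exact: DU]].
  by move=> x []; apply: interiorS => z; [left|right].
- have [C [cC CU] xC] := compact_nbhs (open_nbhs_nbhs (conj oU (KU _ Kx))).
  by exists C => //; exact: nbhs_interior.
- by exists C.
Qed.

End topology.

(** * Radon measures under translation *)
Section borel.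
Context (R : realType) (G : lcGroupType).
Local Notation borel := (g_sigma_algebraType (@open G)).
Local Notation mborel := (@open G).-sigma.-measurable.
Implicit Types (E : set G) (x y : G).

Lemma borel_ind (Q : set G -> Prop) :
  Q set0 -> (forall U, open U -> Q U) -> (forall E, mborel E -> Q E -> Q (~` E)) ->
  (forall F : nat -> set G, (forall k, mborel (F k)) -> (forall k, Q (F k)) -> Q (\bigcup_k F k)) ->
  forall E, mborel E -> Q E.
Proof.
move=> Q0 QU QC QF E mE.
have : smallest (sigma_algebra setT) (@open G) `<=` [set E | mborel E /\ Q E].
  apply: smallest_sub => [|U oU]; last by split; [exact: borel_open|exact: QU].
  split.
  - by split => //; exact: measurable0.
  - by move=> A [mA QA]; rewrite setTD; split; [exact: measurableC|exact: QC].
  - move=> F mF; split.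
      by apply: bigcupT_measurable => k; case: (mF k).
    by apply: QF => k; case: (mF k).
by move=> /(_ E mE)[].
Qed.

Lemma borel_preimage (f : G -> G) : continuous f -> forall E, mborel E -> mborel (f @^-1` E).
Proof.
move=> cf; apply: borel_ind.
- by rewrite preimage_set0; exact: measurable0.
- by move=> U oU; apply: borel_open; apply: open_comp => // x _; exact: cf.
- by move=> E mE mf; rewrite preimage_setC; exact: measurableC.
- by move=> F _ mF; rewrite preimage_bigcup; apply: bigcupT_measurable.
Qed.

Lemma borel_continuous (f : G -> R) : continuous f ->
  measurable_fun setT (f : borel -> R).
Proof.
move=> cf; apply: (measurability _ (RGenOInfty.measurableE R)) => _ [_ [x ->] <-].
rewrite setTI; apply: (@borel_open G); apply: open_comp => [y _|]; first exact: cf.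
exact: rray_open.
Qed.

Definition rtrans E y : set G := [set x | E (x * y)%g].

Lemma rtrans_measurable E y : mborel E -> mborel (rtrans E y).
Proof. by apply: borel_preimage; exact: mulgr_continuous. Qed.

Implicit Types p q : {measure set borel -> \bar R}.

(** The analogue of [is_regular] for positive finite measures. *)
Definition radon p := (p setT < +oo)%E /\
  forall E, mborel E -> forall e : R, 0 < e -> exists K U,
    [/\ compact K, open U, K `<=` E, E `<=` U & (p (U `\` K) < e%:E)%E].

Lemma radon_fin p E : radon p -> mborel E -> p E \is a fin_num.
Proof.
move=> [pT _] mE; rewrite ge0_fin_numE//; apply: le_lt_trans pT.
by apply: le_measure; rewrite ?inE//; exact: measurableT.
Qed.

Lemma measure_le p E F : mborel E -> mborel F -> E `<=` F -> (p E <= p F)%E.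
Proof. by move=> mE mF EF; apply: le_measure; rewrite ?inE. Qed.

Lemma radon_compact p E (r : R) : radon p -> mborel E -> (r%:E < p E)%E ->
  exists2 K, compact K /\ K `<=` E & (r%:E < p K)%E.
Proof.
move=> rp mE rE; have fE := radon_fin rp mE.
have e0 : 0 < fine (p E) - r by rewrite subr_gt0 -lte_fin fineK.
have [_ reg] := rp; have [K [U [cK oU KE EU pUK]]] := reg E mE _ e0.
exists K => //; have mK := borel_compact cK.
have : (p E <= p (E `\` K) + p K)%E by rewrite (measureDI p mE mK) (setIidr KE).
have : (p (E `\` K) <= p (U `\` K))%E.
  apply: measure_le; [exact: measurableD| |exact: setSD].
  by apply: measurableD => //; exact: borel_open.
move=> h1 h2; have h3 := le_lt_trans h1 pUK.
rewrite -(fineK fE) -(fineK (radon_fin rp mK)) in h2 *.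
rewrite lte_fin.
have h4 : p (E `\` K) \is a fin_num by apply: radon_fin => //; exact: measurableD.
move: h3 h2; rewrite -(fineK h4) -EFinD lte_fin lee_fin; lra.
Qed.

(** That [p (U y^-1) > r] is witnessed by a compact [K] of measure [> r] with
    [K y] inside [U], and [K y'] is still inside [U] for [y'] near [y]. *)
Lemma radon_lsc p U (r : R) : radon p -> open U ->
  open [set y | (r%:E < p (rtrans U y))%E].
Proof.
move=> rp oU; apply: open_nbhsP => y /= ry.
have [K [cK KU] rK] := radon_compact rp (rtrans_measurable y (borel_open oU)) ry.
have : \forall y' \near y, forall x, K x -> U (x * y')%g.
  apply: (@compact_uniform_near _ K _ _ (fun y' x => U (x * y')%g)) => // x Kx.
  have := @mulg_continuous G (x, y) U (open_nbhs_nbhs (conj oU (KU _ Kx))).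
  by case=> -[A B] /= [xA yB] AB; exists (A, B) => // -[a b]/= [Aa Bb]; apply: (AB (a, b)).
apply: filterS => y' Ky' /=; apply: lt_le_trans rK _; apply: measure_le => //.
- exact: borel_compact.
- by apply: rtrans_measurable; exact: borel_open.
Qed.

(** Lower semicontinuity settles the open sets, which are stable under
    intersection, and the good sets form a Dynkin system. *)
Lemma radon_translate_measurable p E : radon p -> mborel E ->
  measurable_fun setT (fun y : borel => p (rtrans E y)).
Proof.
move=> rp mE.
pose B := [set E | mborel E /\ measurable_fun setT (fun y : borel => p (rtrans E y))].
suff : <<s @open G >> `<=` B by move=> /(_ E mE)[].
have CB : @open G `<=` B.
  move=> U oU; split; first exact: borel_open.
  apply: (measurability _ (ErealGenOInfty.measurableE R)) => _ [_ [r ->] <-].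
  rewrite setTI; apply: (@borel_open G).
  rewrite (_ : _ @^-1` _ = [set y | (r%:E < p (rtrans U y))%E]); first exact: radon_lsc.
  by apply/seteqP; split => y /=; rewrite in_itv/= andbT.
suff lB : lambda_system setT B.
  apply: lambda_system_subset => //.
  exact: openI.
split => //; first by apply: CB; exact: openT.
- move=> X Y YX [mX pX] [mY pY]; split; first exact: measurableD.
  rewrite (_ : (fun y => _) = (fun y => p (rtrans X y) - p (rtrans Y y))%E).
    exact: emeasurable_funB.
  apply/funext => y; rewrite (_ : rtrans (X `\` Y) y = rtrans X y `\` rtrans Y y)//.
  have mX' := rtrans_measurable y mX; have mY' := rtrans_measurable y mY.
  rewrite measureD//; last by rewrite -ge0_fin_numE//; exact: radon_fin.
  by rewrite setIidr// => x; exact: YX.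
- move=> F ndF BF; split; first by apply: bigcupT_measurable => n; have [] := BF n.
  have pF y : p (rtrans (F i) y) @[i --> \oo] --> p (rtrans (\bigcup_i F i) y).
    have -> : rtrans (\bigcup_i F i) y = \bigcup_i (rtrans (F i) y).
      by apply/seteqP; split => x [i _ Fi]; exists i.
    apply: nondecreasing_cvg_mu.
    - by move=> n; apply: rtrans_measurable; case: (BF n).
    - by apply: bigcupT_measurable => i; apply: rtrans_measurable; case: (BF i).
    - by move=> m n mn; apply/subsetPset => x; exact: (subsetPset _ _ (ndF _ _ mn)).
  apply: (emeasurable_fun_cvg (fun i (y : borel) => p (rtrans (F i) y))) => //.
  by move=> i; have [] := BF i.
Qed.

End borel.

(** * Convolution of Radon measures *)
Lemma bigsetU_ordP (X : Type) (F : nat -> set X) N x :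
  (\big[setU/set0]_(n < N) F n) x <-> exists2 n, (n < N)%N & F n x.
Proof. by rewrite -bigcup_mkord; split => -[n ? ?]; exists n. Qed.

Section regularity.
Context (R : realType) (G : lcGroupType).
Local Notation borel := (g_sigma_algebraType (@open G)).
Local Notation mborel := (@open G).-sigma.-measurable.
Implicit Types (E U K C : set G) (x y : G) (p q : {measure set borel -> \bar R}).

(** The sets that can be approximated from both sides are stable under
    countable unions, and under complements because the whole group is nearly
    compact; so only the inner approximation of open sets has to be checked. *)
Lemma radon_inner p : (p setT < +oo)%E ->
  (forall U, open U -> forall e : R, 0 < e ->
    exists C, [/\ compact C, C `<=` U & (p (U `\` C) < e%:E)%E]) ->
  radon p.
Proof.
move=> pT inner; split => // E mE.
have pfin A : mborel A -> (p A < +oo)%E.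
  by move=> mA; apply: le_lt_trans pT; apply: measure_le => //; exact: measurableT.
have mKU K U : compact K -> open U -> mborel (U `\` K).
  by move=> cK oU; apply: measurableD; [exact: borel_open|exact: borel_compact].
move: E mE; apply: borel_ind.
- move=> e e0; exists set0, set0; split => //; first exact: compact0.
    exact: open0.
  by rewrite setD0 measure0 lte_fin.
- move=> U oU e e0; have [C [cC CU pC]] := inner U oU e e0.
  by exists C, U; split.
- move=> E mE QE e e0.
  have e20 : 0 < e / 2 by rewrite divr_gt0.
  have [K [U [cK oU KE EU pUK]]] := QE _ e20.
  have [C [cC _ pC]] := inner _ openT _ e20.
  exists (C `\` U), (~` K); split.
  + exact: compactD_open.
  + by rewrite openC; exact: closed_compact.
  + by move=> x [_ nU] Ex; apply/nU/EU.
  + by move=> x nE Kx; apply/nE/KE.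
  + apply: (@le_lt_trans _ _ (p (U `\` K) + p (setT `\` C))%E).
      apply: le_trans (measureU2 _ _ _); [|exact: mKU|exact: mKU openT].
      apply: measure_le.
      * apply: measurableD; first by apply: measurableC; exact: borel_compact.
        by apply: measurableD; [exact: borel_compact|exact: borel_open].
      * by apply: measurableU; [exact: mKU|apply: mKU openT].
      * move=> x [nK nCU]; have [Cx|nCx] := pselect (C x); last by right.
        by left; split => //; apply: contrapT => nUx; apply: nCU.
    by rewrite [e in ltRHS]splitr EFinD; exact: lteD.
- move=> F mF QF e e0.
  have e20 : 0 < e / 2 / 2 by rewrite !divr_gt0.
  have /choice[KU hKU] : forall n, exists KU : set G * set G,
     [/\ compact KU.1, open KU.2, KU.1 `<=` F n, F n `<=` KU.2 &
       (p (KU.2 `\` KU.1) < (e / 2 / 2 / (2 ^ n.+1)%:R)%:E)%E].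
    move=> n; have en : 0 < e / 2 / 2 / (2 ^ n.+1)%:R by rewrite divr_gt0// ltr0n expn_gt0.
    by have [K [U h]] := QF n _ en; exists (K, U).
  pose U := \bigcup_n (KU n).2; pose K := \bigcup_n (KU n).1.
  have oU : open U by apply: bigcup_open => n _; case: (hKU n).
  have mK n : mborel (KU n).1 by apply: borel_compact; case: (hKU n).
  have mUn n : mborel ((KU n).2 `\` (KU n).1) by apply: mKU; case: (hKU n).
  have pUK : (p (U `\` K) <= (e / 2)%:E)%E.
    apply: (@le_trans _ _ (\sum_(n <oo) p ((KU n).2 `\` (KU n).1))%E).
      apply: (@measure_sigma_subadditive _ _ _ p _ (fun n => (KU n).2 `\` (KU n).1)) => //.
        by apply: measurableD; [exact: borel_open|exact: bigcupT_measurable].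
      move=> x [[n _ Ux] nK]; exists n => //; split => // Kx.
      by apply: nK; exists n.
    apply: (@le_trans _ _ (\sum_(n <oo) (0 + (e / 2 / 2 / (2 ^ n.+1)%:R)%:E))%E).
      apply: lee_nneseries => // n _; rewrite add0e; apply: ltW.
      by case: (hKU n).
    apply: le_trans (epsilon_trick _ _ _) _; [by []|by rewrite ltW|].
    rewrite eseries0// add0e lee_fin ler_pdivrMr// ler_pMr ?ler1n//.
    by rewrite divr_gt0.
  pose V N := U `\` \big[setU/set0]_(n < N) (KU n).1.
  have mV N : mborel (V N).
    apply: measurableD; first exact: borel_open.
    by apply: bigsetU_measurable.
  have Vcap : \bigcap_N V N = U `\` K.
    apply/seteqP; split => x.
      move=> h; split; first by case: (h 0%N I).
      by move=> [n _ Kx]; case: (h n.+1 I) => _; apply; apply/(bigsetU_ordP (fun n => (KU n).1)); exists n.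
    move=> [Ux nK] N _; split => // /(bigsetU_ordP (fun n => (KU n).1))[n _ Kx].
    by apply: nK; exists n.
  have cV : p (V n) @[n --> \oo] --> p (\bigcap_N V N).
    apply: nonincreasing_cvg_mu => //.
    - exact: pfin.
    - exact: bigcapT_measurable.
    - move=> m n mn; apply/subsetPset => x [Ux nK]; split => // Kx; apply: nK.
      move/(bigsetU_ordP (fun n => (KU n).1)) : Kx => [k km Kx].
      by apply/(bigsetU_ordP (fun n => (KU n).1)); exists k => //; exact: leq_trans km mn.
  have [N pN] : exists N, (p (V N) < e%:E)%E.
    have : (p (\bigcap_N V N) < e%:E)%E.
      rewrite Vcap; apply: le_lt_trans pUK _; rewrite lte_fin; lra.
    move=> plt; have oe : open [set x : \bar R | (x < e%:E)%E] by exact: open_ereal_lt_ereal.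
    by have [N _ /(_ N (leqnn _)) h] := cV _ (open_nbhs_nbhs (conj oe plt)); exists N.
  exists (\big[setU/set0]_(n < N) (KU n).1), U; split => //.
  + by apply: bigsetU_compact => n _; case: (hKU n).
  + by move=> x /(bigsetU_ordP (fun n => (KU n).1))[n _ Kx]; exists n => //; case: (hKU n) => _ _ + _ _; apply.
  + by move=> x [n _ Fx]; exists n => //; case: (hKU n) => _ _ _ + _; apply.
Qed.

Section conv.
Variables p q : {measure set borel -> \bar R}.
Hypotheses (rp : radon p) (rq : radon q).

Definition conv_fun of radon p & radon q := fun E : set borel =>
  (\int[q]_y p (rtrans E y))%E.

Local Notation pq := (conv_fun rp rq).

Let conv0 : pq set0 = 0%E.
Proof.
rewrite /conv_fun integral0_eq// => y _.
by rewrite (_ : rtrans set0 y = set0) ?measure0.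
Qed.

Let conv_ge0 E : (0 <= pq E)%E.
Proof. by apply: integral_ge0 => y _; exact: measure_ge0. Qed.

Let conv_additive : semi_sigma_additive pq.
Proof.
move=> F mF tF mUF; rewrite /conv_fun.
have -> : (fun y : borel => p (rtrans (\bigcup_n F n) y)) =
    (fun y => \sum_(n <oo) p (rtrans (F n) y))%E.
  apply/funext => y; have -> : rtrans (\bigcup_i F i) y = \bigcup_i (rtrans (F i) y).
    by apply/seteqP; split => x [i _ Fi]; exists i.
  apply/esym/cvg_lim => //; apply: measure_semi_sigma_additive.
  - by move=> i; exact: rtrans_measurable.
  - apply/trivIsetP => i j _ _ ij; move/trivIsetP : tF => /(_ i j I I ij).
    by move=> Fij; apply/seteqP; split => // x [Fx Fjx]; rewrite -[set0]/(rtrans set0 y) -Fij.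
  - by apply: bigcupT_measurable => i; exact: rtrans_measurable.
rewrite integral_nneseries//; last by move=> n; exact: radon_translate_measurable.
apply: is_cvg_nneseries => n _ _; exact: conv_ge0.
Qed.

HB.instance Definition _ := isMeasure.Build _ _ _ pq conv0 conv_ge0 conv_additive.

Lemma conv_funE E : pq E = (\int[q]_y p (rtrans E y))%E.
Proof. by []. Qed.

Let P := fine (p setT).
Let Q := fine (q setT).
Let PE : p setT = P%:E. Proof. by rewrite fineK// radon_fin//; exact: measurableT. Qed.
Let QE : q setT = Q%:E. Proof. by rewrite fineK// radon_fin//; exact: measurableT. Qed.
Let P0 : 0 <= P. Proof. by rewrite fine_ge0. Qed.
Let Q0 : 0 <= Q. Proof. by rewrite fine_ge0. Qed.

Lemma conv_funT : pq setT = (P * Q)%:E.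
Proof.
rewrite conv_funE (_ : (fun y : borel => _) = fun=> P%:E).
  by rewrite integral_cst//= QE.
by apply/funext => y; rewrite -PE.
Qed.

(** A compact set of points [y] needs a single compact [C], by the perturbation
    used for lower semicontinuity. *)
Let level U (r : R) : open U -> forall D, compact D ->
  (forall y, D y -> r%:E < p (rtrans U y))%E ->
  exists C, [/\ compact C, C `<=` U & forall y, D y -> (r%:E < p (rtrans C y))%E].
Proof.
move=> oU D cD rD.
have mC (C : set G) (y : G) : compact C -> mborel (rtrans C y).
  by move=> cC; apply: rtrans_measurable; exact: borel_compact.
have [||y Dy|C [cC CU] DC] := @compact_directed G (set G)
    [set C | compact C /\ C `<=` U] (fun C y => (r%:E < p (rtrans C y))%E) D cD.
- by exists set0; split; [exact: compact0|].
- move=> A B [cA AU] [cB BU]; exists (A `|` B).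
    by split; [exact: compactU|move=> x []; [exact: AU|exact: BU]].
  have mAB y := mC _ y (compactU cA cB).
  by move=> y [] h; apply: lt_le_trans h _; (apply: measure_le; [exact: mC|exact: mAB|]);
    move=> x; [left|right].
- have mU := rtrans_measurable y (borel_open oU).
  have [K [cK KU] rK] := radon_compact rp mU (rD y Dy).
  have cKy : compact ((fun x => (x * y)%g) @` K).
    apply: continuous_compact => //; apply: continuous_subspaceT; exact: mulgr_continuous.
  have [|C [cC CU KC]] := compact_interior cKy oU.
    by move=> _ [x Kx <-]; exact: KU.
  have yC : \forall y' \near y, forall x, K x -> C^° (x * y')%g.
    apply: (@compact_uniform_near _ K _ _ (fun y' x => C^° (x * y')%g)) => // x Kx.
    have Cxy : C^° (x * y)%g by apply: KC; exists x.
    have := @mulg_continuous G (x, y) (C^°) (open_nbhs_nbhs (conj (@open_interior _ _) Cxy)).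
    by case=> -[A B] /= [xA yB] AB; exists (A, B) => // -[a b]/= [Aa Bb]; apply: (AB (a, b)).
  exists C => //; apply: filterS yC => y' Ky'; apply: lt_le_trans rK _.
  apply: measure_le; [exact: borel_compact|exact: mC|].
  by move=> x Kx; exact: (@interior_subset _ C _ (Ky' x Kx)).
- by exists C.
Qed.

(** Only [n] of the levels [k d] matter for the function [y |-> p (U y^-1)].
    For each of them, a compact subset [C k] of [U] attains the level for all
    [y] in a compact part [D k] of the level set [O k]. Outside the set [B] of
    points lost in passing from [O k] to [D k], the union of the [C k] captures
    [p (U y^-1)] up to [d]. *)
Let conv_inner U (d : R) (n : nat) : open U -> 0 < d -> P <= n%:R * d ->
  forall e : R, 0 < e ->
  exists C, [/\ compact C, C `<=` U & (pq (U `\` C) <= (d * Q + P * (n%:R * e))%:E)%E].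
Proof.
move=> oU d0 nd e e0.
have mg : measurable_fun setT (fun y : borel => p (rtrans U y)).
  by apply: radon_translate_measurable => //; exact: borel_open.
pose O k : set G := [set y | ((k.+1%:R * d)%:E < p (rtrans U y))%E].
have oO k : open (O k) by exact: radon_lsc.
have /choice[D hD] : forall k, exists D, [/\ compact D, D `<=` O k & (q (O k `\` D) < e%:E)%E].
  move=> k; have [_ reg] := rq; have [D [V [cD oV DO OV qVD]]] := reg _ (borel_open (oO k)) _ e0.
  exists D; split => //; apply: le_lt_trans qVD; apply: measure_le.
  - by apply: measurableD; [exact: borel_open|exact: borel_compact].
  - by apply: measurableD; [exact: borel_open|exact: borel_compact].
  - by move=> x [/OV].
have /choice[C hC] : forall k, exists C, [/\ compact C, C `<=` U &
    forall y, D k y -> ((k.+1%:R * d)%:E < p (rtrans C y))%E].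
  by move=> k; have [cD DO _] := hD k; apply: level => // y /DO.
pose CC := \big[setU/set0]_(k < n) C k.
have cCC : compact CC by apply: bigsetU_compact => k _; case: (hC k).
have CCU : CC `<=` U.
  by move=> x /bigsetU_ordP[k _ Ckx]; case: (hC k) => _ + _; apply.
have CsC k : (k < n)%N -> C k `<=` CC.
  by move=> kn x Cx; apply/bigsetU_ordP; exists k.
pose B := \big[setU/set0]_(k < n) (O k `\` D k).
have mOD k : mborel (O k `\` D k).
  by apply: measurableD; [exact: borel_open|apply: borel_compact; case: (hD k)].
have mB : mborel B by apply: bigsetU_measurable.
have qB : (q B <= (n%:R * e)%:E)%E.
  apply: (@le_trans _ _ (\sum_(k < n) q (O k `\` D k))%E); first by apply: (@content_subadditive _ _ _ q B (fun k => O k `\` D k) n).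
  apply: (@le_trans _ _ (\sum_(k < n) e%:E)%E); last first.
    by rewrite sumEFin sumr_const card_ord mulr_natl.
  by apply: lee_sum => k _; apply: ltW; case: (hD k).
have mI : measurable_fun setT (\1_B : borel -> R) by exact: measurable_indic.
have mh : measurable_fun setT (fun y : borel => d + P * \1_B y).
  apply: (@measurable_funD _ borel R setT (cst d)); first exact: measurable_cst.
  apply: (@measurable_funM _ borel R setT (cst P)); last exact: mI.
  exact: measurable_cst.
have mCC := borel_compact cCC; have mU := borel_open oU.
have mUC : mborel (U `\` CC) by exact: measurableD.
exists CC; split => //; rewrite conv_funE.
have key y : (p (rtrans (U `\` CC) y) <= (d + P * \1_B y)%:E)%E.
  have mUy := rtrans_measurable y mU; have mCy := rtrans_measurable y mCC.
  have mUCy := rtrans_measurable y mUC.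
  have fU := radon_fin rp mUy; have fC := radon_fin rp mCy.
  have fUC := radon_fin rp mUCy.
  have [By|nBy] := pselect (B y).
    rewrite indicE mem_set// mulr1 EFinD -PE.
    apply: (@le_trans _ _ (p setT)); first by apply: measure_le => //; exact: measurableT.
    by rewrite leeDr// lee_fin ltW.
  rewrite indicE memNset// mulr0 addr0.
  have pU : p (rtrans U y) = (p (rtrans (U `\` CC) y) + p (rtrans CC y))%E.
    rewrite (measureDI p mUy mCy); congr (_ + p _)%E.
    by apply/seteqP; split => x //; [case|move=> Cx; split => //; exact: CCU].
  have [le|lt] := leP (fine (p (rtrans U y))) d.
    rewrite -lee_fin fineK// in le; apply: le_trans le; rewrite pU leeDl//.
  have UP : fine (p (rtrans U y)) <= P.
    by rewrite -lee_fin fineK// -PE; apply: measure_le => //; exact: measurableT.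
  have [k [kn kd dk]] : exists k, [/\ (k < n)%N, k.+1%:R * d < fine (p (rtrans U y)) &
     fine (p (rtrans U y)) <= k.+2%:R * d].
    have ex : exists m, fine (p (rtrans U y)) <= m%:R * d by exists n; exact: le_trans nd.
    have /ex_minnP[m hm mmin] := ex.
    have m2 : (1 < m)%N.
      case: m hm {mmin} => [|[|m]]//; rewrite ?mul0r ?mul1r => h; exfalso; move: lt; lra.
    case: m m2 hm mmin => [|[|k]]// _ hm mmin; exists k; split => //.
      have := mmin n (le_trans UP nd); exact: leq_trans.
    by rewrite ltNge; apply/negP => /mmin; rewrite ltnn.
  have Oy : O k y by rewrite /O/= -(fineK fU) lte_fin.
  have Dy : D k y.
    apply: contrapT => nD; apply: nBy.
    by apply/(bigsetU_ordP (fun k => O k `\` D k)); exists k.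
  have [_ _ /(_ y Dy) pC] := hC k.
  have : ((k.+1%:R * d)%:E < p (rtrans CC y))%E.
    apply: lt_le_trans pC _; apply: measure_le => //.
      by apply: rtrans_measurable; apply: borel_compact; case: (hC k).
    by move=> x; exact: CsC.
  have pU' : fine (p (rtrans U y)) =
      fine (p (rtrans (U `\` CC) y)) + fine (p (rtrans CC y)) by rewrite pU fineD.
  rewrite -(fineK fC) -(fineK fUC) lte_fin lee_fin.
  move: dk; rewrite -(natr1 k.+1) mulrDl mul1r pU'; lra.
apply: (@le_trans _ _ (\int[q]_y (d + P * \1_B y)%:E)%E).
  apply: ge0_le_integral => //.
  - exact: radon_translate_measurable.
  - by apply/measurable_EFinP; exact: mh.
under eq_integral do rewrite EFinD EFinM.
rewrite ge0_integralD//; first last.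
- by apply: measurable_funeM; apply/measurable_EFinP; exact: mI.
- by move=> y _; rewrite mule_ge0// lee_fin// indicE; case: (_ \in _).
- by move=> y _; rewrite lee_fin ltW.
rewrite integral_cst//= QE ge0_integralZl//; first last.
- by apply/measurable_EFinP; exact: mI.
rewrite integral_indic// setIT EFinD EFinM leeD2l// [leRHS]EFinM.
by rewrite lee_wpmul2l.
Qed.

Lemma radon_conv : radon pq.
Proof.
apply: radon_inner.
  by apply: (@eq_ind_r _ _ (fun z => (z < +oo)%E) (ltry _) _ conv_funT).
move=> U oU e e0.
pose d := e / (2 * (Q + 1)).
have d0 : 0 < d by rewrite divr_gt0// mulr_gt0// ltr_wpDl.
pose n := (Num.truncn (P / d)).+1.
have nd : P <= n%:R * d by rewrite -ler_pdivrMr// ltW// truncnS_gt.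
pose e' := e / (4 * (P + 1) * n%:R).
have n0 : 0 < n%:R :> R by rewrite ltr0n.
have e'0 : 0 < e' by rewrite divr_gt0// !mulr_gt0// ltr_wpDl.
have [C [cC CU pC]] := conv_inner oU d0 nd e'0.
exists C; split => //; apply: le_lt_trans pC _; rewrite lte_fin.
have h1 : d * Q <= e / 2.
  rewrite /d -mulrA ler_pM2l// mulrC ler_pdivrMr ?mulr_gt0 ?ltr_wpDl//.
  have := Q0; lra.
have h2 : P * (n%:R * e') <= e / 4.
  have -> : n%:R * e' = e / (4 * (P + 1)).
    by rewrite /e'; field; rewrite !lt0r_neq0// ltr_wpDl.
  rewrite mulrCA ler_pM2l// ler_pdivrMr ?mulr_gt0 ?ltr_wpDl//.
  have := P0; lra.
lra.
Qed.

End conv.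
End regularity.

(** * Complex measures from additive set functions *)
Section functionals.
Context d (T : measurableType d) (R : realType).

Lemma small_eq0 (z : R[i]) (c : R) : (forall e : R, 0 < e -> Re `|z| <= c * e) -> z = 0.
Proof.
move=> h; apply/eqP; rewrite -normr_eq0 normRe.
suff -> : Re `|z| = 0 by [].
apply/eqP; rewrite eq_le normRe_ge0 andbT; apply/ler_addgt0Pl => e e0; rewrite addr0.
have c0 : 0 <= c by have := le_trans (normRe_ge0 z) (h 1 ltr01); rewrite mulr1.
have h1 := h (e / (c + 1)); apply: (le_trans (h1 _)).
  by rewrite divr_gt0// ltr_wpDl.
by rewrite mulrA ler_pdivrMr ?ltr_wpDl// mulrC ler_pM2l// lerDl.
Qed.

(** The form in which functionals on functions are compared; the bound is the one
    needed to pass to uniform limits. *)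
Definition bounded_linear (F : (T -> R[i]) -> R[i]) :=
  (forall a f g, cbounded_measurable f -> cbounded_measurable g ->
     F (fun x => a * f x + g x) = a * F f + F g) /\
  exists c, forall f (e : R), cbounded_measurable f ->
     (forall x, Re `|f x| <= e) -> Re `|F f| <= c * e.

Lemma bounded_linear_eq F1 F2 : bounded_linear F1 -> bounded_linear F2 ->
  (forall E, measurable E ->
     F1 (fun x => (\1_E x : R)%:C) = F2 (fun x => (\1_E x : R)%:C)) ->
  forall f, cbounded_measurable f -> F1 f = F2 f.
Proof.
move=> [l1 [c1 b1]] [l2 [c2 b2]] FE; apply: cbounded_measurable_ind => //.
  by move=> a f g fb gb F1f F1g; rewrite l1// l2// F1f F1g.
move=> f fb flim; apply/eqP; rewrite -subr_eq0; apply/eqP.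
apply: (@small_eq0 _ (c1 + c2)) => e e0.
have [g [gb Fg fg]] := flim e e0.
have hb : cbounded_measurable (fun x => -1 * g x + f x).
  by apply: cbounded_measurableD => //; exact: cbounded_measurableZ.
have he x : Re `|-1 * g x + f x| <= e by rewrite mulN1r addrC.
have -> : F1 f - F2 f = F1 (fun x => -1 * g x + f x) - F2 (fun x => -1 * g x + f x).
  by rewrite l1// l2// Fg !mulN1r opprD opprK addrACA addNr add0r.
apply: le_trans (normReD _ _) _; rewrite normrN mulrDl.
by apply: lerD; [exact: b1|exact: b2].
Qed.

Lemma complex_integral_bounded_linear (mu : set T -> R[i]) (cm : is_complex_measure mu) :
  bounded_linear (complex_integral cm).
Proof.
split.
  move=> a f g fb gb; rewrite complex_integralD//; last exact: cbounded_measurableZ.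
  by rewrite complex_integralZ.
exists (2 * fine (dominant cm setT)) => f e fb fe.
by rewrite mulrAC; exact: complex_integral_sup.
Qed.

(** Jordan decompositions are not additive in the measure, but both sides are
    bounded linear functionals that agree on indicators. *)
Lemma complex_integral_lin (mu nu rho : set T -> R[i])
    (cm : is_complex_measure mu) (cn : is_complex_measure nu)
    (cr : is_complex_measure rho) (a : R[i]) f :
  (forall E, measurable E -> rho E = a * mu E + nu E) -> cbounded_measurable f ->
  complex_integral cr f = a * complex_integral cm f + complex_integral cn f.
Proof.
move=> rhoE; apply: (@bounded_linear_eq (complex_integral cr)
  (fun f => a * complex_integral cm f + complex_integral cn f)).
- exact: complex_integral_bounded_linear.
- have [l1 [c1 b1]] := complex_integral_bounded_linear cm.
  have [l2 [c2 b2]] := complex_integral_bounded_linear cn.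
  split; first by move=> b g h gb hb; rewrite l1// l2//; ring.
  exists (Re `|a| * c1 + c2) => g e gb ge; apply: le_trans (normReD _ _) _.
  rewrite normReM mulrDl -mulrA; apply: lerD; last exact: b2.
  by rewrite ler_wpM2l ?normRe_ge0//; exact: b1.
- by move=> E mE; rewrite !complex_integral_indic// rhoE.
Qed.

(** The remainders of a disjoint union decrease to the empty set, so that
    continuity there turns finite into countable additivity. *)
Lemma continuous_complex_measure (m : set T -> R[i]) :
  m set0 = 0 -> (forall E, ~ measurable E -> m E = 0) ->
  (forall A B, measurable A -> measurable B -> A `&` B = set0 -> m (A `|` B) = m A + m B) ->
  (forall V : nat -> set T, (forall n, measurable (V n)) ->
     (forall i j, (i <= j)%N -> V j `<=` V i) -> \bigcap_n V n = set0 ->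
     forall e : R, 0 < e -> \forall n \near \oo, Re `|m (V n)| < e) ->
  is_complex_measure m.
Proof.
move=> m0 mn mU mV0; split => // F mF tF.
pose V N := \bigcup_k F k `\` \big[setU/set0]_(k < N) F k.
have mUF : measurable (\bigcup_k F k) by exact: bigcupT_measurable.
have mB N : measurable (\big[setU/set0]_(k < N) F k) by exact: bigsetU_measurable.
have mV N : measurable (V N) by exact: measurableD.
have Vcap : \bigcap_N V N = set0.
  apply/seteqP; split => // x h; have [[k _ Fk] _] := h 0%N I.
  by have [_] := h k.+1 I; apply; apply/(bigsetU_ordP F); exists k.
have Vdec i j : (i <= j)%N -> V j `<=` V i.
  move=> ij x [Ux nK]; split => // /(bigsetU_ordP F)[k ki Fk].
  by apply: nK; apply/(bigsetU_ordP F); exists k => //; exact: leq_trans ki ij.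
have mS N : \sum_(0 <= k < N) m (F k) = m (\big[setU/set0]_(k < N) F k).
  rewrite big_mkord; elim: N => [|N IH]; first by rewrite !big_ord0.
  rewrite !big_ord_recr/= IH -mU//.
  apply/seteqP; split => // x [/(bigsetU_ordP F)[k kN Fk] FN].
  move/trivIsetP : tF => /(_ k N I I); rewrite (ltn_eqF kN) => /(_ isT) FkN.
  by rewrite -FkN.
have mD N : m (\bigcup_k F k) - \sum_(0 <= k < N) m (F k) = m (V N).
  rewrite mS; have UV : \bigcup_k F k = V N `|` \big[setU/set0]_(k < N) F k.
    apply/seteqP; split => x; last by case=> [[]//|/(bigsetU_ordP F)[k _ Fk]]; exists k.
    by move=> Ux; have [b|b] := pselect ((\big[setU/set0]_(k < N) F k) x); [right|left].
  rewrite {1}UV mU//; first by rewrite addrK.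
  by apply/seteqP; split => // x [[]].
apply/cvgrPdist_lt => /= e e0; rewrite ltcE in e0; case: e e0 => e e' /= /andP[/eqP e'0 e0].
apply: filterS (mV0 V mV Vdec Vcap e e0) => N h.
by rewrite mD e'0 normRe ltcE/= eqxx.
Qed.

Lemma measure_vanishing (rho : {measure set T -> \bar R}) (V : nat -> set T) :
  (rho setT < +oo)%E -> (forall n, measurable (V n)) ->
  (forall i j, (i <= j)%N -> V j `<=` V i) -> \bigcap_n V n = set0 ->
  forall e : R, 0 < e -> \forall n \near \oo, (rho (V n) < e%:E)%E.
Proof.
move=> rT mV Vdec Vcap e e0.
have rfin A : measurable A -> (rho A < +oo)%E.
  by move=> mA; apply: le_lt_trans rT; apply: le_measure; rewrite ?inE.
have cV : rho (V n) @[n --> \oo] --> 0%E.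
  rewrite -(measure0 rho) -Vcap; apply: nonincreasing_cvg_mu => //.
  - exact: rfin.
  - exact: bigcapT_measurable.
  - by move=> i j ij; apply/subsetPset; exact: Vdec.
have /fine_cvgP[_ /cvgrPdist_lt/(_ _ e0)] := cV.
have rVfin N : rho (V N) \is a fin_num by rewrite ge0_fin_numE// rfin.
apply: filterS => N /=; rewrite sub0r normrN => h.
by rewrite -(fineK (rVfin N)) lte_fin (le_lt_trans (ler_norm _)).
Qed.

Lemma dominated_complex_measure (m : set T -> R[i]) (rho : {measure set T -> \bar R}) :
  (rho setT < +oo)%E -> m set0 = 0 -> (forall E, ~ measurable E -> m E = 0) ->
  (forall A B, measurable A -> measurable B -> A `&` B = set0 -> m (A `|` B) = m A + m B) ->
  (forall A, measurable A -> ((Re `|m A|)%:E <= rho A)%E) ->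
  is_complex_measure m.
Proof.
move=> rT m0 mn mU mle; apply: continuous_complex_measure => // V mV Vdec Vcap e e0.
apply: filterS (measure_vanishing rT mV Vdec Vcap e0) => n h.
by rewrite -lte_fin; exact: le_lt_trans (mle _ (mV n)) h.
Qed.

End functionals.

(** * Convolution of regular complex measures *)
Section convolution_measure.
Context (R : realType) (G : lcGroupType).
Local Notation borel := (g_sigma_algebraType (@open G)).
Local Notation mborel := (@open G).-sigma.-measurable.
Local Notation M := (measure_algebra R G).
Implicit Types (mu nu rho : M) (E : set G) (x y : G) (g : borel -> R[i]).

Definition lambda mu : {measure set borel -> \bar R} := dominant (cmeasure_complex mu).
Definition J mu g := complex_integral (cmeasure_complex mu) g.

Lemma radon_le (p q : {measure set borel -> \bar R}) : radon q ->
  (forall E, mborel E -> (p E <= q E)%E) -> radon p.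
Proof.
move=> [qT qreg] pq; split; first exact: le_lt_trans (pq _ measurableT) qT.
move=> E mE e e0; have [K [U [cK oU KE EU qUK]]] := qreg E mE e e0.
exists K, U; split => //; apply: le_lt_trans qUK; apply: pq.
by apply: measurableD; [exact: borel_open|exact: borel_compact].
Qed.

Lemma radon_lambda mu : radon (lambda mu).
Proof.
split.
  by rewrite -ge0_fin_numE//; exact: dominant_fin.
have : regular_complex_measure (mu : set borel -> R[i]) by exact: cmeasureP.
rewrite inE => -[_ reg] E mE e e0.
have e4 : 0 < e / 4 by rewrite divr_gt0.
have [K [U [cK oU KE EU tvUK]]] := reg E mE _ e4.
exists K, U; split => //.
have mUK : mborel (U `\` K).
  by apply: measurableD; [exact: borel_open|exact: borel_compact].
apply: le_lt_trans (dominant_le_total_variation _ mUK) _.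
have -> : e%:E = ((e / 4)%:E + (e / 4)%:E + ((e / 4)%:E + (e / 4)%:E))%E.
  by rewrite -!EFinD; congr EFin; field.
by apply: lteD; apply: lteD.
Qed.

Lemma measure_algebra_ext mu nu : (forall E, mborel E -> mu E = nu E) -> mu = nu.
Proof.
move=> h; apply: val_inj; apply/funext => E /=.
have [mE|nE] := pselect (mborel E); first exact: h.
by have [_ -> // _] := cmeasure_complex mu; have [_ -> // _] := cmeasure_complex nu.
Qed.

Lemma cmeasureU mu A B : mborel A -> mborel B -> A `&` B = set0 -> mu (A `|` B) = mu A + mu B.
Proof.
move=> mA mB AB; rewrite -!(complex_integral_indic (cmeasure_complex mu))//; last exact: measurableU.
rewrite -complex_integralD; try exact: cbounded_measurable_indic.
congr complex_integral; apply/funext => x; rewrite -rmorphD; congr (_ %:C).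
rewrite !indicE in_setU; have [xA|] := boolP (x \in A); last by rewrite add0r.
rewrite [x \in B](_ : _ = false) ?addr0//; apply/negbTE/negP; rewrite !inE in xA * => xB.
by have : (A `&` B) x by []; rewrite AB.
Qed.

Lemma mu0 mu : mu set0 = 0. Proof. by have [] := cmeasure_complex mu. Qed.

(** The four Jordan parts are Radon, being dominated by [lambda mu], and their
    translates are measurable. *)
Lemma mu_translate_cbounded mu E : mborel E ->
  cbounded_measurable (fun y : borel => mu (rtrans E y)).
Proof.
move=> mE; have mEy y := rtrans_measurable y mE.
have jm (p : {measure set borel -> \bar R}) : (forall A, mborel A -> (p A <= lambda mu A)%E) ->
    measurable_fun setT (fun y : borel => fine (p (rtrans E y))).
  move=> ple; apply: (measurableT_comp (@fine_measurable R setT measurableT)).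
  by apply: radon_translate_measurable => //; apply: radon_le (radon_lambda mu) ple.
apply: cbounded_measurableP.
- rewrite (_ : (fun y => _) = fun y : borel =>
     fine (jordan_pos (hahn_posneg (charge_Re (cmeasure_complex mu))) (rtrans E y)) -
     fine (jordan_neg (hahn_posneg (charge_Re (cmeasure_complex mu))) (rtrans E y))); last first.
    apply/funext => y; have := jordan_decomp (hahn_posneg (charge_Re (cmeasure_complex mu))) (mEy y).
    rewrite {1}/charge_Re /cadd/= cscaleN1 => /(congr1 fine)/= ->.
    by rewrite fineB//; exact: fin_num_measure.
  apply: measurable_funB; apply: jm => A mA; rewrite /lambda dominantE.
    by rewrite -addeA leeDl// !adde_ge0.
  by rewrite -addeA addeCA leeDl// !adde_ge0.
- rewrite (_ : (fun y => _) = fun y : borel =>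
     fine (jordan_pos (hahn_posneg (charge_Im (cmeasure_complex mu))) (rtrans E y)) -
     fine (jordan_neg (hahn_posneg (charge_Im (cmeasure_complex mu))) (rtrans E y))); last first.
    apply/funext => y; have := jordan_decomp (hahn_posneg (charge_Im (cmeasure_complex mu))) (mEy y).
    rewrite {1}/charge_Im /cadd/= cscaleN1 => /(congr1 fine)/= ->.
    by rewrite fineB//; exact: fin_num_measure.
  apply: measurable_funB; apply: jm => A mA; rewrite /lambda dominantE.
    by rewrite addeCA leeDl// !adde_ge0.
  by rewrite addeA leeDr// !adde_ge0.
- exists (fine (lambda mu setT)) => y; rewrite -lee_fin fineK; last exact: dominant_fin.
  apply: le_trans (dominant_ge (cmeasure_complex mu) (mEy y)) _.
  by apply: measure_le => //; exact: measurableT.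
Qed.

Lemma convolution_funE mu nu E : mborel E ->
  convolution_fun mu nu E = J nu (fun y => mu (rtrans E y)).
Proof.
move=> mE; rewrite /convolution_fun asboolT// /J; congr complex_integral.
apply/funext => y; rewrite -(complex_integral_indic (cmeasure_complex mu) (rtrans_measurable y mE)).
by congr complex_integral; apply/funext => x; rewrite !indicE; congr (_%:R%:C); apply/idP/idP; rewrite !inE.
Qed.

(** The convolution of the dominating measures, taken twice, dominates
    [convolution_fun mu nu]: this gives both its countable additivity and its
    regularity. *)
Let pi mu nu : {measure set borel -> \bar R} := conv_fun (radon_lambda mu) (radon_lambda nu).
Let pi2 mu nu := measure_add (pi mu nu) (pi mu nu).

Let pi2E mu nu E : pi2 mu nu E = (pi mu nu E + pi mu nu E)%E.
Proof. exact: measure_addE. Qed.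

Let conv_le_pi mu nu E : mborel E -> ((Re `|convolution_fun mu nu E|)%:E <= pi2 mu nu E)%E.
Proof.
move=> mE; rewrite convolution_funE// pi2E.
have -> : (pi mu nu E + pi mu nu E = 2%:E * pi mu nu E)%E.
  by rewrite [(2%:E)%E](_ : _ = (1 + 1)%E)// ge0_muleDl// !mul1e.
apply: complex_integral_le.
- exact: mu_translate_cbounded.
- by apply: radon_translate_measurable => //; exact: radon_lambda.
- by move=> y; apply: dominant_ge; exact: rtrans_measurable.
Qed.

Let pi2_fin mu nu : (pi2 mu nu setT < +oo)%E.
Proof.
rewrite pi2E; have [h _] := radon_conv (radon_lambda mu) (radon_lambda nu).
by apply: lte_add_pinfty.
Qed.

Lemma convolution_fun_complex mu nu : is_complex_measure (convolution_fun mu nu).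
Proof.
apply: (@dominated_complex_measure _ _ _ _ (pi2 mu nu)).
- exact: pi2_fin.
- rewrite convolution_funE//.
  have [l _] := complex_integral_bounded_linear (cmeasure_complex nu).
  rewrite (_ : (fun y => _) = fun=> 0).
    rewrite /J -[RHS](mu0 nu) -(complex_integral_indic (cmeasure_complex nu) measurable0).
    by congr complex_integral; apply/funext => x; rewrite indicE in_set0.
  by apply/funext => y; rewrite (_ : rtrans set0 y = set0)// mu0.
- by move=> E nE; rewrite /convolution_fun asboolF.
- move=> A B mA mB AB; rewrite !convolution_funE//; last exact: measurableU.
  rewrite /J -complex_integralD; try exact: mu_translate_cbounded.
  congr complex_integral; apply/funext => y; rewrite -cmeasureU; try exact: rtrans_measurable.
    by [].
  by apply/seteqP; split => // x [Ax Bx]; rewrite -[set0]/(rtrans set0 y) -AB.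
- by move=> A mA; exact: conv_le_pi.
Qed.

Lemma convolution_fun_regular mu nu : is_regular (convolution_fun mu nu).
Proof.
move=> E mE e e0; have [_ reg] := radon_conv (radon_lambda mu) (radon_lambda nu).
have e2 : 0 < e / 2 by rewrite divr_gt0.
have [K [U [cK oU KE EU h]]] := reg E mE _ e2.
exists K, U; split => //.
have mUK : mborel (U `\` K).
  by apply: measurableD; [exact: borel_open|exact: borel_compact].
apply: (@le_lt_trans _ _ (pi2 mu nu (U `\` K))).
  by apply: total_variation_le_measure => // A mA; exact: conv_le_pi.
by rewrite pi2E [e in ltRHS]splitr EFinD; exact: lteD.
Qed.

(** The default value in the definition of [convolution] is never taken. *)
Lemma convolutionE mu nu E : mborel E ->
  convolution mu nu E = J nu (fun y => mu (rtrans E y)).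
Proof.
move=> mE; rewrite -convolution_funE// /convolution.
have h : convolution_fun mu nu \in @regular_complex_measure R G.
  by rewrite inE; split; [exact: convolution_fun_complex|exact: convolution_fun_regular].
by have := insubdK 0 h => /= ->.
Qed.

End convolution_measure.

(** * The measure algebra as a ring *)
(* Keeps unification from unfolding products of measures into integrals. *)
Local Opaque convolution.

Section algebra.
Context (R : realType) (G : lcGroupType).
Local Notation borel := (g_sigma_algebraType (@open G)).
Local Notation mborel := (@open G).-sigma.-measurable.
Local Notation M := (measure_algebra R G).
Implicit Types (mu nu rho : M) (E : set G) (g : borel -> R[i]) (a : R[i]).

Lemma cmeasureB mu nu E : (mu - nu) E = mu E - nu E. Proof. by []. Qed.

Lemma J_bounded_linear mu : bounded_linear (J mu).
Proof. exact: complex_integral_bounded_linear. Qed.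

Lemma J_indic mu E : mborel E -> J mu (fun x => (\1_E x : R)%:C) = mu E.
Proof. exact: complex_integral_indic. Qed.

Lemma JD mu f g : cbounded_measurable f -> cbounded_measurable g ->
  J mu (fun x => f x + g x) = J mu f + J mu g.
Proof. exact: complex_integralD. Qed.

Lemma JZ mu a f : cbounded_measurable f -> J mu (fun x => a * f x) = a * J mu f.
Proof. exact: complex_integralZ. Qed.

Lemma J_muD mu nu g : cbounded_measurable g -> J (mu + nu) g = J mu g + J nu g.
Proof.
move=> gb; rewrite -[J mu g]mul1r.
by apply: complex_integral_lin => // E mE; rewrite mul1r.
Qed.

Lemma J_muZ a mu g : cbounded_measurable g -> J (a *: mu) g = a * J mu g.
Proof.
move=> gb.
have := @complex_integral_lin _ _ _ _ _ _ (cmeasure_complex mu) (cmeasure_complex (0 : M))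
  (cmeasure_complex (a *: mu + 0)) a g (fun E _ => erefl) gb.
rewrite -/(J _ g) addr0 => ->; rewrite -/(J mu g) -/(J 0 g).
suff -> : J 0 g = 0 by rewrite addr0.
have := J_muD 0 0 gb; rewrite addr0 => /eqP; rewrite -subr_eq0 opprD addrA subrr sub0r oppr_eq0.
by move=> /eqP.
Qed.

Lemma cbounded_measurable_comp (f : G -> G) g : continuous f -> cbounded_measurable g ->
  cbounded_measurable (fun x : borel => g (f x)).
Proof.
move=> cf [[m1 [c1 b1]] [m2 [c2 b2]]].
have mf : measurable_fun setT (f : borel -> borel).
  by move=> _ E mE; rewrite setTI; exact: borel_preimage.
split; split.
- exact: (measurableT_comp m1 mf).
- by exists c1.
- exact: (measurableT_comp m2 mf).
- by exists c2.
Qed.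

Lemma cbounded_measurable_lim (f : borel -> R[i]) :
  (forall e : R, 0 < e -> exists2 g, cbounded_measurable g & forall x, Re `|f x - g x| <= e) ->
  cbounded_measurable f.
Proof.
move=> h; have /choice[u hu] : forall n : nat, exists g,
    cbounded_measurable g /\ forall x, Re `|f x - g x| <= n.+1%:R^-1.
  by move=> n; have [|g gb gf] := h n.+1%:R^-1; [rewrite invr_gt0|exists g].
have inv0 (e : R) : 0 < e -> \forall n \near \oo, n.+1%:R^-1 < e.
  move=> e0; have := @near_infty_natSinv_lt R (PosNum e0); exact.
apply: cbounded_measurableP.
- apply: (measurable_fun_cvg (h := fun n (x : borel) => Re (u n x))).
    by move=> n; case: (hu n) => -[[]].
  move=> x _; apply/cvgrPdist_lt => e /inv0; apply: filterS => n; apply: le_lt_trans.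
  rewrite -raddfB; apply: le_trans (abs_Re_le _) _; exact: (hu n).2.
- apply: (measurable_fun_cvg (h := fun n (x : borel) => Im (u n x))).
    by move=> n; case: (hu n) => -[_ []].
  move=> x _; apply/cvgrPdist_lt => e /inv0; apply: filterS => n; apply: le_lt_trans.
  rewrite -raddfB; apply: le_trans (abs_Im_le _) _; exact: (hu n).2.
- have [ub uf] := hu 0%N; have [c cu] := cbounded_measurable_bound ub.
  exists (1^-1 + c) => x; rewrite -(subrK (u 0%N x) (f x)).
  by apply: le_trans (normReD _ _) (lerD (uf x) (cu x)).
Qed.

(** Fubini's formula. For indicators it is the definition of the convolution;
    both sides respect linear combinations and uniform limits, and the
    measurability of the inner integral is carried along in the induction. *)
Lemma J_convolution mu nu g : cbounded_measurable g ->
  cbounded_measurable (fun y : borel => J mu (fun x => g (x * y)%g)) /\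
  J (convolution mu nu) g = J nu (fun y => J mu (fun x => g (x * y)%g)).
Proof.
have [lm [cm bm]] := J_bounded_linear mu; have [lc [cc bc]] := J_bounded_linear (convolution mu nu).
have [ln [cn bn]] := J_bounded_linear nu.
have tr (f : borel -> R[i]) (y : G) : cbounded_measurable f -> cbounded_measurable (fun x : borel => f ((x : G) * y)%g).
  by move=> fb; apply: cbounded_measurable_comp => //; exact: mulgr_continuous.
apply: (@cbounded_measurable_ind _ borel _ (fun g =>
  cbounded_measurable (fun y : borel => J mu (fun x => g (x * y)%g)) /\
  J (convolution mu nu) g = J nu (fun y => J mu (fun x => g (x * y)%g)))) => {g}.
- move=> E mE.
  have e : (fun y : borel => J mu (fun x => (\1_E (x * y)%g)%:C)) = (fun y => mu (rtrans E y)).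
    apply/funext => y; rewrite -J_indic; last exact: rtrans_measurable.
    by congr J; apply/funext => x; rewrite !indicE; congr (_%:R%:C); apply/idP/idP; rewrite !inE.
  rewrite e; split; first exact: mu_translate_cbounded.
  by rewrite J_indic// convolutionE.
- move=> a f g fb gb [f1 f2] [g1 g2].
  have e : (fun y : borel => J mu (fun x => a * f (x * y)%g + g (x * y)%g)) =
      (fun y => a * J mu (fun x => f (x * y)%g) + J mu (fun x => g (x * y)%g)).
    by apply/funext => y; rewrite lm//; exact: tr.
  rewrite e; split; first by apply: cbounded_measurableD => //; exact: cbounded_measurableZ.
  by rewrite lc// ln// f2 g2.
- move=> f fb flim.
  have key e : 0 < e -> exists g, [/\ cbounded_measurable g,
      cbounded_measurable (fun y : borel => J mu (fun x => g (x * y)%g)),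
      J (convolution mu nu) g = J nu (fun y => J mu (fun x => g (x * y)%g)),
      (forall x, Re `|f x - g x| <= e) &
      (forall y, Re `|J mu (fun x => f (x * y)%g) - J mu (fun x => g (x * y)%g)| <= cm * e)].
    move=> e0; have [g [gb [g1 g2] fg]] := flim e e0; exists g; split => // y.
    have -> : J mu (fun x => f (x * y)%g) - J mu (fun x => g (x * y)%g) =
        J mu (fun x => -1 * g (x * y)%g + f (x * y)%g).
      by rewrite lm ?mulN1r 1?addrC//; exact: tr.
    apply: bm => [|x]; last by rewrite mulN1r addrC.
    by apply: cbounded_measurableD; [apply: cbounded_measurableZ|]; exact: tr.
  have fcb : cbounded_measurable (fun y : borel => J mu (fun x => f (x * y)%g)).
    apply: cbounded_measurable_lim => e e0.
    have c1 : 0 < `|cm| + 1 by rewrite ltr_wpDl.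
    have [|g [_ gb _ _ h]] := key (e / (`|cm| + 1)); first by rewrite divr_gt0.
    eexists; first exact: gb.
    move=> y; apply: le_trans (h y) _; rewrite mulrCA ler_piMr ?(ltW e0)//.
    by rewrite ler_pdivrMr// mul1r (le_trans (ler_norm _))// lerDl.
  split => //; apply/eqP; rewrite -subr_eq0; apply/eqP.
  apply: (@small_eq0 _ _ (cc + cn * cm)) => e e0.
  have [g [gb gcb geq fg h]] := key e e0.
  have -> : J (convolution mu nu) f - J nu (fun y => J mu (fun x => f (x * y)%g)) =
     J (convolution mu nu) (fun x => -1 * g x + f x) -
     J nu (fun y => -1 * J mu (fun x => g (x * y)%g) + J mu (fun x => f (x * y)%g)).
    by rewrite lc// ln// geq !mulN1r opprD opprK addrACA addNr add0r.
  apply: le_trans (normReD _ _) _; rewrite normrN mulrDl; apply: lerD.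
    apply: bc => [|x]; last by rewrite mulN1r addrC.
    by apply: cbounded_measurableD => //; exact: cbounded_measurableZ.
  rewrite -mulrA; apply: bn => [|y]; last by rewrite mulN1r addrC.
  by apply: cbounded_measurableD => //; exact: cbounded_measurableZ.
Qed.

Definition dirac_fun (x : G) : set borel -> R[i] :=
  fun E => if `[< mborel E >] then (\1_E x)%:C else 0.

Lemma dirac_fun_le (x : G) E : mborel E -> ((Re `|dirac_fun x E|)%:E <= @dirac _ borel x R E)%E.
Proof.
move=> mE; rewrite /dirac_fun asboolT// normRe_real diracE lee_fin indicE.
by case: (x \in E); rewrite ?normr1 ?normr0.
Qed.

Lemma dirac_fun_regular (x : G) : dirac_fun x \in @regular_complex_measure R G.
Proof.
have m0 : mborel set0 := measurable0.
rewrite inE; split.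
  apply: (@dominated_complex_measure _ borel _ _ (@dirac _ borel x R)).
  - by have h : (@dirac _ borel x R setT < +oo)%E; [rewrite diracE ltry|exact: h].
  - by rewrite /dirac_fun asboolT// indicE in_set0.
  - by move=> E nE; rewrite /dirac_fun asboolF.
  - move=> A B mA mB AB; rewrite /dirac_fun !asboolT//; last exact: measurableU.
    rewrite -rmorphD; congr (_ %:C); rewrite !indicE in_setU.
    have [xA|] := boolP (x \in A); last by rewrite add0r.
    rewrite [x \in B](_ : _ = false) ?addr0//; apply/negbTE/negP; rewrite !inE in xA * => xB.
    by have : (A `&` B) x by []; rewrite AB.
  - exact: dirac_fun_le.
move=> E mE e e0; have cx : compact [set x] by exact: compact_set1.
have ox : open (~` [set x]) by rewrite openC; exact: closed_compact.
have suff0 K U : compact K -> open U -> ~ (U `\` K) x ->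
    (total_variation (dirac_fun x) (U `\` K) < e%:E)%E.
  move=> cK oU nx; have mUK : mborel (U `\` K).
    by apply: measurableD; [exact: borel_open|exact: borel_compact].
  apply: le_lt_trans (@total_variation_le_measure _ borel _ _ (@dirac _ borel x R) _ _ mUK) _.
    by move=> A mA; exact: dirac_fun_le.
  suff h : @dirac _ borel x R (U `\` K) = 0%E by rewrite [ltLHS]h lte_fin.
  by rewrite diracE memNset.
have [Ex|nEx] := pselect (E x).
  exists [set x], setT; split => //; [exact: openT|by move=> y ->|].
  by apply: suff0 => //; [exact: openT|move=> [_ h]; exact: h].
exists set0, (~` [set x]); split => //; first exact: compact0.
  by move=> y Ey xy; apply: nEx; rewrite -xy.
by apply: suff0 => //; [exact: compact0|move=> [h _]; exact: h].
Qed.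

Definition delta (x : G) : M := MeasureAlgebra (dirac_fun_regular x).

Lemma deltaE (x : G) E : mborel E -> delta x E = (\1_E x)%:C.
Proof. by move=> mE; rewrite /= /dirac_fun asboolT. Qed.

Lemma J_delta (x : G) g : cbounded_measurable g -> J (delta x) g = g x.
Proof.
apply: (@bounded_linear_eq _ borel R (J (delta x)) (fun g => g x)).
- exact: J_bounded_linear.
- by split => //; exists 1 => f e _ fe; rewrite mul1r.
- by move=> E mE; rewrite J_indic// deltaE.
Qed.

Lemma rtrans_rtrans E (y z : G) : rtrans (rtrans E z) y = rtrans E (y * z)%g.
Proof. by apply/seteqP; split => x; rewrite /rtrans/= mulgA. Qed.

(** Both sides integrate the indicator of [E] at [x y z], by Fubini's formula. *)
Lemma convolutionA mu nu rho :
  convolution mu (convolution nu rho) = convolution (convolution mu nu) rho.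
Proof.
apply: measure_algebra_ext => E mE.
transitivity (J (convolution nu rho) (fun y => mu (rtrans E y))); first exact: convolutionE.
transitivity (J rho (fun z => convolution mu nu (rtrans E z))); last exact/esym/convolutionE.
have [_ ->] := J_convolution nu rho (mu_translate_cbounded mu mE).
congr (J rho _); apply/funext => z.
rewrite (convolutionE mu nu (rtrans_measurable z mE)).
by congr (J nu _); apply/funext => y; rewrite rtrans_rtrans.
Qed.

Lemma convolutionDl mu nu rho :
  convolution (mu + nu) rho = convolution mu rho + convolution nu rho.
Proof.
apply: measure_algebra_ext => E mE.
transitivity (J rho (fun y => mu (rtrans E y) + nu (rtrans E y))).
  exact: (convolutionE (mu + nu) rho mE).
transitivity (convolution mu rho E + convolution nu rho E); last by [].
rewrite JD; [|exact: mu_translate_cbounded..].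
by congr (_ + _); exact/esym/convolutionE.
Qed.

Lemma convolutionDr mu nu rho :
  convolution mu (nu + rho) = convolution mu nu + convolution mu rho.
Proof.
apply: measure_algebra_ext => E mE.
transitivity (J (nu + rho) (fun y => mu (rtrans E y))); first exact: convolutionE.
transitivity (convolution mu nu E + convolution mu rho E); last by [].
rewrite J_muD; last exact: mu_translate_cbounded.
by congr (_ + _); exact/esym/convolutionE.
Qed.

Lemma convolutionZl a mu nu : convolution (a *: mu) nu = a *: convolution mu nu.
Proof.
apply: measure_algebra_ext => E mE.
transitivity (J nu (fun y => a * mu (rtrans E y))).
  exact: (convolutionE (a *: mu) nu mE).
transitivity (a * convolution mu nu E); last by [].
rewrite JZ; last exact: mu_translate_cbounded.
by congr (_ * _); exact/esym/convolutionE.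
Qed.

Lemma convolutionZr a mu nu : convolution mu (a *: nu) = a *: convolution mu nu.
Proof.
apply: measure_algebra_ext => E mE.
transitivity (J (a *: nu) (fun y => mu (rtrans E y))); first exact: convolutionE.
transitivity (a * convolution mu nu E); last by [].
rewrite J_muZ; last exact: mu_translate_cbounded.
by congr (_ * _); exact/esym/convolutionE.
Qed.

Lemma convolution_deltar mu (x : G) E : mborel E -> convolution mu (delta x) E = mu (rtrans E x).
Proof.
move=> mE; transitivity (J (delta x) (fun y => mu (rtrans E y))); first exact: convolutionE.
by rewrite J_delta//; exact: mu_translate_cbounded.
Qed.

Lemma convolution_deltal mu (x : G) E : mborel E ->
  convolution (delta x) mu E = mu [set y | E (x * y)%g].
Proof.
move=> mE; transitivity (J mu (fun y => delta x (rtrans E y))); first exact: convolutionE.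
rewrite -J_indic; last exact: (borel_preimage (@mulgl_continuous G x) mE).
congr (J mu _); apply/funext => y; rewrite deltaE; last exact: rtrans_measurable.
by rewrite !indicE; congr (_%:R%:C); apply/idP/idP; rewrite !inE.
Qed.

Lemma convolution1m mu : convolution (delta 1%g) mu = mu.
Proof.
apply: measure_algebra_ext => E mE.
transitivity (mu [set y | E (1 * y)%g]); first exact: convolution_deltal.
by congr (cmeasure mu _); apply/seteqP; split => x /=; rewrite mul1g.
Qed.

Lemma convolutionm1 mu : convolution mu (delta 1%g) = mu.
Proof.
apply: measure_algebra_ext => E mE.
transitivity (mu (rtrans E 1%g)); first exact: convolution_deltar.
by congr (cmeasure mu _); apply/seteqP; split => x; rewrite /rtrans/= mulg1.
Qed.

Lemma delta1_neq0 : delta 1%g != 0.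
Proof.
apply/eqP => h; have := deltaE 1%g measurableT; rewrite h indicE mem_set//.
by move=> /eqP; rewrite eq_sym oner_eq0.
Qed.

HB.instance Definition _ := GRing.Zmodule_isNzRing.Build M
  convolutionA convolution1m convolutionm1 convolutionDl convolutionDr delta1_neq0.

Lemma mulE mu nu : mu * nu = convolution mu nu. Proof. by []. Qed.
Lemma oneE : 1 = delta 1%g :> M. Proof. by []. Qed.

End algebra.

(** * Completeness for the total variation *)
Section completeness.
Context (R : realType) (G : lcGroupType).
Local Notation borel := (g_sigma_algebraType (@open G)).
Local Notation mborel := (@open G).-sigma.-measurable.
Local Notation M := (measure_algebra R G).
Implicit Types (mu nu rho : M) (E : set G) (g : borel -> R[i]) (a : R[i]).

(** The norm of the measure algebra takes its values in [R[i]]. *)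
Definition tvn mu : R := fine (total_variation mu setT).

Lemma tv_fin mu E : mborel E -> total_variation mu E \is a fin_num.
Proof. by apply: total_variation_fin_num; exact: cmeasure_complex. Qed.

Lemma normE mu : `|mu| = (tvn mu)%:C.
Proof. by []. Qed.

Lemma tvn_ge0 mu : 0 <= tvn mu.
Proof. by rewrite fine_ge0// Defs.total_variation_ge0//; exact: measurableT. Qed.

Lemma tvnD mu nu : tvn (mu + nu) <= tvn mu + tvn nu.
Proof. by rewrite -lecR rmorphD/= -!normE; exact: ler_normD. Qed.

Lemma tvnZ a mu : tvn (a *: mu) = Re `|a| * tvn mu.
Proof. by apply: complexI; rewrite rmorphM/= -normE normrZ normE normRe. Qed.

Lemma le_tvn mu E : mborel E -> Re `|mu E| <= tvn mu.
Proof.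
move=> mE; rewrite -lee_fin fineK; last by apply: tv_fin; exact: measurableT.
apply: le_trans (le_total_variation1 _ mE) _.
by apply: le_total_variation => //; exact: measurableT.
Qed.

Lemma lambda_le_tvn mu : (lambda mu setT <= (4 * tvn mu)%:E)%E.
Proof.
apply: le_trans (dominant_le_total_variation _ measurableT) _.
rewrite -(@fineK _ (total_variation mu setT)) ?tv_fin//.
by rewrite -!EFinD lee_fin -/(tvn mu); lra.
Qed.

Lemma real_limit (u : nat -> R) (eps : nat -> R) :
  (forall n m, (n <= m)%N -> `|u m - u n| <= eps n) ->
  (forall e : R, 0 < e -> exists n, eps n < e) ->
  exists l, forall n, `|l - u n| <= eps n.
Proof.
move=> ueps eps0.
have : cvgn u.
  apply: cauchy_cvg; apply: cauchy_exP => e e0.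
  have [n en] := eps0 e e0; exists (u n); exists n => // m nm.
  by rewrite /ball/= distrC; apply: le_lt_trans en; exact: ueps.
move=> /cvg_ex[l ul]; exists l => n.
apply/ler_addgt0Pl => e e0.
have /cvgrPdist_lt/(_ e e0)[N _ hN] := ul.
have h1 := hN (maxn n N) (leq_maxr _ _); have h2 := ueps n (maxn n N) (leq_maxl _ _).
rewrite -(subrK (u (maxn n N)) l) -addrA; apply: le_trans (ler_normD _ _) _.
by apply: lerD => //; exact: ltW.
Qed.

Lemma complex_limit (u : nat -> R[i]) (eps : nat -> R) :
  (forall n m, (n <= m)%N -> Re `|u m - u n| <= eps n) ->
  (forall e : R, 0 < e -> exists n, eps n < e) ->
  exists l, forall n, Re `|l - u n| <= 2 * eps n.
Proof.
move=> ueps eps0.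
have [l1 h1] := @real_limit (fun n => Re (u n)) eps
  (fun n m nm => le_trans (eq_ind _ (fun z => `|z| <= _) (abs_Re_le _) _ (raddfB _ _ _)) (ueps n m nm)) eps0.
have [l2 h2] := @real_limit (fun n => Im (u n)) eps
  (fun n m nm => le_trans (eq_ind _ (fun z => `|z| <= _) (abs_Im_le _) _ (raddfB _ _ _)) (ueps n m nm)) eps0.
exists (l1 +i* l2) => n; apply: le_trans (normRe_le _) _.
have := h1 n; have := h2 n; case: (u n) => p q /= ? ?.
by rewrite mulrDl mul1r; apply: lerD.
Qed.

Section limit.
Variables (u : nat -> M) (eps : nat -> R).
Hypothesis ueps : forall n m, (n <= m)%N -> tvn (u m - u n) <= eps n.
Hypothesis eps0 : forall e : R, 0 < e -> exists N, forall n, (N <= n)%N -> eps n < e.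

Let eps_small (e : R) : 0 < e -> exists n, eps n < e.
Proof. by move=> /eps0[N h]; exists N; exact: h. Qed.

Let limE E : exists l : R[i], mborel E -> forall n, Re `|l - u n E| <= 2 * eps n.
Proof.
have [mE|nE] := pselect (mborel E); last by exists 0.
have [|//|l hl] := @complex_limit (fun n => u n E) eps.
  by move=> n m nm; apply: le_trans (ueps nm); rewrite -cmeasureB; exact: le_tvn.
by exists l.
Qed.

(* The limit is taken separately on each Borel set. *)
Let s (E : set borel) : R[i] := if `[< mborel E >] then sval (cid (limE E)) else 0.

Let sE E n : mborel E -> Re `|s E - u n E| <= 2 * eps n.
Proof. by move=> mE; rewrite /s asboolT//; exact: (svalP (cid (limE E)) mE n). Qed.

Let s_unique (z : R[i]) c : (forall n, Re `|z| <= c * eps n) -> z = 0.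
Proof.
move=> h; apply: (@small_eq0 _ _ `|c|) => e e0.
have [n en] := eps_small e0; apply: le_trans (h n) _.
have ep : 0 <= eps n by apply: le_trans (ueps (leqnn n)); exact: tvn_ge0.
apply: le_trans (ler_norm _) _; rewrite normrM ler_wpM2l// ger0_norm// ltW//.
Qed.

(** Convergence is uniform in the set, so continuity at the empty set passes
    from one [u n] to [s]. *)
Let s_complex : is_complex_measure s.
Proof.
have m0 : mborel set0 := measurable0.
apply: continuous_complex_measure.
- apply: (@s_unique _ 2) => n; have := sE n m0.
  by rewrite mu0 subr0.
- by move=> E nE; rewrite /s asboolF.
- move=> A B mA mB AB; have mAB := measurableU _ _ mA mB.
  apply/eqP; rewrite -subr_eq0; apply/eqP; apply: (@s_unique _ 6) => n.
  have -> : s (A `|` B) - (s A + s B) =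
      (s (A `|` B) - u n (A `|` B)) + (- (s A - u n A) + - (s B - u n B)).
    have -> : - (s A - u n A) + - (s B - u n B) = (u n A + u n B) - (s A + s B).
      by rewrite !opprB addrACA -opprD.
    by rewrite cmeasureU// addrA subrK.
  have h1 := sE n mAB; have h2 := sE n mA; have h3 := sE n mB.
  apply: le_trans (normReD _ _) _; apply: le_trans (lerD h1 (normReD _ _)) _.
  by rewrite !normrN; lra.
- move=> V mV Vdec Vcap e e0.
  have e4 : 0 < e / 4 by rewrite divr_gt0.
  have e2 : 0 < e / 2 by rewrite divr_gt0.
  have [n en] := eps_small e4.
  have lT : (lambda (u n) setT < +oo)%E by have [] := radon_lambda (u n).
  apply: filterS (measure_vanishing lT mV Vdec Vcap e2) => k hk.
  rewrite -(subrK (u n (V k)) (s (V k))); apply: le_lt_trans (normReD _ _) _.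
  have h1 := sE n (mV k).
  have h2 : Re `|u n (V k)| < e / 2.
    by rewrite -lte_fin; apply: le_lt_trans hk; exact: dominant_ge.
  lra.
Qed.

(** For a fixed partition the values of [s] are limits of those of [u m], so the
    Cauchy bound holds before the supremum over partitions is taken. *)
Let s_tv n : (total_variation (fun E : set borel => (s E - u n E)%R) setT <= (eps n)%:E)%E.
Proof.
apply: ge_ereal_sup => _ [k [A [mA tA AE ->]]]; rewrite lee_fin.
apply/ler_addgt0Pl => e e0.
have ek : 0 < e / (2 * k.+1%:R) by rewrite divr_gt0// mulr_gt0.
have [N hN] := eps0 ek; pose m := maxn n N.
have em : eps m < e / (2 * k.+1%:R) by apply: hN; exact: leq_maxr.
have nm : (n <= m)%N by exact: leq_maxl.
have ep : 0 <= eps m by apply: le_trans (ueps (leqnn m)); exact: tvn_ge0.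
have hk : (2 * eps m) *+ k <= e.
  rewrite -mulr_natl; apply: (@le_trans _ _ (k.+1%:R * (2 * (e / (2 * k.+1%:R))))).
    by apply: ler_pM; rewrite ?mulr_ge0// ?ler_nat// ler_pM2l// ltW.
  rewrite (_ : k.+1%:R * _ = e)//; field; by rewrite addrC natr1 pnatr_eq0.
apply: (@le_trans _ _ (\sum_(i < k) (2 * eps m + Re `|(u m - u n) (A i)|))).
  apply: ler_sum => i _; rewrite -(subrK (u m (A i)) (s (A i))) -addrA.
  by apply: le_trans (normReD _ _) _; apply: lerD => //; exact: sE.
rewrite big_split/= sumr_const card_ord; apply: lerD.
  exact: hk.
apply: le_trans (ueps nm); rewrite -lee_fin fineK ?tv_fin//.
by apply: ereal_sup_ubound; exists k, A.
Qed.

(** Since [s - u n] has small variation on the whole group, the sets that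
    approximate [E] for [u n] do so for [s]. *)
Let s_regular : is_regular s.
Proof.
move=> E mE e e0; have e2 : 0 < e / 2 by rewrite divr_gt0.
have [n en] := eps_small e2.
have : regular_complex_measure (u n : set borel -> R[i]) by exact: cmeasureP.
rewrite inE => -[_ reg]; have [K [U [cK oU KE EU h]]] := reg E mE _ e2.
exists K, U; split => //.
have mUK : mborel (U `\` K).
  by apply: measurableD; [exact: borel_open|exact: borel_compact].
have -> : s = ((u n : set borel -> R[i]) + (fun E : set borel => (s E - u n E)%R))%R.
  by apply/funext => A; rewrite fctE addrC subrK.
apply: le_lt_trans (Defs.total_variationD _ _ mUK) _.
rewrite [e in ltRHS]splitr EFinD; apply: lteD => //.
apply: (@le_lt_trans _ _ (eps n)%:E); last by rewrite lte_fin.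
apply: le_trans (s_tv n); apply: le_total_variation => //; exact: measurableT.
Qed.

Lemma tvn_limit : exists s : M, forall n, tvn (s - u n) <= eps n.
Proof.
have h : s \in @regular_complex_measure R G by rewrite inE; split.
exists (MeasureAlgebra h) => n; rewrite -lee_fin fineK.
  exact: s_tv.
by apply: tv_fin; exact: measurableT.
Qed.

End limit.

Lemma closed_tvn (S : set M) s : closed S ->
  (forall e : R, 0 < e -> exists2 t, S t & tvn (s - t) < e) -> S s.
Proof.
move=> cS h; apply: cS => B /nbhs_ballP[e /= e0].
rewrite ltcE in e0; case: e e0 => e e' /= /andP[/eqP -> e0] eB.
have [t St ts] := h e e0; exists t; split => //; apply: eB.
by rewrite -ball_normE/= normE ltcR.
Qed.

(** Continuity of the product in each factor; the constant is not sharp. *)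
Lemma convolution_le mu nu E : mborel E ->
  Re `|(mu * nu) E| <= 32 * tvn mu * tvn nu.
Proof.
move=> mE; rewrite mulE.
have -> : convolution mu nu E = J nu (fun y => mu (rtrans E y)) by exact: convolutionE.
apply: le_trans (complex_integral_sup (e := tvn mu) _ _ _) _.
- exact: mu_translate_cbounded.
- by move=> y; apply: le_tvn; exact: rtrans_measurable.
rewrite -/(lambda nu); have := lambda_le_tvn nu.
rewrite -{1}(@fineK _ (lambda nu setT)); last exact: dominant_fin.
rewrite lee_fin => h; have := tvn_ge0 mu; have := tvn_ge0 nu => h1 h2.
have : tvn mu * fine (lambda nu setT) <= tvn mu * (4 * tvn nu) by rewrite ler_wpM2l.
have : 0 <= tvn mu * tvn nu by rewrite mulr_ge0.
by rewrite -!mulrA; lra.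
Qed.

Lemma scaleAl a mu nu : (a *: mu) * nu = a *: (mu * nu).
Proof. exact: convolutionZl. Qed.

Lemma scaleAr a mu nu : mu * (a *: nu) = a *: (mu * nu).
Proof. exact: convolutionZr. Qed.

(** With weights [c i > 0] small enough, the series of the [c i *: e i] converges
    to an element [s] of the closed set [S], and [e j * s = c j *: e j]. *)
Lemma orthogonal_limit (S : set M) (e : nat -> M) : closed S -> S 0 ->
  (forall mu nu, S mu -> S nu -> S (mu + nu)) ->
  (forall a mu, S mu -> S (a *: mu)) ->
  (forall i, S (e i)) -> (forall i, e i != 0) ->
  (forall i, e i * e i = e i) -> (forall i j, i != j -> e i * e j = 0) ->
  exists2 s, S s & (forall i, e i * s * e i != 0) /\
     (forall i j, i != j -> e i * s * e j = 0).
Proof.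
move=> cS S0 SD SZ Se e0 ee eo.
(* The norm of the i-th term is then at most 2^-i. *)
pose c i : R := (2 ^+ i)^-1 / (1 + tvn (e i)).
have t1 i : 0 < 1 + tvn (e i) by rewrite ltr_pwDl// tvn_ge0.
have c0 i : 0 < c i by rewrite divr_gt0// invr_gt0 exprn_gt0.
pose u n : M := \sum_(i < n) ((c i)%:C *: e i).
have uS n : u n.+1 = u n + (c n)%:C *: e n by rewrite /u big_ord_recr.
pose eps n : R := 2 / 2 ^+ n.
have epsS n : eps n.+1 = eps n / 2 by rewrite /eps exprS; field; rewrite expf_neq0.
have eps_gt0 n : 0 < eps n by rewrite divr_gt0// exprn_gt0.
have step n : tvn ((c n)%:C *: e n) <= eps n - eps n.+1.
  rewrite tvnZ normRe_real gtr0_norm// epsS.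
  have -> : eps n - eps n / 2 = (2 ^+ n)^-1 by rewrite /eps; field; rewrite expf_neq0.
  rewrite /c -mulrA ler_piMr ?invr_ge0 ?exprn_ge0// mulrC ler_pdivrMr// mul1r.
  by rewrite lerDr.
have ueps n m : (n <= m)%N -> tvn (u m - u n) <= eps n.
  move=> nm; apply: (@le_trans _ _ (eps n - eps m)); last by rewrite gerBl ltW.
  elim: m nm => [|m IH]; first by rewrite leqn0 => /eqP ->; rewrite !subrr -lecR -normE normr0.
  rewrite leq_eqVlt => /orP[/eqP <-|]; first by rewrite !subrr -lecR -normE normr0.
  rewrite ltnS => /IH h; rewrite uS addrAC; apply: le_trans (tvnD _ _) _.
  by have := step m; lra.
have epslim (r : R) : 0 < r -> exists N, forall n, (N <= n)%N -> eps n < r.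
  move=> r0; exists (Num.truncn (2 / r)).+1 => n nN.
  rewrite ltr_pdivrMr ?exprn_gt0// -ltr_pdivrMl// mulrC.
  apply: (lt_le_trans (truncnS_gt _)); apply: (@le_trans _ _ n%:R); first by rewrite ler_nat.
  by rewrite -natrX ler_nat ltnW// ltn_expl.
have [s us] := tvn_limit ueps epslim.
have Su n : S (u n).
  by elim: n => [|n IH]; [rewrite /u big_ord0|rewrite uS; apply: SD => //; exact: SZ].
have eu j n : (j < n)%N -> e j * u n = (c j)%:C *: e j.
  elim: n => // n IH; rewrite uS mulrDr ltnS leq_eqVlt => /orP[/eqP ->|jn].
    rewrite scaleAr ee [X in X + _](_ : _ = 0) ?add0r//.
    rewrite /u mulr_sumr big1// => i _; rewrite scaleAr eo ?scaler0//.
    by rewrite neq_ltn ltn_ord orbT.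
  by rewrite IH// scaleAr eo ?scaler0 ?addr0// neq_ltn jn.
have es j : e j * s = (c j)%:C *: e j.
  apply/eqP; rewrite -subr_eq0; apply/eqP; apply: measure_algebra_ext => E mE.
  apply: (@small_eq0 _ _ (32 * tvn (e j))) => r r0.
  have [N hN] := epslim r r0; pose n := maxn N j.+1.
  have -> : e j * s - (c j)%:C *: e j = e j * (s - u n).
    by rewrite mulrBr (eu j n)// leq_maxr.
  apply: le_trans (convolution_le _ _ mE) _; rewrite ler_wpM2l ?mulr_ge0 ?tvn_ge0//.
  by apply: le_trans (us n) _; apply/ltW/hN; exact: leq_maxl.
exists s.
  apply: closed_tvn cS _ => r /epslim[N hN]; exists (u N) => //.
  by apply: le_lt_trans (us N) _; exact: hN.
split=> [i|i j ij]; rewrite es scaleAl.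
  rewrite ee scaler_eq0 negb_or e0 andbT; apply/eqP => /(@complexI R)/eqP.
  by rewrite gt_eqF.
by rewrite eo// scaler0.
Qed.

End completeness.

(** * Continuous functions of compact support *)
Section cc.
Context (R : realType) (G : lcGroupType).
Implicit Types (f g h phi : G -> R) (K U V : set G).

(** Short for continuous with compact support; [ccp] adds nonnegativity. *)
Definition cc f := continuous f /\ exists2 K, compact K & forall x, ~ K x -> f x = 0.
Definition ccp f := cc f /\ forall x, 0 <= f x.

Lemma cc0 : cc (fun=> 0).
Proof. by split; [move=> x; exact: cvg_cst|exists set0 => //; exact: compact0]. Qed.

Lemma ccD f g : cc f -> cc g -> cc (fun x => f x + g x).
Proof.
move=> [cf [K cK fK]] [cg [L cL gL]]; split.
  by move=> x; apply: cvgD; [exact: cf|exact: cg].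
exists (K `|` L); first exact: compactU.
by move=> x nKL; rewrite fK ?gL ?addr0// => h; apply: nKL; [right|left].
Qed.

Lemma ccM f g : cc f -> continuous g -> cc (fun x => f x * g x).
Proof.
move=> [cf [K cK fK]] cg; split.
  by move=> x; apply: cvgM; [exact: cf|exact: cg].
by exists K => // x nK; rewrite fK ?mul0r.
Qed.

Lemma ccZ (c : R) f : cc f -> cc (fun x => c * f x).
Proof.
move=> fc; have cc : continuous (fun _ : G => c) by move=> x; exact: cvg_cst.
rewrite (_ : (fun x => _) = (fun x => f x * c)); first exact: ccM.
by apply/funext => x; rewrite mulrC.
Qed.

Lemma cc_comp f (t : G -> G) (t' : G -> G) : cc f -> continuous t -> continuous t' ->
  cancel t t' -> cc (fun x => f (t x)).
Proof.
move=> [cf [K cK fK]] ct ct' tK; split.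
  by move=> x; apply: continuous_comp; [exact: ct|exact: cf].
exists (t' @` K).
  by apply: continuous_compact => //; apply: continuous_subspaceT.
by move=> x nK; apply: fK => Kt; apply: nK; exists (t x).
Qed.

Lemma cc_rt f (s : G) : cc f -> cc (fun x => f (x * s)%g).
Proof.
move=> fc; apply: (@cc_comp f (fun x => (x * s)%g) (fun x => (x * s^-1)%g) fc).
- exact: mulgr_continuous.
- exact: mulgr_continuous.
- by move=> x; rewrite mulgK.
Qed.

Lemma ccpD f g : ccp f -> ccp g -> ccp (fun x => f x + g x).
Proof. by move=> [? f0] [? g0]; split; [exact: ccD|move=> x; exact: addr_ge0]. Qed.

Lemma ccpZ (c : R) f : 0 <= c -> ccp f -> ccp (fun x => c * f x).
Proof. by move=> c0 [? f0]; split; [exact: ccZ|move=> x; exact: mulr_ge0]. Qed.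

Lemma ccp_rt f (s : G) : ccp f -> ccp (fun x => f (x * s)%g).
Proof. by move=> [? f0]; split => //; exact: cc_rt. Qed.

Lemma cc_bounded f : cc f -> exists2 c, 0 < c & forall x, `|f x| <= c.
Proof.
move=> [cf [K cK fK]].
have /compact_bounded[c [_ hc]] : compact (f @` K).
  by apply: continuous_compact => //; exact: continuous_subspaceT.
exists (`|c| + 1) => [|x]; first by rewrite ltr_wpDl.
have [Kx|nKx] := pselect (K x); last by rewrite fK// normr0 addr_ge0.
by apply: hc; [rewrite ltr_pwDr// ler_norm|exists x].
Qed.

Lemma near1_inv (P : G -> Prop) :
  (\forall v \near (1%g : G), P v) -> \forall v \near (1%g : G), P (v^-1)%g.
Proof.
move=> P1; have : (fun x : G => (x^-1)%g) @ (1%g : G) --> (1%g : G).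
  by rewrite -[X in _ --> X]invg1; exact: invg_continuous.
by apply.
Qed.

(** Compactness gives uniformity on the support; a point that [v] moves into the
    support is treated by exchanging [v] and [v^-1]. *)
Lemma cc_left_uniform f (e : R) : cc f -> 0 < e ->
  \forall v \near (1%g : G), forall x, `|f (v * x)%g - f x| <= e.
Proof.
move=> [cf [K cK fK]] e0.
have near1 : \forall v \near (1%g : G), forall x, K x -> `|f (v * x)%g - f x| < e.
  apply: (@compact_uniform_near _ K _ _ (fun v x => `|f (v * x)%g - f x| < e)) => // x Kx.
  have cont : (fun p : G * G => f (p.1 * p.2)%g - f p.2) @ nbhs (1%g, x) --> f (1 * x)%g - f x.
    apply: (@cvgB R R).
      apply: (@cvg_comp (G * G)%type G R (fun p => (p.1 * p.2)%g) f _ (nbhs (1 * x)%g)); last exact: cf.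
      exact: (@mulg_continuous G (1%g, x)).
    by apply: (@cvg_comp (G * G)%type G R snd f _ (nbhs x)); [exact: cvg_snd|exact: cf].
  move: cont; rewrite mul1g subrr => /cvgrPdist_lt/(_ e e0)[[A B]]/= [A1 Bx] AB.
  exists (B, A) => // -[x' v]/= [Bx' Av].
  by have := AB (v, x') (conj Av Bx'); rewrite /= sub0r normrN.
have inv1 := near1_inv near1.
apply: filterS2 near1 inv1 => v h1 h2 x.
have [Kx|nKx] := pselect (K x); first exact: ltW (h1 x Kx).
rewrite (fK x nKx) subr0; have [Kvx|nKvx] := pselect (K (v * x)%g).
  by have := h2 _ Kvx; rewrite mulKg (fK x nKx) sub0r normrN => /ltW.
by rewrite fK// normr0 ltW.
Qed.

Lemma cc_right_uniform f (e : R) : cc f -> 0 < e ->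
  \forall v \near (1%g : G), forall x, `|f (x * v)%g - f x| <= e.
Proof.
move=> fc e0; have ci : continuous (fun x : G => (x^-1)%g) by exact: invg_continuous.
have fic : cc (fun x => f (x^-1)%g) by apply: (cc_comp fc ci ci); exact: invgK.
apply: filterS (near1_inv (cc_left_uniform fic e0)) => v h x.
by have := h (x^-1)%g; rewrite -invgM !invgK.
Qed.

Lemma bump_function (x : G) U : nbhs x U ->
  exists f : G -> R, [/\ ccp f, f x = 1, forall y, f y <= 1 & forall y, ~ U y -> f y = 0].
Proof.
move=> xU; have [C [cC CU] xC] := compact_nbhs xU.
have clC : closed (~` C^°) by rewrite closedC; exact: open_interior.
have nCx : ~ (~` C^°) x by move=> h; apply: h.
have := @locally_compact_completely_regular G R lcgroup_locally_compact
  lcgroup_hausdorff x _ clC nCx.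
move=> /(@uniform_separatorP _ R)[f [cf f01 f0 f1]].
have fC y : ~ C y -> f y = 1.
  move=> nC; have : [set (1 : R)] (f y); last by [].
  by apply: f1; exists y => // Cy; apply: nC; exact: (@interior_subset _ C _ Cy).
have fb y : 0 <= f y <= 1 by have := f01 (f y) (ex_intro2 _ _ y I erefl); rewrite /= in_itv.
exists (fun y => 1 - f y); split.
- split; last by move=> y; rewrite subr_ge0; case/andP: (fb y).
  split; first by move=> y; apply: cvgB; [exact: cvg_cst|exact: cf].
  by exists C => // y nC; rewrite fC// subrr.
- by rewrite (f0 (f x)) ?subr0//; exists x.
- by move=> y; rewrite gerBl; case/andP: (fb y).
- by move=> y nU; rewrite fC ?subrr// => /CU.
Qed.

(** Multiples of bump functions add up to a function that is at least [1] on
    [K], which is then truncated at [1]. *)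
Lemma urysohn_compact K U : compact K -> open U -> K `<=` U ->
  exists f : G -> R, [/\ ccp f, forall x, K x -> f x = 1, forall x, f x <= 1 & forall x, ~ U x -> f x = 0].
Proof.
move=> cK oU KU.
have [||x Kx|f [fc fU] fK] := @compact_directed G (G -> R)
    [set f | ccp f /\ forall x, ~ U x -> f x = 0] (fun f x => 1 <= f x) K cK.
- by exists (fun=> 0); split => //; split => //; exact: cc0.
- move=> f g [fc fU] [gc gU]; exists (fun x => f x + g x).
    by split; [exact: ccpD|move=> x nU; rewrite fU// gU// addr0].
  move=> x [] h; apply: (le_trans h); [rewrite lerDl|rewrite lerDr]; by [case: gc|case: fc].
- have [f [fc fx _ fU]] := bump_function (open_nbhs_nbhs (conj oU (KU x Kx))).
  exists (fun y => 2 * f y); first by split; [exact: ccpZ|move=> y nU; rewrite fU ?mulr0].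
  have cf : {for x, continuous f} by case: fc => -[+ _] _; apply.
  have /cvgrPdist_lt/(_ (1/2)) := cf; rewrite divr_gt0// => /(_ isT).
  by apply: filterS => y; rewrite fx => /ltr_normlW; lra.
exists (fun x => Num.min 1 (f x)); split.
- have [[cf [L cL fL]] f0] := fc; split; last by move=> x; rewrite le_min ler01 f0.
  split; last by exists L => // x nL; rewrite fL// min_r.
  by move=> x; apply: (@continuous_min _ _ (fun=> 1) f); [exact: cvg_cst|exact: cf].
- by move=> x Kx; rewrite min_l//; exact: fK.
- by move=> x; rewrite ge_min lexx.
- by move=> x nU; rewrite fU// min_r.
Qed.

(** * Covering numbers *)
Section covering_number.

Definition admissible phi := ccp phi /\ exists s, 0 < phi s.
Definition nonneg (l : seq (R * G)) := forall p, p \in l -> 0 <= p.1.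
Definition comb phi (l : seq (R * G)) x := \sum_(p <- l) p.1 * phi (x * p.2)%g.
Definition weight (l : seq (R * G)) := \sum_(p <- l) p.1.
Definition covers f phi l := nonneg l /\ forall x, f x <= comb phi l x.
(** Weil's covering number [(f : phi)]: the least total weight of a combination
    of right translates of [phi] that dominates [f]. Up to normalization it
    becomes the integral of [f] as the support of [phi] shrinks. *)
Definition covnum f phi := inf [set weight l | l in covers f phi].

Lemma weight_ge0 l : nonneg l -> 0 <= weight l.
Proof. by move=> nl; rewrite /weight big_seq sumr_ge0. Qed.

Lemma comb_ge0 phi l x : ccp phi -> nonneg l -> 0 <= comb phi l x.
Proof.
move=> [_ p0] nl; rewrite /comb big_seq sumr_ge0// => p pl.
by rewrite mulr_ge0//; exact: nl.
Qed.

Lemma covers_exists f phi : ccp f -> admissible phi -> exists l, covers f phi l.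
Proof.
move=> [[cf [K cK fK]] f0] [pc [s ps]].
have [||x Kx|l nl lK] := @compact_directed G (seq (R * G)) nonneg
    (fun l x => f x <= comb phi l x) K cK.
- by exists [::].
- move=> l m nl nm; exists (l ++ m).
    by move=> p; rewrite mem_cat => /orP[]; [exact: nl|exact: nm].
  move=> x; rewrite /comb big_cat/= => -[] h; apply: (le_trans h).
    by rewrite lerDl; exact: comb_ge0.
  by rewrite lerDr; exact: comb_ge0.
- pose c := 2 * (f x + 1) / phi s.
  have c0 : 0 <= c by rewrite divr_ge0 ?ltW// mulr_gt0// ltr_wpDl.
  exists [:: (c, (x^-1 * s)%g)]; first by move=> p; rewrite inE => /eqP ->.
  have cphi : {for x, continuous (fun y => phi (y * (x^-1 * s))%g)}.
    by have [[cont _] _] := ccp_rt (x^-1 * s)%g pc; exact: cont.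
  have ps2 : 0 < phi s / 2 by rewrite divr_gt0.
  have /cvgrPdist_lt/(_ _ ps2) h1 := cphi; have /cvgrPdist_lt/(_ 1 ltr01) h2 := cf x.
  apply: filterS2 h1 h2 => y /ltr_normlW h1; rewrite distrC => /ltr_normlW h2.
  rewrite /comb big_seq1/=; move: h1; rewrite mulVKg => h1.
  apply: (@le_trans _ _ (c * (phi s / 2))).
    have -> : c * (phi s / 2) = f x + 1 by rewrite /c; field; rewrite gt_eqF.
    by lra.
  by rewrite ler_wpM2l//; lra.
exists l; split => // x; have [Kx|nKx] := pselect (K x); first exact: lK.
by rewrite fK//; exact: comb_ge0.
Qed.

Lemma covnum_lb f phi : has_lbound [set weight l | l in covers f phi].
Proof. by exists 0 => _ [l [nl _] <-]; exact: weight_ge0. Qed.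

Lemma covnum_le f phi l : covers f phi l -> covnum f phi <= weight l.
Proof. by move=> cl; apply: ge_inf; [exact: covnum_lb|exists l]. Qed.

Lemma le_covnum f phi c : ccp f -> admissible phi ->
  (forall l, covers f phi l -> c <= weight l) -> c <= covnum f phi.
Proof.
move=> fc pa h; apply: lb_le_inf.
  by have [l cl] := covers_exists fc pa; exists (weight l); exists l.
by move=> _ [l cl <-]; exact: h.
Qed.

Lemma covnum_ge0 f phi : ccp f -> admissible phi -> 0 <= covnum f phi.
Proof. by move=> fc pa; apply: le_covnum => // l [nl _]; exact: weight_ge0. Qed.

Lemma covnum_rt f phi (s : G) : ccp f -> admissible phi ->
  covnum (fun x => f (x * s)%g) phi = covnum f phi.
Proof.
move=> fc pa.
have le (g : G -> R) (t : G) : ccp g -> covnum (fun x => g (x * t)%g) phi <= covnum g phi.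
  move=> gc; apply: le_covnum => // l [nl lg].
  have -> : weight l = weight [seq (p.1, (t * p.2)%g) | p <- l] by rewrite /weight big_map.
  apply: covnum_le; split; first by move=> _ /mapP[p pl ->]/=; exact: nl.
  move=> x; apply: le_trans (lg (x * t)%g) _.
  by rewrite /comb big_map; under [leRHS]eq_bigr do rewrite /= mulgA.
apply/le_anti/andP; split; first exact: le.
have := le _ (s^-1)%g (ccp_rt s fc); congr (covnum _ _ <= _).
by apply/funext => x; rewrite mulgVK.
Qed.

Lemma covnumD f g phi : ccp f -> ccp g -> admissible phi ->
  covnum (fun x => f x + g x) phi <= covnum f phi + covnum g phi.
Proof.
move=> fc gc pa; rewrite -lerBlDr; apply: le_covnum => // l [nl lf].
rewrite lerBlDr -lerBlDl; apply: le_covnum => // m [nm mg].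
rewrite lerBlDl; have -> : weight l + weight m = weight (l ++ m) by rewrite /weight big_cat.
apply: covnum_le; split; first by move=> p; rewrite mem_cat => /orP[]; [exact: nl|exact: nm].
by move=> x; rewrite /comb big_cat; exact: lerD.
Qed.

(** Coverings compose. As [covnum] is an infimum, coverings of weight [0] or
    close to it are treated apart. *)
Lemma covnum_trans f g phi : ccp f -> admissible g -> admissible phi ->
  covnum f phi <= covnum f g * covnum g phi.
Proof.
move=> fc ga pa; have [gc _] := ga.
have key l m : covers f g l -> covers g phi m -> covnum f phi <= weight l * weight m.
  move=> [nl lf] [nm mg].
  pose n := [seq (p.1 * q.1, (p.2 * q.2)%g) | p <- l, q <- m].
  have -> : weight l * weight m = weight n.
    rewrite /weight /n big_allpairs_dep/= mulr_suml; apply: eq_bigr => p _.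
    by rewrite mulr_sumr.
  apply: covnum_le; split.
    by move=> _ /allpairsP[[p q] [/= pl qm ->]]/=; rewrite mulr_ge0//; [exact: nl|exact: nm].
  move=> x; apply: le_trans (lf x) _; rewrite /comb /n big_allpairs_dep/=.
  rewrite big_seq [leRHS]big_seq; apply: ler_sum => p pl.
  apply: (@le_trans _ _ (p.1 * comb phi m (x * p.2)%g)).
    by rewrite ler_wpM2l//; exact: nl.
  by rewrite /comb mulr_sumr; apply: ler_sum => q _; rewrite mulrA mulgA.
have ig0 := covnum_ge0 gc pa.
have [ig|] := eqVneq (covnum g phi) 0.
  have [l cl] := covers_exists fc ga; rewrite ig mulr0.
  have nl : 0 <= weight l by case: cl => nl _; exact: weight_ge0.
  apply/ler_addgt0Pl => e e0; rewrite addr0.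
  have el : 0 < e / (weight l + 1) by rewrite divr_gt0// ltr_wpDl.
  have hi : has_inf [set weight m | m in covers g phi].
    split; last exact: covnum_lb.
    by have [m cm] := covers_exists gc pa; exists (weight m); exists m.
  have [_ [m cm <-] hm] := inf_adherent el hi.
  apply: le_trans (key _ _ cl cm) _; rewrite -/(covnum g phi) ig add0r in hm.
  apply: (@le_trans _ _ (weight l * (e / (weight l + 1)))); first by rewrite ler_wpM2l// ltW.
  by rewrite mulrA ler_pdivrMr ?ltr_wpDl// mulrC ler_pM2l// lerDl.
rewrite neq_lt ltNge ig0/= => igp.
rewrite -ler_pdivrMr//; apply: le_covnum => // l cl.
rewrite ler_pdivrMr//; have nl : 0 <= weight l by case: cl => nl _; exact: weight_ge0.
have [l0|] := eqVneq (weight l) 0.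
  have [m cm] := covers_exists gc pa; have := key l m cl cm.
  by rewrite l0 !mul0r.
rewrite neq_lt ltNge nl/= => lp.
rewrite mulrC -ler_pdivrMr//; apply: le_covnum => // m cm.
by rewrite ler_pdivrMr// mulrC; exact: key.
Qed.

Lemma covnum_gt0 f phi : admissible f -> admissible phi -> 0 < covnum f phi.
Proof.
move=> [fc [s fs]] pa; have [pc _] := pa.
have [b b0 hb] := cc_bounded (proj1 pc).
apply: (@lt_le_trans _ _ (f s / b)); first by rewrite divr_gt0.
apply: le_covnum => // l [nl lf]; rewrite ler_pdivrMr//; apply: le_trans (lf s) _.
rewrite /comb /weight mulr_suml big_seq [leRHS]big_seq; apply: ler_sum => p pl.
by rewrite ler_wpM2l//; [exact: nl|exact: le_trans (ler_norm _) (hb _)].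
Qed.

Lemma covnumZ (c : R) f phi : 0 < c -> ccp f -> admissible phi ->
  covnum (fun x => c * f x) phi = c * covnum f phi.
Proof.
have le a (g : G -> R) : 0 < a -> ccp g -> admissible phi ->
    covnum (fun x => a * g x) phi <= a * covnum g phi.
  move=> a0 gc pa; rewrite mulrC -ler_pdivrMr//; apply: le_covnum => // l [nl lg].
  rewrite ler_pdivrMr//.
  have -> : weight l * a = weight [seq (a * p.1, p.2) | p <- l].
    by rewrite /weight big_map/= mulrC mulr_sumr.
  apply: covnum_le; split.
    by move=> _ /mapP[p pl ->]/=; rewrite mulr_ge0 ?(ltW a0)//; exact: nl.
  move=> x; rewrite /comb big_map/=; under eq_bigr do rewrite -mulrA.
  by rewrite -mulr_sumr ler_pM2l.
move=> c0 fc pa; apply/le_anti/andP; split; first exact: le.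
rewrite -ler_pdivlMl//; have ci : 0 < c^-1 by rewrite invr_gt0.
have := le c^-1 _ ci (ccpZ (ltW c0) fc) pa; congr (covnum _ _ <= _).
by apply/funext => x; rewrite mulrA mulVf ?mul1r// gt_eqF.
Qed.

(** Subadditivity is reversed up to [e]: a covering of [f1 + f2] is split by the
    functions [h_i = f_i / (f1 + f2 + e)], which are almost constant on the small
    supports of the translates of [phi]. Adding [e] to the denominator is paid
    for by [f'], which is at least [1] where [f1] or [f2] does not vanish. *)
Lemma covnum_additive f1 f2 f' (e : R) : ccp f1 -> ccp f2 -> ccp f' ->
  (forall x, f' x < 1 -> f1 x = 0 /\ f2 x = 0) -> 0 < e ->
  exists2 V, nbhs (1%g : G) V & forall phi, admissible phi -> (forall x, ~ V x -> phi x = 0) ->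
   covnum f1 phi + covnum f2 phi <=
     (1 + 2 * e) * (covnum (fun x => f1 x + f2 x) phi + e * covnum f' phi).
Proof.
move=> f1c f2c f'c f'1 e0.
have f10 := proj2 f1c; have f20 := proj2 f2c; have f'0 := proj2 f'c.
pose q x := f1 x + f2 x + e.
have q0 x : 0 < q x by rewrite ltr_wpDl// addr_ge0.
have cq : continuous q.
  have [[c1 _] _] := f1c; have [[c2 _] _] := f2c.
  by move=> x; apply: cvgD; [apply: cvgD; [exact: c1|exact: c2]|exact: cvg_cst].
have cqi : continuous (fun x => (q x)^-1).
  by move=> x; apply: cvgV; [rewrite gt_eqF|exact: cq].
pose h1 x := f1 x * (q x)^-1; pose h2 x := f2 x * (q x)^-1.
have h1c : cc h1 by apply: ccM => //; case: f1c.
have h2c : cc h2 by apply: ccM => //; case: f2c.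
have h12 x : h1 x + h2 x <= 1.
  by rewrite -mulrDl ler_pdivrMr// mul1r lerDl ltW.
pose V : set G := [set v | (forall x, `|h1 (v * x)%g - h1 x| <= e) /\
                         (forall x, `|h2 (v * x)%g - h2 x| <= e)].
exists V.
  by apply: filterS2 (cc_left_uniform h1c e0) (cc_left_uniform h2c e0) => v.
move=> phi pa pV; have [pc _] := pa; have p0 := proj2 pc.
pose hh x := (f1 x + f2 x) + e * f' x.
have f12c := ccpD f1c f2c; have ef'c := ccpZ (ltW e0) f'c.
have hhc : ccp hh by exact: ccpD f12c ef'c.
have e2 : 0 < 1 + 2 * e by rewrite ltr_wpDr ?mulr_ge0 ?ltW.
apply: (@le_trans _ _ ((1 + 2 * e) * covnum hh phi)); last first.
  by rewrite (ler_pM2l e2); apply: le_trans (covnumD f12c ef'c pa) _; rewrite covnumZ.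
rewrite mulrC -ler_pdivrMr//; apply: le_covnum => // l [nl lh].
rewrite ler_pdivrMr// mulrC.
have cov (fi hi : G -> R) : ccp fi -> (forall x, hi x = fi x * (q x)^-1) ->
    (forall x, f' x < 1 -> fi x = 0) -> (forall v x, V v -> `|hi (v * x)%g - hi x| <= e) ->
    covnum fi phi <= \sum_(p <- l) p.1 * (hi (p.2^-1)%g + e).
  move=> fic hiE fi1 hiu.
  have hi0 x : 0 <= hi x by rewrite hiE mulr_ge0 ?invr_ge0 ?(ltW (q0 x))//; case: fic.
  have -> : \sum_(p <- l) p.1 * (hi (p.2^-1)%g + e) =
      weight [seq (p.1 * (hi (p.2^-1)%g + e), p.2) | p <- l] by rewrite /weight big_map.
  apply: covnum_le; split.
    by move=> _ /mapP[p pl ->]/=; rewrite mulr_ge0 ?addr_ge0 ?(ltW e0)//; exact: nl.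
  move=> x; rewrite /comb big_map/=.
  apply: (@le_trans _ _ (hi x * hh x)).
    have [lt|ge] := ltP (f' x) 1.
      by rewrite fi1// mulr_ge0//; case: hhc.
    rewrite hiE -mulrA ler_peMr//; first by case: fic.
    rewrite mulrC ler_pdivlMr// mul1r /q /hh lerD2l ler_peMr// ltW//.
  apply: (@le_trans _ _ (hi x * comb phi l x)); first by rewrite ler_wpM2l.
  rewrite /comb mulr_sumr big_seq [leRHS]big_seq; apply: ler_sum => p pl.
  have [Vx|nVx] := pselect (V (x * p.2)%g); last by rewrite pV// !mulr0.
  rewrite mulrCA mulrA ler_wpM2r// ler_wpM2l//; first exact: nl.
  have := hiu _ (p.2^-1)%g Vx; rewrite mulgK => /ler_normlW; lra.
apply: (@le_trans _ _ (\sum_(p <- l) p.1 * (h1 (p.2^-1)%g + e) +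
                       \sum_(p <- l) p.1 * (h2 (p.2^-1)%g + e))).
  apply: lerD; apply: cov => //.
  - by move=> x /f'1[].
  - by move=> v x [+ _]; apply.
  - by move=> x /f'1[].
  - by move=> v x [_]; apply.
rewrite -big_split/= /weight mulr_sumr big_seq [leRHS]big_seq; apply: ler_sum => p pl.
rewrite -mulrDr mulrC ler_wpM2r//; first exact: nl.
by have := h12 (p.2^-1)%g; lra.
Qed.

End covering_number.
End cc.

(** * A right-invariant Haar functional *)
Section haar.
Context (R : realType) (G : lcGroupType).
Implicit Types (f g h phi : G -> R).

Lemma ultra_bounded_cvg (T : Type) (F : set_system T) (r : T -> R) (c : R) :
  UltraFilter F -> F [set t | 0 <= r t <= c] -> exists l : R, r @ F --> l.
Proof.
move=> FU Fc; have := @segment_compact R 0 c.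
have FF : ProperFilter F by exact: ultra_proper.
have Fr : F [set t | (`[0, c]%classic : set R) (r t)].
  by apply: filterS Fc => t h; rewrite /= in_itv.
move=> /(_ (r @ F) _ Fr)[l [_ lr]].
exists l => B lB; have [//|nB] := in_ultra_setVsetC (r @^-1` B) FU.
by have [x []] := lr (~` B) B nB lB.
Qed.

Lemma cvg_le (T : Type) (F : set_system T) (FF : ProperFilter F) (u v : T -> R) (a b : R) :
  u @ F --> a -> v @ F --> b -> F [set t | u t <= v t] -> a <= b.
Proof.
move=> ua vb uv; rewrite -subr_ge0; apply: (cvgr_to_ge (cvgB vb ua)).
by apply: filterS uv => t /=; rewrite subr_ge0.
Qed.

(** Normalized by the covering number of a fixed [f0], the number [(f : phi)]
    stays in a bounded interval, so it converges along an ultrafilter of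
    functions [phi] whose supports shrink to the identity. Invariance and
    homogeneity pass to the limit, and additivity appears there, by
    [covnum_additive]. *)
Lemma positive_haar : exists I : (G -> R) -> R,
  [/\ forall f g, ccp f -> ccp g -> I (fun x => f x + g x) = I f + I g,
      forall c f, 0 < c -> ccp f -> I (fun x => c * f x) = c * I f,
      forall f, ccp f -> 0 <= I f,
      forall f s, ccp f -> I (fun x => f (x * s)%g) = I f &
      forall f x, ccp f -> 0 < f x -> 0 < I f].
Proof.
have [f0 [f0c f01 _ _]] := @bump_function R G 1%g setT filterT.
have f0a : admissible f0 by split => //; exists 1%g; rewrite f01.
pose B (V : set G) : set (G -> R) := [set phi | admissible phi /\ forall x, ~ V x -> phi x = 0].
have BF : ProperFilter (filter_from (nbhs (1%g : G)) B).
  apply: filter_from_proper; last first.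
    move=> V V1; have [f [fc f1 _ fV]] := @bump_function R G 1%g V V1; exists f; split => //.
    by split => //; exists 1%g; rewrite f1.
  apply: filter_from_filter; first by exists setT; exact: filterT.
  move=> V W V1 W1; exists (V `&` W); first exact: filterI.
  move=> phi [pa pVW]; split; split => // x n; apply: pVW => -[? ?]; exact: n.
have [F [FU BsF]] := ultraFilterLemma BF.
have FF : ProperFilter F by exact: ultra_proper.
have Fa : F [set phi | admissible phi].
  apply: BsF; exists setT; first exact: filterT.
  by move=> phi [].
pose r f phi := covnum f phi / covnum f0 phi.
have i0 phi : admissible phi -> 0 < covnum f0 phi by move=> pa; exact: covnum_gt0.
have rcv f : ccp f -> exists l : R, r f @ F --> l.
  move=> fc; apply: (@ultra_bounded_cvg _ F (r f) (covnum f f0)).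
  apply: filterS Fa => phi pa /=; rewrite divr_ge0 ?(ltW (i0 _ pa)) ?covnum_ge0//=.
  by rewrite ler_pdivrMr ?i0//; exact: covnum_trans.
pose I f : R := lim (r f @ F).
have Icv f : ccp f -> r f @ F --> I f.
  by move=> fc; have [l rl] := rcv f fc; apply/cvg_ex; exists l.
have I0 f : ccp f -> 0 <= I f.
  move=> fc; have c0 : (fun=> 0 : R) @ F --> (0 : R) by exact: cvg_cst.
  apply: (cvg_le FF c0 (Icv f fc)); apply: filterS Fa => phi pa.
  by rewrite /= /r divr_ge0 ?(ltW (i0 _ pa))// covnum_ge0.
exists I; split.
- move=> f g fc gc; have fgc := ccpD fc gc.
  apply/le_anti/andP; split.
    have c1 := Icv _ fgc; have c2 : (fun phi => r f phi + r g phi) @ F --> I f + I g.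
      by apply: cvgD; exact: Icv.
    apply: (cvg_le FF c1 c2); apply: filterS Fa => phi pa.
    by rewrite /= /r -mulrDl ler_pM2r ?invr_gt0 ?i0//; exact: covnumD.
  have [[_ [K cK fK]] _] := fc; have [[_ [L cL gL]] _] := gc.
  have [f' [f'c f'1 _ _]] := @urysohn_compact R G _ _ (compactU cK cL) (@openT G) (@subsetT _ _).
  have key e : 0 < e -> I f + I g <= (1 + 2 * e) * (I (fun x => f x + g x) + e * I f').
    move=> e0; have [x h|V V1 hV] := @covnum_additive R G f g f' e fc gc f'c _ e0.
      have nKL : ~ (K `|` L) x by move=> /f'1 h1; move: h; rewrite h1 ltxx.
      by split; [apply: fK|apply: gL] => h1; apply: nKL; [left|right].
    have c1 : (fun phi => r f phi + r g phi) @ F --> I f + I g by apply: cvgD; exact: Icv.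
    have c2 : (fun phi => (1 + 2 * e) * (r (fun x => f x + g x) phi + e * r f' phi)) @ F -->
        (1 + 2 * e) * (I (fun x => f x + g x) + e * I f').
      by apply: cvgMl_tmp; apply: cvgD; [exact: Icv|apply: cvgMl_tmp; exact: Icv].
    apply: (cvg_le FF c1 c2); apply: BsF; exists V => // phi [pa pV].
    rewrite /= /r -mulrDl [e * (_ / _)]mulrA -mulrDl mulrA ler_pM2r ?invr_gt0 ?i0//.
    exact: hV.
  have If'0 := I0 _ f'c; have Ifg0 := I0 _ fgc.
  apply/ler_addgt0Pl => d d0.
  pose D := 2 * I (fun x => f x + g x) + 3 * I f' + 1.
  have D0 : 0 < D by rewrite ltr_wpDl// addr_ge0// mulr_ge0.
  have e0 : 0 < Num.min 1 (d / D) by rewrite lt_min ltr01 divr_gt0.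
  apply: le_trans (key _ e0) _; set e := Num.min _ _ in e0 *.
  have e1 : e <= 1 by rewrite /e ge_min lexx.
  have ed : e * D <= d by rewrite -ler_pdivlMr// /e ge_min lexx orbT.
  have h : e * (e * I f') <= e * I f' by rewrite ler_piMl// mulr_ge0// ltW.
  rewrite /D in ed.
  have -> : (1 + 2 * e) * (I (fun x => f x + g x) + e * I f') =
     I (fun x => f x + g x) + e * (2 * I (fun x => f x + g x)) + e * I f' + 2 * (e * (e * I f')).
    by ring.
  move: ed; rewrite !mulrDr mulr1; have := mulr_ge0 (ltW e0) If'0.
  have -> : e * (3 * I f') = 3 * (e * I f') by ring.
  lra.
- move=> c f c0 fc; apply: (@cvg_unique _ _ (r (fun x => c * f x) @ F)) => //.
    by apply: Icv; apply: ccpZ => //; exact: ltW.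
  have c2 : (fun phi => c * r f phi) @ F --> c * I f by apply: cvgMl_tmp; exact: Icv.
  apply: cvg_trans c2; apply: near_eq_cvg; apply: filterS Fa => phi pa.
  by rewrite /= /r covnumZ// mulrA.
- exact: I0.
- move=> f s fc; apply: (@cvg_unique _ _ (r (fun x => f (x * s)%g) @ F)) => //.
    by apply: Icv; exact: ccp_rt.
  apply: cvg_trans (Icv _ fc); apply: near_eq_cvg; apply: filterS Fa => phi pa.
  by rewrite /= /r covnum_rt.
- move=> f x fc fx; have fa : admissible f by split => //; exists x.
  have i1 : 0 < covnum f0 f by exact: covnum_gt0.
  apply: (@lt_le_trans _ _ (covnum f0 f)^-1); first by rewrite invr_gt0.
  have c0 : (fun=> (covnum f0 f)^-1 : R) @ F --> (covnum f0 f)^-1 by exact: cvg_cst.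
  apply: (cvg_le FF c0 (Icv f fc)); apply: filterS Fa => phi pa.
  by rewrite /= /r ler_pdivlMr ?i0// mulrC ler_pdivrMr// mulrC covnum_trans.
Qed.

Lemma cc_max f : cc f -> ccp (fun x => Num.max (f x) 0).
Proof.
move=> [cf [K cK fK]]; split; last by move=> x; rewrite le_max lexx orbT.
split; last by exists K => // x nK; rewrite fK// maxxx.
by move=> x; apply: (@continuous_max _ _ f (fun=> 0)); [exact: cf|exact: cvg_cst].
Qed.

Lemma ccN f : cc f -> cc (fun x => - f x).
Proof.
move=> fc; have := ccZ (-1) fc.
by rewrite (_ : (fun x => -1 * f x) = (fun x => - f x))//; apply/funext => x; rewrite mulN1r.
Qed.

(** Extension by differences of positive and negative parts. *)
Theorem right_haar_functional : exists I : (G -> R) -> R,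
  [/\ forall f g, cc f -> cc g -> I (fun x => f x + g x) = I f + I g,
      forall c f, cc f -> I (fun x => c * f x) = c * I f,
      forall f, ccp f -> 0 <= I f,
      forall f s, cc f -> I (fun x => f (x * s)%g) = I f &
      forall f x, ccp f -> 0 < f x -> 0 < I f].
Proof.
have [P [PD PZ P0 Pinv Ppos]] := positive_haar.
pose pos f x := Num.max (f x) 0; pose neg f x := Num.max (- f x) 0.
pose I f := P (pos f) - P (neg f).
have pc f : cc f -> ccp (pos f) by exact: cc_max.
have nc f : cc f -> ccp (neg f) by move=> fc; apply: cc_max; exact: ccN.
have pnE f x : f x = pos f x - neg f x.
  rewrite /pos /neg; have /orP[h|h] := le_total 0 (f x).
    by rewrite (max_l h) max_r ?subr0// oppr_le0.
  by rewrite (max_r h) max_l ?oppr_ge0// sub0r opprK.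
have IE f g h : cc f -> ccp g -> ccp h -> (forall x, f x = g x - h x) -> I f = P g - P h.
  move=> fc gc hc fgh; apply/eqP; rewrite /I subr_eq addrAC eq_sym subr_eq eq_sym; apply/eqP.
  rewrite -!PD //; try by [exact: pc|exact: nc].
  congr P; apply/funext => x; have := fgh x; rewrite (pnE f x); lra.
have I_ccp f : ccp f -> I f = P f.
  move=> fc; have z : ccp (fun _ : G => 0 : R) by split => //; exact: cc0.
  have P00 : P (fun _ : G => 0) = 0.
    have := PD _ _ z z; rewrite (_ : (fun x => 0 + 0) = fun=> 0).
      by lra.
    by apply/funext => x; rewrite addr0.
  rewrite (IE f f (fun=> 0))//; first by rewrite P00 subr0.
    by case: fc.
  by move=> x; rewrite subr0.
have ID f g : cc f -> cc g -> I (fun x => f x + g x) = I f + I g.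
  move=> fc gc; rewrite (IE _ (fun x => pos f x + pos g x) (fun x => neg f x + neg g x)).
  - rewrite !PD; try by [exact: pc|exact: nc].
    by rewrite /I opprD addrACA.
  - exact: ccD.
  - by apply: ccpD; exact: pc.
  - by apply: ccpD; exact: nc.
  - by move=> x; rewrite (pnE f x) (pnE g x); lra.
have IN f : cc f -> I (fun x => - f x) = - I f.
  move=> fc; rewrite (IE _ (neg f) (pos f)); [by rewrite /I opprB|exact: ccN|exact: nc|exact: pc|].
  by move=> x; rewrite {1}(pnE f x) opprB.
have IZp c f : 0 < c -> cc f -> I (fun x => c * f x) = c * I f.
  move=> c0 fc; rewrite (IE _ (fun x => c * pos f x) (fun x => c * neg f x)).
  - by rewrite !PZ; [rewrite mulrBr|by []|exact: nc|by []|exact: pc].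
  - exact: ccZ.
  - by apply: ccpZ; [exact: ltW|exact: pc].
  - by apply: ccpZ; [exact: ltW|exact: nc].
  - by move=> x; rewrite -mulrBr -pnE.
exists I; split => //.
- move=> c f fc; have [c0|c0|<-] := ltgtP 0 c.
  + exact: IZp.
  + rewrite -[c]opprK mulNr -IZp ?oppr_gt0// -IN; last exact: ccZ.
    by congr I; apply/funext => x; rewrite !mulNr opprK.
  + rewrite mul0r (_ : (fun x => 0 * f x) = (fun x => f x + - f x)).
      by rewrite ID ?IN ?subrr//; exact: ccN.
    by apply/funext => x; rewrite mul0r subrr.
- by move=> f fc; rewrite I_ccp//; exact: P0.
- move=> f s fc; rewrite (IE _ (fun x => pos f (x * s)%g) (fun x => neg f (x * s)%g)).
  + by rewrite !Pinv; [|exact: nc|exact: pc].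
  + exact: cc_rt.
  + by apply: ccp_rt; exact: pc.
  + by apply: ccp_rt; exact: nc.
  + by move=> x; exact: pnE.
- by move=> f x fc fx; rewrite I_ccp//; exact: Ppos fx.
Qed.

End haar.

(** * Combinations of translations and their adjoints *)
Section hilbert.
Context (R : realType) (G : lcGroupType).
Implicit Types (h k : G -> R[i]) (b : seq (R[i] * G)).

(** A list [b] stands for the combination of the point masses at the [p.2] with
    coefficients [p.1], and [act b h] at [z] is the integral of [h (z x)] against
    it. *)
Definition act b h : G -> R[i] := fun z => \sum_(p <- b) p.1 * h (z * p.2)%g.
(** The adjoint of [act b], see [ip_act]. *)
Definition star b : seq (R[i] * G) := [seq ((p.1)^*%C, (p.2^-1)%g) | p <- b].
Definition mass b : R := \sum_(p <- b) Re `|p.1|.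
Definition ccc h := cc (fun z => Re (h z)) /\ cc (fun z => Im (h z)).
(** The real part of the Hermitian product, which is all that norms require. *)
Definition dot (z w : R[i]) : R := Re z * Re w + Im z * Im w.

Lemma dotC z w : dot z w = dot w z.
Proof. by rewrite /dot ![Re z * _]mulrC ![Im z * _]mulrC. Qed.

Lemma dotDl x y z : dot (x + y) z = dot x z + dot y z.
Proof. by rewrite /dot Re_add Im_add !mulrDl addrACA. Qed.

Lemma dotDr x y z : dot x (y + z) = dot x y + dot x z.
Proof. by rewrite !(dotC x) dotDl. Qed.

Lemma dot_conj a z w : dot (a * z) w = dot z (a^*%C * w).
Proof. by case: a z w => [a1 a2] [z1 z2] [w1 w2]; rewrite /dot/=; ring. Qed.

Lemma dot_norm z : dot z z = (Re `|z|) ^+ 2.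
Proof. by case: z => a b; rewrite /dot normc_def/= sqr_sqrtr ?addr_ge0 ?sqr_ge0// !expr2. Qed.

Lemma dot_le z w : dot z w <= Re `|z| * Re `|w|.
Proof.
have -> : dot z w = Re (z * w^*%C) by case: z w => [a b] [c d]; rewrite /dot/=; ring.
apply: le_trans (ler_norm _) _; apply: le_trans (abs_Re_le _) _.
rewrite normReM; congr (_ * _ <= _): (lexx (Re `|z| * Re `|w|)).
by case: w => c d; rewrite !normc_def/= sqrrN.
Qed.

Lemma ccc0 : ccc (fun=> 0).
Proof. by split; exact: cc0. Qed.

Lemma cccD h k : ccc h -> ccc k -> ccc (fun z => h z + k z).
Proof.
move=> [h1 h2] [k1 k2]; split.
  by under eq_fun do rewrite Re_add; exact: ccD.
by under eq_fun do rewrite Im_add; exact: ccD.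
Qed.

Lemma cccZ a h : ccc h -> ccc (fun z => a * h z).
Proof.
move=> [h1 h2]; split.
  under eq_fun do rewrite Re_mul -mulNr; apply: ccD; exact: ccZ.
under eq_fun do rewrite Im_mul; apply: ccD; exact: ccZ.
Qed.

Lemma ccc_rt h s : ccc h -> ccc (fun z => h (z * s)%g).
Proof. by move=> [h1 h2]; split; [exact: (cc_rt s h1)|exact: (cc_rt s h2)]. Qed.

Lemma ccc_act b h : ccc h -> ccc (act b h).
Proof.
move=> hc; rewrite /act; elim: b => [|p b IH].
  by under eq_fun do rewrite big_nil; exact: ccc0.
under eq_fun do rewrite big_cons; apply: cccD => //.
by apply: cccZ; exact: ccc_rt.
Qed.

Lemma cc_dot h k : ccc h -> ccc k -> cc (fun z => dot (h z) (k z)).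
Proof. by move=> [h1 h2] [[k1 _] [k2 _]]; apply: ccD; exact: ccM. Qed.

Variable I : (G -> R) -> R.
Hypothesis ID : forall f g : G -> R, cc f -> cc g -> I (fun x => f x + g x) = I f + I g.
Hypothesis IZ : forall c (f : G -> R), cc f -> I (fun x => c * f x) = c * I f.
Hypothesis I0 : forall f : G -> R, ccp f -> 0 <= I f.
Hypothesis Iinv : forall (f : G -> R) s, cc f -> I (fun x => f (x * s)%g) = I f.

Definition ip h k := I (fun z => dot (h z) (k z)).

Lemma I_mono (f g : G -> R) : cc f -> cc g -> (forall x, f x <= g x) -> I f <= I g.
Proof.
move=> fc gc fg; rewrite -subr_ge0.
have -> : I g - I f = I (fun x => g x + -1 * f x).
  by rewrite ID ?IZ ?mulN1r//; exact: ccZ.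
by apply: I0; split; [apply: ccD => //; exact: ccZ|move=> x; rewrite mulN1r subr_ge0].
Qed.

Lemma ip_act b h k : ccc h -> ccc k -> ip (act b h) k = ip h (act (star b) k).
Proof.
move=> hc kc; rewrite /ip; elim: b => [|p b IH].
  congr I; apply/funext => z; rewrite /act !big_nil/= /dot !mul0r !mulr0.
  by [].
have c1 : cc (fun z => dot (p.1 * h (z * p.2)%g) (k z)).
  by apply: cc_dot => //; apply: cccZ; exact: ccc_rt.
have c2 : cc (fun z => dot (act b h z) (k z)) by apply: cc_dot => //; exact: ccc_act.
have c3 : cc (fun z => dot (h z) ((p.1)^*%C * k (z * p.2^-1)%g)).
  by apply: cc_dot => //; apply: cccZ; exact: ccc_rt.
have c4 : cc (fun z => dot (h z) (act (star b) k z)) by apply: cc_dot => //; exact: ccc_act.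
transitivity (I (fun z => dot (p.1 * h (z * p.2)%g) (k z) + dot (act b h z) (k z))).
  by congr I; apply/funext => z; rewrite -dotDl /act big_cons.
transitivity (I (fun z => dot (h z) ((p.1)^*%C * k (z * p.2^-1)%g) + dot (h z) (act (star b) k z))).
  rewrite ID// ID// IH; congr (_ + _); rewrite -(Iinv p.2 c3).
  by congr I; apply/funext => z; rewrite dot_conj mulgK.
by congr I; apply/funext => z; rewrite -dotDr /act /star big_cons.
Qed.

(** Put [u = T f], [w = T' u] and [y = T w], for [T = act b] with adjoint [T'].
    Then [<u, u> = <f, w>] is at most [(s <f, f> + s^-1 <w, w>) / 2], and
    [<w, w> = <y, u>] is small when [y] is uniformly small. *)
Lemma ip_act_bound (f : G -> R) b (eta s : R) : ccp f -> 0 < s ->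
  (forall z, Re `|act b (act (star b) (act b (fun x => (f x)%:C))) z| <= eta) ->
  ip (act b (fun x => (f x)%:C)) (act b (fun x => (f x)%:C)) <=
  (s * I (fun x => f x * f x) + s^-1 * (eta * (mass b * I f))) / 2.
Proof.
move=> fp s0 yeta; have [fc f0] := fp.
set F := fun x => (f x)%:C; set u := act b F; set w := act (star b) u; set y := act b w in yeta.
have Fc : ccc F by split => //; exact: cc0.
have uc : ccc u by exact: ccc_act.
have wc : ccc w by exact: ccc_act.
have yc : ccc y by exact: ccc_act.
have uu : ip u u = ip F w by rewrite {1}/u ip_act.
have ww : ip w w = ip y u by rewrite /y ip_act// -/w.
have eta0 : 0 <= eta by apply: le_trans (yeta 1%g); exact: normRe_ge0.
have mf (c : seq (R[i] * G)) : cc (fun z => \sum_(p <- c) Re `|p.1| * f (z * p.2)%g) /\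
    I (fun z => \sum_(p <- c) Re `|p.1| * f (z * p.2)%g) = mass c * I f.
  elim: c => [|p c [IH1 IH2]].
    under eq_fun do rewrite big_nil; split; first exact: cc0.
    rewrite /mass big_nil mul0r -[RHS](mul0r (I f)) -IZ//.
    by congr I; apply/funext => z; rewrite mul0r.
  have c1 : cc (fun z => Re `|p.1| * f (z * p.2)%g) by apply: ccZ; exact: cc_rt.
  under eq_fun do rewrite big_cons; split; first exact: ccD.
  rewrite ID// IH2 IZ; last exact: cc_rt.
  by rewrite Iinv// /mass big_cons mulrDl.
have [mc mE] := mf b.
have wwle : ip w w <= eta * (mass b * I f).
  rewrite ww -mE -IZ//; apply: I_mono; [exact: cc_dot|exact: ccZ|] => z.
  apply: le_trans (dot_le _ _) _; apply: ler_pM; rewrite ?normRe_ge0//.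
  rewrite /u /act; elim: (b) => [|p c IH]; first by rewrite !big_nil normr0.
  rewrite !big_cons; apply: le_trans (normReD _ _) _; apply: lerD => //.
  rewrite normReM; suff -> : Re `|F (z * p.2)%g| = f (z * p.2)%g by [].
  by rewrite /F normRe_real ger0_norm.
have ffc : cc (fun x => f x * f x) by apply: ccM => //; case: fc.
have wwc : cc (fun z => dot (w z) (w z)) by exact: cc_dot.
rewrite uu mulrC; apply: (@le_trans _ _ (2^-1 * (s * I (fun x => f x * f x) + s^-1 * ip w w))).
  rewrite -(IZ s ffc) -(IZ s^-1 wwc) -ID; [|exact: ccZ..].
  rewrite -IZ; last by apply: ccD; exact: ccZ.
  apply: I_mono; [exact: cc_dot|by apply: ccZ; apply: ccD; exact: ccZ|] => z.
  rewrite /F /dot/= mul0r addr0.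
  set p := Re (w z); set q := Im (w z); set t := f z.
  have sV : s * s^-1 = 1 by rewrite divff// gt_eqF.
  have : 0 <= s^-1 * ((s * t - p) ^+ 2 + q ^+ 2).
    by rewrite mulr_ge0 ?invr_ge0 ?(ltW s0)// addr_ge0 ?sqr_ge0.
  have -> : s^-1 * ((s * t - p) ^+ 2 + q ^+ 2) =
    (s * s^-1) * (s * t * t) - 2 * (s * s^-1) * (t * p) + s^-1 * (p * p + q * q) by ring.
  by rewrite sV; lra.
by rewrite ler_wpM2l// lerD2l ler_wpM2l ?invr_ge0// ltW.
Qed.

End hilbert.

(** * Approximation by finitely many point masses *)
Section discretization.
Context (R : realType) (G : lcGroupType).
Local Notation borel := (g_sigma_algebraType (@open G)).
Local Notation mborel := (@open G).-sigma.-measurable.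
Local Notation M := (measure_algebra R G).
Implicit Types (mu nu : M) (E B : set G) (g h : borel -> R[i]).

Definition lam nu E : R := fine (lambda nu E).

Lemma lamE nu E : mborel E -> lambda nu E = (lam nu E)%:E.
Proof. by move=> mE; rewrite /lam fineK//; exact: dominant_fin. Qed.

Lemma le_lam nu E : mborel E -> Re `|nu E| <= lam nu E.
Proof. by move=> mE; rewrite -lee_fin -lamE//; exact: dominant_ge. Qed.

Lemma lam_ge0 nu E : 0 <= lam nu E.
Proof. by rewrite fine_ge0. Qed.

Lemma lam_mono nu E B : mborel E -> mborel B -> E `<=` B -> lam nu E <= lam nu B.
Proof.
move=> mE mB EB; rewrite -lee_fin -!lamE//; exact: measure_le.
Qed.

Lemma lam_split nu E B : mborel E -> mborel B -> lam nu E = lam nu (E `&` B) + lam nu (E `\` B).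
Proof.
move=> mE mB; apply: EFin_inj; rewrite EFinD -!lamE//.
- by rewrite (measureDI _ mE mB) addrC.
- exact: measurableD.
- exact: measurableI.
Qed.

Lemma J_le_split nu g (e m : R) E : mborel E -> cbounded_measurable g ->
  0 <= e -> 0 <= m -> (forall x, ~ E x -> Re `|g x| <= e) -> (forall x, E x -> Re `|g x| <= e + m) ->
  Re `|J nu g| <= 2 * (e * lam nu setT + m * lam nu E).
Proof.
move=> mE gb e0 m0 gE gnE; rewrite -lee_fin.
have mI : measurable_fun setT (\1_E : borel -> R) by exact: measurable_indic.
pose hh (x : borel) := (e + m * \1_E x)%:E.
have mh : measurable_fun setT hh.
  apply/measurable_EFinP; apply: (@measurable_funD _ borel R setT (cst e)); first exact: measurable_cst.
  by apply: (@measurable_funM _ borel R setT (cst m)) => //; exact: measurable_cst.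
apply: le_trans (complex_integral_le (h := hh) _ gb mh _) _.
  move=> x; rewrite /hh lee_fin indicE; have [Ex|nEx] := pselect (E x).
    by rewrite mem_set// mulr1; exact: gnE.
  by rewrite memNset// mulr0 addr0; exact: gE.
rewrite EFinM lee_wpmul2l//.
rewrite /hh; under eq_integral do rewrite EFinD EFinM.
rewrite ge0_integralD//; first last.
- by apply: measurable_funeM; apply/measurable_EFinP.
- by move=> y _; rewrite mule_ge0// lee_fin// indicE; case: (_ \in _).
rewrite integral_cst// ge0_integralZl//; first last.
- by apply/measurable_EFinP.
rewrite integral_indic// setIT EFinD !EFinM -!lamE//.
Qed.

(** The points of [s] are treated one at a time: the part of [B] in [x V] that
    is still unused gives its mass to [x]. The list [b] is chosen before [g], so
    that it serves all translates of a function at once; [h] is the step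
    function of the values of [g] at the chosen points. *)
Lemma discretize nu (V : set G) (s : seq G) B : open V -> mborel B ->
  exists b : seq (R[i] * G),
  [/\ forall p, p \in b -> p.2 \in s, mass b <= lam nu B &
   forall g (e : R), cbounded_measurable g ->
     (forall x v, x \in s -> V v -> Re `|g (x * v)%g - g x| <= e) ->
     exists h, [/\ cbounded_measurable h, J nu h = \sum_(p <- b) p.1 * g p.2,
       forall z, B z -> (exists2 x, x \in s & V (x^-1 * z)%g) -> Re `|g z - h z| <= e &
       forall z, ~ (B z /\ exists2 x, x \in s & V (x^-1 * z)%g) -> h z = 0]].
Proof.
move=> oV; elim: s B => [|x s IH] B mB.
  exists [::]; split => //; first by rewrite /mass big_nil lam_ge0.
  move=> g e gb gV; exists (fun=> 0); split => //.
  - by split; exact: bounded_measurable_cst.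
  - rewrite big_nil; have := JZ nu 0 gb.
    by rewrite mul0r; under eq_fun do rewrite mul0r.
  - by move=> z _ [].
pose xV : set G := [set z | V (x^-1 * z)%g].
have mxV : mborel xV.
  by apply: (borel_preimage (@mulgl_continuous G (x^-1)%g)); exact: borel_open.
have mA : mborel (B `&` xV) by exact: measurableI.
have mB' : mborel (B `\` xV) by exact: measurableD.
have [b [bs bm bg]] := IH _ mB'.
exists ((nu (B `&` xV), x) :: b); split.
- by move=> p; rewrite !inE => /orP[/eqP ->|/bs ->]; rewrite ?eqxx ?orbT.
- rewrite /mass big_cons (lam_split nu mB mxV); apply: lerD => //; exact: le_lam.
move=> g e gb gV.
have [h [hb Jh hB hn]] := bg g e gb (fun y v ys => gV y v (mem_behead (s := x :: s) ys)).
exists (fun z => g x * (\1_(B `&` xV) z : R)%:C + h z); split.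
- by apply: cbounded_measurableD => //; apply: cbounded_measurableZ; exact: cbounded_measurable_indic.
- rewrite JD//; last by apply: cbounded_measurableZ; exact: cbounded_measurable_indic.
  rewrite JZ; last exact: cbounded_measurable_indic.
  by rewrite J_indic// Jh big_cons mulrC.
- move=> z Bz zs; have [xVz|nxVz] := pselect (xV z).
    rewrite hn ?addr0; last by move=> [[]].
    rewrite indicE mem_set// mulr1.
    have := gV x (x^-1 * z)%g (mem_head _ _) xVz; by rewrite mulVKg.
  rewrite indicE memNset; last by move=> [].
  rewrite mulr0 add0r; apply: hB => //.
  by have [y] := zs; rewrite inE => /orP[/eqP ->//|ys Vy]; exists y.
- move=> z nz; rewrite indicE memNset; last first.
    by move=> [Bz xVz]; apply: nz; split => //; exists x => //; rewrite inE eqxx.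
  rewrite mulr0 add0r; apply: hn => -[[Bz _] [y ys Vy]]; apply: nz; split => //.
  by exists y => //; rewrite inE ys orbT.
Qed.

(** A compact [K] is covered by finitely many [x V] with [x] in [K]; outside
    [K] only the size of [g] counts. *)
Lemma discretization nu (V K : set G) : open V -> V 1%g -> compact K ->
  exists b : seq (R[i] * G),
  [/\ forall p, p \in b -> K p.2, mass b <= lam nu setT &
   forall g (e m : R), cbounded_measurable g -> 0 <= e -> 0 <= m ->
     (forall x v, K x -> V v -> Re `|g (x * v)%g - g x| <= e) ->
     (forall x, Re `|g x| <= m) ->
     Re `|J nu g - \sum_(p <- b) p.1 * g p.2| <= 2 * (e * lam nu setT + m * lam nu (~` K))].
Proof.
move=> oV V1 cK.
have mK := borel_compact cK; have mnK : mborel (~` K) by exact: measurableC.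
have [||x Kx|s sK cov] := @compact_directed G (seq G) [set s : seq G | forall x, x \in s -> K x]
   (fun (s : seq G) (z : G) => exists2 x, x \in s & V (x^-1 * z)%g) K cK.
- by exists [::].
- move=> s t sK tK; exists (s ++ t).
    by move=> x; rewrite mem_cat => /orP[]; [exact: sK|exact: tK].
  move=> z [] [x xs Vx]; exists x => //; by rewrite mem_cat xs ?orbT.
- exists [:: x]; first by move=> y; rewrite inE => /eqP ->.
  have : \forall z \near x, V (x^-1 * z)%g.
    apply: (@mulgl_continuous G (x^-1)%g x V); apply: open_nbhs_nbhs; split => //.
    by rewrite mulVg.
  by apply: filterS => z Vz; exists x => //; rewrite inE.
have [b [bs bm bg]] := discretize nu s oV mK.
exists b; split.
- by move=> p /bs /sK.
- by apply: le_trans bm _; apply: lam_mono => //; exact: measurableT.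
move=> g e m gb e0 m0 gV gm.
have [h [hb <- hK hn]] := bg g e gb (fun x v xs Vv => gV x v (sK x xs) Vv).
have hb' : cbounded_measurable (fun z => -1 * h z) by exact: cbounded_measurableZ.
have -> : J nu g - J nu h = J nu (fun z => -1 * h z + g z).
  by rewrite JD// JZ// mulN1r addrC.
apply: J_le_split => //; first exact: cbounded_measurableD.
- move=> z /contrapT Kz; rewrite mulN1r addrC; apply: hK => //; exact: cov.
- by move=> z nKz; rewrite hn; [rewrite mulr0 add0r; apply: le_trans (gm z) _; rewrite lerDr|case].
Qed.

(** Moving a perturbation [v] of [x] past [t y] in [f (z x v t y)] conjugates it
    by [t y], which ranges over a compact set. *)
Lemma conj_nbhs (K V : set G) : compact K -> nbhs (1%g : G) V ->
  \forall v \near (1%g : G), forall x, K x -> V (x^-1 * v * x)%g.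
Proof.
move=> cK V1; apply: (@compact_uniform_near _ K _ _ (fun v x => V (x^-1 * v * x)%g)) => // x Kx.
have cx : (fun p : G * G => (p.1^-1 * p.2 * p.1)%g) @ nbhs (x, 1%g : G) --> (x^-1 * 1 * x)%g.
  have c1 : (fun p : G * G => (p.1^-1 * p.2)%g) @ nbhs (x, 1%g : G) --> (x^-1 * 1)%g.
    apply: (@cvg_comp (G * G)%type (G * G)%type G (fun p => (p.1^-1, p.2)%g)
      (fun z => (z.1 * z.2)%g) _ (nbhs (x^-1, 1)%g)); last exact: (@mulg_continuous G (x^-1, 1)%g).
    apply: cvg_pair; last exact: cvg_snd.
    by apply: (@cvg_comp _ _ _ fst (fun x => (x^-1)%g) _ (nbhs x)); [exact: cvg_fst|exact: invg_continuous].
  apply: (@cvg_comp (G * G)%type (G * G)%type G (fun p => (p.1^-1 * p.2, p.1)%g)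
      (fun z => (z.1 * z.2)%g) _ (nbhs (x^-1 * 1, x)%g)); last exact: (@mulg_continuous G (x^-1 * 1, x)%g).
  by apply: cvg_pair; [exact: c1|exact: cvg_fst].
have := cx V; rewrite mulg1 mulVg => /(_ V1) [[A B]]/= [Ax B1] AB.
by exists (A, B) => // -[x' v]/= h; exact: (AB (x', v)).
Qed.

End discretization.

(** * Semiprimeness of the measure algebra *)
Section semiprime.
Context (R : realType) (G : lcGroupType).
Local Notation borel := (g_sigma_algebraType (@open G)).
Local Notation mborel := (@open G).-sigma.-measurable.
Local Notation M := (measure_algebra R G).
Implicit Types (nu : M) (f : G -> R) (b : seq (R[i] * G)).

Lemma cc_cbounded f (phi : G -> G) : cc f -> continuous phi ->
  cbounded_measurable (fun x : borel => (f (phi x))%:C).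
Proof.
move=> fc cphi; have [c c0 fle] := cc_bounded fc.
split; last exact: bounded_measurable_cst.
split=> /=; last by exists c => x; exact: fle.
apply: borel_continuous => x; apply: (@cvg_comp _ _ _ phi f); [exact: cphi|].
by case: fc => cf _; exact: cf.
Qed.

Lemma lmulr_continuous (z t : G) : continuous (fun x : G => (z * x * t)%g).
Proof.
move=> x; apply: (@cvg_comp _ _ _ (fun x => (z * x)%g) (fun x => (x * t)%g)).
  exact: mulgl_continuous.
exact: mulgr_continuous.
Qed.

(** A Borel set of nonzero mass lies between a compact [K] and an open [U] of
    nearly the same mass, and a function between their indicators integrates to
    nearly this mass. *)
Lemma nonzero_test nu : nu != 0 ->
  exists f, [/\ ccp f, forall x, f x <= 1 & J nu (fun x => (f x)%:C) != 0].
Proof.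
move=> nu0; have [E mE nuE] : exists2 E, mborel E & nu E != 0.
  apply: contrapT => h; move/eqP: nu0; apply; apply: measure_algebra_ext => E mE.
  by apply: contrapT => /eqP nE; apply: h; exists E.
have c0 : 0 < Re `|nu E| by rewrite -ltcR -normRe normr_gt0.
have e0 : 0 < Re `|nu E| / 4 by rewrite divr_gt0.
have [_ /(_ E mE _ e0)[K [U [cK oU KE EU UK]]]] := radon_lambda nu.
have [f [fp fK f1 fU]] := urysohn_compact R cK oU (subset_trans KE EU).
exists f; split => //; have [fc f0] := fp.
have mUK : mborel (U `\` K) by apply: measurableD; [exact: borel_open|exact: borel_compact].
have Fb : cbounded_measurable (fun x : borel => (f x)%:C).
  by apply: (cc_cbounded fc (phi := id)) => x; exact: cvg_id.
have Eb : cbounded_measurable (fun x : borel => (\1_E x : R)%:C) by exact: cbounded_measurable_indic.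
have Enb := cbounded_measurableZ (-1) Eb.
have : Re `|J nu (fun x => (f x)%:C + -1 * (\1_E x)%:C)| <= 2 * (0 * lam nu setT + 1 * lam nu (U `\` K)).
  apply: J_le_split => //; first exact: cbounded_measurableD.
    move=> x nUK; have [Kx|nKx] := pselect (K x).
      by rewrite fK// indicE mem_set ?mulN1r ?subrr ?normr0//; exact: KE.
    have nUx : ~ U x by move=> Ux; apply: nUK.
    rewrite fU// indicE memNset; last by move/EU.
    by rewrite mulr0 addr0 normr0.
  move=> x _; have -> : (f x)%:C + -1 * (\1_E x)%:C = (f x - \1_E x)%:C :> R[i].
    by rewrite mulN1r rmorphB.
  rewrite normRe_real add0r ler_norml indicE; have := f0 x; have := f1 x.
  by case: (_ \in _) => /= h1 h2; apply/andP; split; lra.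
rewrite JD// JZ// J_indic// mul0r add0r mul1r => h.
apply/negP => /eqP J0; move: h; rewrite J0 add0r mulN1r normrN.
apply/negP; rewrite -ltNge.
have : lam nu (U `\` K) < Re `|nu E| / 4 by rewrite -lte_fin -lamE.
by move: c0; lra.
Qed.

(** The measure [nu * delta t * nu], tested on the left translate of [f] by [z]. *)
Lemma sandwich_vanish nu f (z t : G) : nu * delta R t * nu = 0 -> cc f ->
  cbounded_measurable (fun y : borel => J nu (fun x => (f (z * x * t * y)%g)%:C)) /\
  J nu (fun y => J nu (fun x => (f (z * x * t * y)%g)%:C)) = 0.
Proof.
move=> nutnu fc.
have Fb : cbounded_measurable (fun x : borel => (f (z * x)%g)%:C).
  by apply: cc_cbounded => //; exact: mulgl_continuous.
have inner : (fun y : borel => J (convolution nu (delta R t)) (fun x => (f (z * (x * y))%g)%:C)) =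
   (fun y : borel => J nu (fun x => (f (z * x * t * y)%g)%:C)).
  apply/funext => y.
  have Fyb : cbounded_measurable (fun x : borel => (f (z * (x * y))%g)%:C).
    have -> : (fun x : borel => (f (z * (x * y))%g)%:C) = (fun x : borel => (f (z * x * y)%g)%:C) :> (borel -> R[i]).
      by apply/funext => x; rewrite mulgA.
    by apply: (cc_cbounded fc); exact: lmulr_continuous.
  have [h1 ->] := J_convolution nu (delta R t) Fyb.
  by rewrite J_delta//; congr (J nu _); apply/funext => x; rewrite !mulgA.
have [h1 h2] := J_convolution (convolution nu (delta R t)) nu Fb.
have key (A B : borel -> R[i]) (c : R[i]) : A = B -> cbounded_measurable A ->
  c = J nu A -> cbounded_measurable B /\ J nu B = c by move=> -> ? ->.
apply: (key _ _ _ inner h1); apply: (etrans _ h2).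
have -> : convolution (convolution nu (delta R t)) nu = 0 by exact: nutnu.
by have := J_muZ 0 nu Fb; rewrite scale0r mul0r.
Qed.

Lemma mass_star b : mass (star b) = mass b.
Proof.
rewrite /mass /star big_map; apply: eq_bigr => -[[x y] p] _ /=.
by rewrite sqrrN.
Qed.

Lemma sum_le_mass b (X : R[i] * G -> R[i]) (e : R) :
  (forall p, p \in b -> Re `|X p| <= e) ->
  Re `|\sum_(p <- b) p.1 * X p| <= mass b * e.
Proof.
rewrite /mass; elim: b => [|p b IH] h; first by rewrite !big_nil normr0 mul0r.
rewrite !big_cons mulrDl; apply: le_trans (normReD _ _) _; apply: lerD.
  by rewrite normReM ler_wpM2l ?normRe_ge0// h// mem_head.
by apply: IH => q qb; apply: h; rewrite inE qb orbT.
Qed.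

(** The approximation of [nu] by [b] is uniform over the functions
    [x |-> f (z x t y)] with [y] and [t^-1] in the compact set [K], where nearly
    all of [nu] lives. In the identity of [sandwich_vanish] both integrals can
    therefore be replaced by sums over [b], for every [t] that occurs in
    [star b], at a cost proportional to [e] and independent of [b]. *)
Lemma discrete_sandwich nu f (e : R) : (forall t : G, nu * delta R t * nu = 0) ->
  ccp f -> (forall x, f x <= 1) -> 0 < e ->
  exists b, [/\ mass b <= lam nu setT,
   forall z, Re `|J nu (fun x => (f (z * x)%g)%:C) - act b (fun x => (f x)%:C) z|
      <= 2 * (e * lam nu setT + 1 * e) &
   forall z, Re `|act b (act (star b) (act b (fun x => (f x)%:C))) z| <=
     lam nu setT * (lam nu setT * (6 * e * (lam nu setT + 1) * 1))].
Proof.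
move=> nutnu fp f1 e0; have [fc f0] := fp.
set N := lam nu setT; have N0 : 0 <= N by exact: lam_ge0.
have [_ /(_ setT (@measurableT _ borel) e e0)[K [U [cK oU _ TU UK]]]] := radon_lambda nu.
have mnK : mborel (~` K) by apply: measurableC; exact: borel_compact.
have lamK : lam nu (~` K) <= e.
  rewrite -lee_fin -lamE//; apply: le_trans (ltW UK).
  rewrite (_ : U `\` K = ~` K)//; apply/seteqP; split => x; first by case.
  by move=> nKx; split => //; exact: TU.
have cKV : compact ((fun x : G => (x^-1)%g) @` K).
  apply: continuous_compact => //; apply: continuous_subspaceT; exact: invg_continuous.
have V0 := cc_right_uniform fc e0.
have V2 := conj_nbhs cKV (conj_nbhs cK V0).
have [V [oV V1] VV] : exists2 V : set G, open V /\ V 1%g & forall v, V v ->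
   (forall x, `|f (x * v)%g - f x| <= e) /\
   forall y t, K y -> K t^-1%g -> forall x, `|f (x * ((t * y)^-1 * v * (t * y)))%g - f x| <= e.
  exists (((fun v => forall x, `|f (x * v)%g - f x| <= e) : set G)^° `&`
    ((fun v : G => forall x, ((fun x : G => (x^-1)%g) @` K) x -> forall y, K y ->
       forall z, `|f (z * (y^-1 * (x^-1 * v * x) * y))%g - f z| <= e) : set G)^°).
    by split; [apply: openI; exact: open_interior|split].
  move=> v [/interior_subset h1 /interior_subset h2]; split => // y t Ky Kt x.
  have := h2 t _ y Ky x; rewrite invgM !mulgA; apply.
  by exists (t^-1)%g => //; rewrite invgK.
have [b [bK bm bg]] := discretization nu oV V1 cK.
have Fb (z t : G) : cbounded_measurable (fun x : borel => (f (z * x * t)%g)%:C).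
  by apply: cc_cbounded => //; exact: lmulr_continuous.
have FE (x : G) : Re `|(f x)%:C| <= 1 :> R by rewrite normRe_real ger0_norm.
have err (m : R) : 0 <= m -> 2 * (e * N + m * lam nu (~` K)) <= 2 * (e * N + m * e).
  by move=> m0; rewrite ler_wpM2l// lerD2l ler_wpM2l.
exists b; split => // [z|z].
  have Fzb : cbounded_measurable (fun x : borel => (f (z * x)%g)%:C).
    by apply: cc_cbounded => //; exact: mulgl_continuous.
  apply: le_trans (err 1 ler01); apply: (bg _ e 1 Fzb) => //; first exact: ltW.
  move=> x v _ Vv; rewrite -rmorphB normRe_real mulgA; exact: (VV v Vv).1.
have inner (t y x : G) v : K t^-1%g -> K y -> V v ->
    Re `|(f (z * (x * v) * t * y)%g)%:C - (f (z * x * t * y)%g)%:C| <= e.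
  move=> Kt Ky Vv; rewrite -rmorphB normRe_real.
  have := (VV v Vv).2 y t Ky Kt (z * x * t * y)%g.
  have -> : (z * x * t * y * ((t * y)^-1 * v * (t * y)) = z * (x * v) * t * y)%g.
    by rewrite invgM !mulgA !mulgK.
  by [].
have Sle (t : G) : K t^-1%g ->
    Re `|\sum_(r <- b) r.1 * \sum_(p <- b) p.1 * (f (z * p.2 * t * r.2)%g)%:C| <= N * (6 * e * (N + 1) * 1).
  move=> Kt; have [gb g0] := sandwich_vanish z (nutnu t) fc.
  set g := fun y : borel => J nu (fun x => (f (z * x * t * y)%g)%:C) in gb g0.
  have Fbt (y : G) : cbounded_measurable (fun x : borel => (f (z * x * t * y)%g)%:C).
    have -> : (fun x : borel => (f (z * x * t * y)%g)%:C) = (fun x : borel => (f (z * x * (t * y))%g)%:C) :> (borel -> R[i]).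
      by apply/funext => x; rewrite !mulgA.
    exact: Fb.
  have step1 : Re `|\sum_(r <- b) r.1 * g r.2| <= 2 * (2 * e * N * N + 2 * N * e).
    have := bg g (2 * e * N) (2 * N) gb.
    rewrite g0 sub0r normrN => h; apply: (le_trans (h _ _ _ _)).
    - by rewrite !mulr_ge0// ltW.
    - by rewrite mulr_ge0.
    - move=> y v Ky Vv; rewrite /g.
      have -> : J nu (fun x => (f (z * x * t * (y * v))%g)%:C) - J nu (fun x => (f (z * x * t * y)%g)%:C)
        = J nu (fun x => (f (z * x * t * (y * v))%g)%:C + -1 * (f (z * x * t * y)%g)%:C).
        by rewrite JD ?JZ ?mulN1r//; exact: cbounded_measurableZ.
      apply: le_trans (@complex_integral_sup _ _ _ _ _ _ e _ _) _ => //.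
      + by apply: cbounded_measurableD => //; exact: cbounded_measurableZ.
      + move=> x; rewrite mulN1r -rmorphB normRe_real mulgA; exact: (VV v Vv).1.
    - move=> y; rewrite /g; have := @complex_integral_sup _ _ _ nu (cmeasure_complex nu) _ 1 (Fbt y).
      by rewrite mulr1; apply.
    - by rewrite ler_wpM2l// lerD2l ler_wpM2l// mulr_ge0.
  have step2 : Re `|\sum_(r <- b) r.1 * (\sum_(p <- b) p.1 * (f (z * p.2 * t * r.2)%g)%:C - g r.2)|
      <= mass b * (2 * (e * N + 1 * e)).
    apply: sum_le_mass => r rb; rewrite -normrN opprB.
    apply: le_trans (err 1 ler01).
    apply: (bg (fun x => (f (z * x * t * r.2)%g)%:C) e 1 (Fbt r.2)) => //; first exact: ltW.
    by move=> x v _ Vv; apply: inner => //; exact: bK.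
  have -> : \sum_(r <- b) r.1 * (\sum_(p <- b) p.1 * (f (z * p.2 * t * r.2)%g)%:C) =
     \sum_(r <- b) r.1 * (\sum_(p <- b) p.1 * (f (z * p.2 * t * r.2)%g)%:C - g r.2) + \sum_(r <- b) r.1 * g r.2.
    by rewrite -big_split; apply: eq_bigr => r _; rewrite /= -mulrDr subrK.
  apply: le_trans (normReD _ _) _; apply: le_trans (lerD step2 step1) _.
  have h : mass b * (2 * (e * N + 1 * e)) <= N * (2 * (e * N + 1 * e)).
    by apply: ler_wpM2r => //; rewrite mulr_ge0// addr_ge0// !mulr_ge0// ltW.
  apply: le_trans (lerD h (lexx _)) _.
  suff -> : N * (2 * (e * N + 1 * e)) + 2 * (2 * e * N * N + 2 * N * e) = N * (6 * e * (N + 1) * 1) by [].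
  by ring.
have -> : act b (act (star b) (act b (fun x => (f x)%:C))) z =
  \sum_(q <- star b) q.1 * \sum_(r <- b) r.1 * \sum_(p <- b) p.1 * (f (z * p.2 * q.2 * r.2)%g)%:C.
  rewrite /act; under eq_bigr do rewrite mulr_sumr.
  rewrite exchange_big; apply: eq_bigr => q _ /=.
  rewrite mulr_sumr; under eq_bigr do rewrite !mulr_sumr.
  rewrite exchange_big; apply: eq_bigr => r _ /=.
  rewrite !mulr_sumr; apply: eq_bigr => p _.
  by rewrite mulrCA; congr (_ * _); exact: mulrCA.
apply: (@le_trans _ _ (mass (star b) * (N * (6 * e * (N + 1) * 1)))).
  apply: (@sum_le_mass (star b) (fun q => \sum_(r <- b) r.1 * \sum_(p <- b) p.1 * (f (z * p.2 * q.2 * r.2)%g)%:C)).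
  move=> q /mapP[p pb ->]; apply: Sle => /=; rewrite invgK; exact: bK.
rewrite mass_star ler_wpM2r// !mulr_ge0 ?(ltW e0)// addr_ge0//.
Qed.

(** Otherwise every [nu * delta t * nu] vanishes, and for [T = act b] as in
    [discrete_sandwich] the function [T T' T f] is [O(e)], so that [ip_act_bound]
    makes [<T f, T f>] arbitrarily small. But [f] can be chosen with a nonzero
    integral, of modulus [c]; then [T f] has modulus at least [c / 2] near the
    identity, and [<T f, T f>] is at least the value [D > 0] of the Haar
    functional on a multiple of a bump function. *)
Theorem measure_algebra_semiprime nu : nu != 0 -> exists mu, nu * mu * nu != 0.
Proof.
move=> nu0; apply: contrapT => hn.
have nutnu t : nu * delta R t * nu = 0.
  by apply: contrapT => /eqP h; apply: hn; exists (delta R t).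
have [f [fp f1 Jf]] := nonzero_test nu0; have [fc f0] := fp.
have [I [ID IZ I0 Iinv Ipos]] := @right_haar_functional R G.
set F := fun x => (f x)%:C in Jf; set c := Re `|J nu F|.
have c0 : 0 < c by rewrite -ltcR -normRe normr_gt0.
set N := lam nu setT; have N0 : 0 <= N by exact: lam_ge0.
have d0 : 0 < c / 8 / (N + 1) by rewrite !divr_gt0// ltr_wpDl.
have [g [gp g1 gle gV]] := bump_function R (cc_left_uniform fc d0).
have [gc g0] := gp.
set D := (c / 2) ^+ 2 * I g.
have D0 : 0 < D by rewrite mulr_gt0 ?exprn_gt0 ?divr_gt0//; apply: (Ipos g 1%g) => //; rewrite g1.
have If0 : 0 <= I f by exact: I0.
have ffp : ccp (fun x => f x * f x).
  by split; [apply: ccM => //; case: fc|move=> x; rewrite mulr_ge0].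
have Iff0 : 0 <= I (fun x => f x * f x) by exact: I0.
set s := D / (I (fun x => f x * f x) + 1).
have s0 : 0 < s by rewrite divr_gt0// ltr_wpDl.
set P := 6 * (N + 1) * N * N * N * I f.
have P0 : 0 <= P by rewrite !mulr_ge0// addr_ge0.
(* The first bound keeps T f above c / 2 near the identity, the second makes
   the contribution of T T' T f to ip_act_bound at most D. *)
pose e := Num.min (c / 8 / (N + 1)) (s * D / (P + 1)).
have e0 : 0 < e by rewrite lt_min d0/=; apply: divr_gt0; [exact: mulr_gt0|exact: ltr_wpDl].
have eN : 8 * (e * (N + 1)) <= c.
  have : e <= c / 8 / (N + 1) by rewrite ge_min lexx.
  rewrite ler_pdivlMr ?ltr_wpDl// ler_pdivlMr//; by rewrite mulrC.
have eP : e * P <= s * D.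
  have : e <= s * D / (P + 1) by rewrite ge_min lexx orbT.
  rewrite ler_pdivlMr ?ltr_wpDl//; apply: le_trans.
  by rewrite ler_wpM2l ?(ltW e0)// lerDl.
have [b [bm bJ bb]] := discrete_sandwich nutnu fp f1 e0; rewrite -/N in bm bJ bb.
have upper := ip_act_bound ID IZ I0 Iinv fp s0 bb; rewrite -/F in upper.
set u := act b F in upper.
have uc : ccc u by apply: ccc_act; split => //; exact: cc0.
have lower : D <= ip I u u.
  rewrite /D -IZ//; apply: (I_mono ID IZ I0) => //; [exact: ccZ|exact: cc_dot|] => z.
  rewrite dot_norm; have [Vz|nVz] := pselect (forall x, `|f (z * x)%g - f x| <= c / 8 / (N + 1)); last first.
    by rewrite gV// mulr0 sqr_ge0.
  apply: (@le_trans _ _ ((c / 2) ^+ 2)); first by rewrite ler_piMr ?sqr_ge0.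
  rewrite ler_sqr ?nnegrE ?normRe_ge0 ?divr_ge0// ?(ltW c0)//.
  have Fb (y : G) : cbounded_measurable (fun x : borel => (f (y * x)%g)%:C).
    by apply: cc_cbounded => //; exact: mulgl_continuous.
  have Fb1 : cbounded_measurable (F : borel -> R[i]).
    by apply: (cc_cbounded fc (phi := id)) => x; exact: cvg_id.
  have close : Re `|J nu F - J nu (fun x => (f (z * x)%g)%:C)| <= c / 4.
    have -> : J nu F - J nu (fun x => (f (z * x)%g)%:C) = J nu (fun x => F x + -1 * (f (z * x)%g)%:C).
      by rewrite JD ?JZ ?mulN1r//; exact: cbounded_measurableZ.
    apply: (@le_trans _ _ (2 * (c / 8 / (N + 1) * N + 0 * lam nu set0))).
      apply: J_le_split => //; rewrite ?(ltW d0)//.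
      - by apply: cbounded_measurableD => //; exact: cbounded_measurableZ.
      - move=> x _; rewrite mulN1r -rmorphB normRe_real -normrN opprB; exact: Vz.
    rewrite mul0r addr0 [c / 8 / _]mulrAC -!mulrA.
    have : (N + 1)^-1 * N <= 1 by rewrite mulrC ler_pdivrMr ?ltr_wpDl// mul1r lerDl.
    move: c0; nra.
  have b2 := bJ z.
  have tri : c <= Re `|J nu F - J nu (fun x => (f (z * x)%g)%:C)| +
      (Re `|J nu (fun x => (f (z * x)%g)%:C) - u z| + Re `|u z|).
    apply: (@le_trans _ _ (Re `|J nu F - J nu (fun x => (f (z * x)%g)%:C)| +
       Re `|J nu (fun x => (f (z * x)%g)%:C) - u z + u z|)); last first.
      by rewrite lerD2l; exact: normReD.
    apply: le_trans (normReD _ _); by rewrite !subrK.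
  rewrite -/F -/u in b2; move: tri b2 close eN; lra.
have : s * I (fun x => f x * f x) < D.
  by rewrite /s mulrAC ltr_pdivrMr ?ltr_wpDl// ltr_pM2l// ltrDl.
have : s^-1 * (N * (N * (6 * e * (N + 1) * 1)) * (mass b * I f)) <= D.
  rewrite mulrC ler_pdivrMr// mulrC [D * s]mulrC; apply: le_trans eP.
  rewrite /P [X in _ <= X](_ : _ = N * (N * (6 * e * (N + 1) * 1)) * (N * I f)); last by ring.
  rewrite mulrC; apply: ler_wpM2l; last exact: ler_wpM2r.
  by rewrite !mulr_ge0 ?addr_ge0// (ltW e0).
by move: upper lower; lra.
Qed.

End semiprime.

(** * Atoms and diffuse measures *)
Section atoms.
Context (R : realType) (G : lcGroupType).
Local Notation borel := (g_sigma_algebraType (@open G)).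
Local Notation mborel := (@open G).-sigma.-measurable.
Local Notation M := (measure_algebra R G).
Implicit Types (mu nu m : M) (E B : set G).

Lemma borel_point (x : G) : mborel [set x].
Proof. by apply: borel_compact; exact: compact_set1. Qed.

Lemma lamU m E B : mborel E -> mborel B -> lam m (E `|` B) <= lam m E + lam m B.
Proof.
move=> mE mB; have mU := measurableU _ _ mE mB.
by rewrite -lee_fin EFinD -!lamE//; exact: measureU2.
Qed.

Lemma set_seq_cons (x : G) (s : seq G) : [set` x :: s] = [set x] `|` [set` s].
Proof.
apply/seteqP; split => z /=; first by rewrite inE => /orP[/eqP ->|]; [left|right].
by move=> [->|zs]; rewrite inE ?eqxx// zs orbT.
Qed.

Lemma rtrans_point (x y : G) : rtrans [set x] y = [set (x * y^-1)%g].
Proof.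
apply/seteqP; split => z; rewrite /rtrans/=; first by move=> <-; rewrite mulgK.
by move=> ->; rewrite mulgVK.
Qed.

(** One of the four Jordan parts carries a quarter of [lam m E], on the
    intersection of [E] with a Hahn set; the constant [5] makes the inequality
    strict. *)
Lemma lam_concentrated m E : mborel E -> 0 < lam m E ->
  exists B, [/\ mborel B, B `<=` E & lam m E < 5 * Re `|m B|].
Proof.
move=> mE L0; apply: contrapT => h.
have : (lambda m E <= (lam m E / 5)%:E + (lam m E / 5)%:E + ((lam m E / 5)%:E + (lam m E / 5)%:E))%E.
  apply: dominant_le => // A mA AE; rewrite lee_fin leNgt; apply/negP => lt; apply: h.
  by exists A; split => //; rewrite mulrC -ltr_pdivrMr.
by rewrite lamE// -!EFinD lee_fin; move: L0; lra.
Qed.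

Lemma lam_point m (x : G) : m [set x] = 0 -> lam m [set x] = 0.
Proof.
move=> mx; apply/eqP; rewrite eq_le lam_ge0 andbT leNgt; apply/negP => h.
have [B [mB Bx]] := lam_concentrated (borel_point x) h.
have [->|->] : B = set0 \/ B = [set x] by exact: subset_set1.
  by rewrite mu0 normr0 mulr0; move: h; lra.
by rewrite mx normr0 mulr0; move: h; lra.
Qed.

Lemma lam_seq m (s : seq G) (e : R) : uniq s -> (forall x, x \in s -> e <= Re `|m [set x]|) ->
  (size s)%:R * e <= lam m setT.
Proof.
have mS (t : seq G) : mborel [set x | x \in t].
  elim: t => [|x t IH]; first by rewrite set_nil; exact: measurable0.
  by rewrite set_seq_cons; apply: measurableU => //; exact: borel_point.
move=> us hs; apply: (@le_trans _ _ (lam m [set x | x \in s])); last first.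
  by apply: lam_mono => //; exact: measurableT.
elim: s us hs => [|x s IH]; first by rewrite mul0r lam_ge0.
move=> /andP[xs us] hs; rewrite -natr1 mulrDl mul1r addrC.
rewrite (lam_split m (mS (x :: s)) (borel_point x)); apply: lerD.
  rewrite (_ : _ `&` _ = [set x]).
    by apply: le_trans (hs x (mem_head _ _)) _; apply: le_lam; exact: borel_point.
  by apply/seteqP; split => y; [case|move=> ->; split => //=; exact: mem_head].
rewrite (_ : _ `\` _ = [set y | y \in s]).
  by apply: IH => // y ys; apply: hs; rewrite inE ys orbT.
apply/seteqP; split => y /=.
  by rewrite inE => -[/orP[/eqP ->|//]].
by move=> ys; rewrite inE ys orbT; split => // yx; move: xs; rewrite -yx ys.
Qed.

Lemma finite_atoms m (e : R) : 0 < e -> finite_set [set x : G | e <= Re `|m [set x]|].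
Proof.
move=> e0; apply: contrapT => inf.
have [B BS nB] := infinite_set_fset (Num.truncn (lam m setT / e)).+1 inf.
have := @lam_seq m (finmap.enum_fset B) e (finmap.fset_uniq B) BS.
apply/negP; rewrite -ltNge -ltr_pdivrMr//.
by apply: lt_le_trans (truncnS_gt _) _; rewrite ler_nat.
Qed.

Definition diffuse m := forall x : G, m [set x] = 0.

Lemma diffuse_right m mu : diffuse m -> diffuse (m * mu).
Proof.
move=> dm x; transitivity (J mu (fun y => m (rtrans [set x] y))).
  by apply: convolutionE; exact: borel_point.
rewrite (_ : (fun y => _) = fun=> 0).
  rewrite -[RHS](mu0 mu) -(J_indic mu measurable0).
  by congr (J mu _); apply/funext => y; rewrite indicE in_set0.
by apply/funext => y; rewrite rtrans_point.
Qed.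

(** The integrand [y |-> mu {x y^-1}] exceeds [e] at finitely many points only,
    and these are null for [m]. *)
Lemma diffuse_left mu m : diffuse m -> diffuse (mu * m).
Proof.
move=> dm x.
have -> : (mu * m) [set x] = J m (fun y => mu (rtrans [set x] y)).
  by apply: convolutionE; exact: borel_point.
apply: (@small_eq0 _ _ (2 * lam m setT)) => e e0.
pose S : set G := [set y | e <= Re `|mu (rtrans [set x] y)|].
have fS : finite_set S.
  apply: (@sub_finite_set _ _ ((fun p => p^-1 * x)%g @` [set p | e <= Re `|mu [set p]|])).
    move=> y; rewrite /S/= rtrans_point => ey; exists (x * y^-1)%g => //.
    by rewrite invgM invgK mulgVK.
  by apply: finite_image; exact: finite_atoms.
have [mS S0] : mborel S /\ lam m S = 0.
  move: fS => /finite_seqP[s ->]; elim: s => [|y s [mS IH]].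
    by rewrite set_nil /lam measure0; split; first exact: measurable0.
  have my := borel_point y.
  rewrite set_seq_cons; split; first exact: measurableU.
  apply/eqP; rewrite eq_le lam_ge0 andbT; apply: le_trans (lamU _ my mS) _.
  by rewrite IH lam_point// addr0.
have := @J_le_split _ _ m (fun y => mu (rtrans [set x] y)) e (lam mu setT) S mS.
rewrite S0 mulr0 addr0 mulrAC -mulrA => -> //.
- by apply: mu_translate_cbounded; exact: borel_point.
- exact: ltW.
- exact: lam_ge0.
- by move=> y /negP; rewrite -ltNge => /ltW.
- move=> y _; have mr := rtrans_measurable y (borel_point x).
  apply: le_trans (le_lam mu mr) _; apply: le_trans (lam_mono mu mr measurableT _) _ => //.
  by rewrite lerDr ltW.
Qed.

End atoms.

(** * Annihilators of measures with atoms *)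
Section concentration.
Context (R : realType) (G : lcGroupType).
Local Notation borel := (g_sigma_algebraType (@open G)).
Local Notation mborel := (@open G).-sigma.-measurable.
Local Notation M := (measure_algebra R G).
Implicit Types (mu nu m : M) (E B : set G).

(** Otherwise open null sets cover a compact set of positive measure. *)
Lemma lambda_support m : m != 0 ->
  exists x, forall U, open U -> U x -> 0 < lam m U.
Proof.
move=> m0; apply: contrapT => h.
have [K [cK _] K0] : exists2 K, compact K /\ K `<=` setT & (0%:E < lambda m K)%E.
  apply: radon_compact => //; first exact: radon_lambda.
  rewrite lamE// lte_fin lt_neqAle lam_ge0 andbT; apply/eqP => L0.
  move/eqP: m0; apply; apply: measure_algebra_ext => E mE; apply/eqP.
  rewrite -normr_eq0 normRe; suff -> : Re `|m E| = 0 by [].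
  apply/eqP; rewrite eq_le normRe_ge0 andbT L0.
  by apply: le_trans (le_lam m mE) _; exact: lam_mono.
have [||x Kx|U [oU U0] KU] := @compact_directed G (set G)
    [set U | open U /\ lam m U = 0] (fun U x => U x) K cK.
- by exists set0; split; [exact: open0|rewrite /lam measure0].
- move=> U V [oU U0] [oV V0]; exists (U `|` V); last by move=> x []; [left|right].
  split; first exact: openU.
  have [mU mV] := (borel_open oU, borel_open oV).
  apply/eqP; rewrite eq_le lam_ge0 andbT; apply: le_trans (lamU _ mU mV) _.
  by rewrite U0 V0 addr0.
- have [U oU [Ux]] : exists2 U, open U & U x /\ ~ (0 < lam m U).
    apply: contrapT => nU; apply: h; exists x => U oU Ux; apply: contrapT => n0.
    by apply: nU; exists U.
  move=> /negP; rewrite -leNgt => U0; exists U.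
    by split => //; apply/eqP; rewrite eq_le U0 lam_ge0.
  exact: (open_nbhs_nbhs (conj oU Ux)).
have mK := borel_compact cK.
move: K0; rewrite lamE// lte_fin ltNge => /negP; apply; rewrite -U0.
by apply: lam_mono => //; exact: borel_open.
Qed.

Lemma restriction_exists m B : mborel B ->
  exists p : M, forall E, mborel E -> p E = m (E `&` B).
Proof.
move=> mB; pose q E : R[i] := if `[< mborel E >] then m (E `&` B) else 0.
have qE E : mborel E -> q E = m (E `&` B) by move=> mE; rewrite /q asboolT.
have qle A : mborel A -> ((Re `|q A|)%:E <= lambda m A)%E.
  move=> mA; rewrite qE//; have mAB := measurableI _ _ mA mB.
  by apply: le_trans (dominant_ge (cmeasure_complex m) mAB) _; apply: measure_le => // x [].
have qP : q \in @regular_complex_measure R G.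
  rewrite inE; split.
    apply: (@dominated_complex_measure _ _ _ _ (lambda m)) => //.
    - by have [] := radon_lambda m.
    - by rewrite qE ?set0I ?mu0//; exact: measurable0.
    - by move=> E nE; rewrite /q asboolF.
    - move=> A C mA mC AC; rewrite !qE//; last exact: measurableU.
      rewrite setIUl cmeasureU//; [exact: measurableI|exact: measurableI|].
      by rewrite setIACA AC set0I.
  move=> E mE e e0; have [_ reg] := radon_lambda m.
  have [K [U [cK oU KE EU h]]] := reg E mE _ e0.
  exists K, U; split => //; apply: le_lt_trans h.
  apply: total_variation_le_measure => //.
  by apply: measurableD; [exact: borel_open|exact: borel_compact].
by exists (MeasureAlgebra qP) => E mE; rewrite -qE.
Qed.

(** Let [x0] be an atom of [nu]. In a small neighbourhood of a point of the
    support of [m] there is a set [B] on which the value of [m] is comparable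
    with its variation. If [p] is the restriction of [m] to [B], the value of
    [p * nu] on [B x0] is [m(B) nu{x0}] plus a contribution of the points
    [y <> x0] near [x0], and [nu] has too little mass there to cancel the main
    term. *)
Lemma diffuse_annihilates nu : ~ diffuse nu ->
  (forall m, diffuse m -> m * nu = 0) -> forall m, diffuse m -> m = 0.
Proof.
move=> ndnu ann m dm; apply/eqP; apply: contrapT => /negP m0.
have [x0 nux0] : exists x, nu [set x] != 0.
  by apply: contrapT => h; apply: ndnu => x; apply/eqP; apply: contrapT => /negP hx; apply: h; exists x.
set a := Re `|nu [set x0]|; have a0 : 0 < a by rewrite -ltcR -normRe normr_gt0.
have a16 : 0 < a / 16 by rewrite divr_gt0.
have mx0 := borel_point x0.
have [_ /(_ _ mx0 _ a16)[K [V [cK oV Kx xV VK]]]] := radon_lambda nu.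
have mVx : mborel (V `\` [set x0]) by apply: measurableD => //; exact: borel_open.
have lV : lam nu (V `\` [set x0]) <= a / 16.
  rewrite -lee_fin -lamE//; apply: le_trans (ltW VK); apply: measure_le => //.
    by apply: measurableD; [exact: borel_open|exact: borel_compact].
  by move=> z [Vz zx]; split => // /Kx.
have [x hx] := lambda_support m0.
have [U [oU Ux UV]] : exists U : set G, [/\ open U, U x &
    forall u v, U u -> U v -> V (u^-1 * v * x0)%g].
  have cont : (fun p : G * G => (p.1^-1 * p.2 * x0)%g) @ nbhs (x, x) --> x0.
    suff : (fun p : G * G => (p.1^-1 * p.2 * x0)%g) @ nbhs (x, x) --> (x^-1 * x * x0)%g by rewrite mulVg mul1g.
    apply: (@cvg_comp (G * G)%type G G (fun p => (p.1^-1 * p.2)%g) (fun z => (z * x0)%g) _ (nbhs (x^-1 * x)%g)).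
      apply: (@cvg_comp (G * G)%type (G * G)%type G (fun p => (p.1^-1, p.2)%g)
        (fun z => (z.1 * z.2)%g) _ (nbhs (x^-1, x)%g)); last exact: (@mulg_continuous G (x^-1, x)%g).
      apply: cvg_pair; last exact: cvg_snd.
      by apply: (@cvg_comp _ _ _ fst (fun x => (x^-1)%g) _ (nbhs x)); [exact: cvg_fst|exact: invg_continuous].
    exact: mulgr_continuous.
  have [[A B]/= [Ax Bx] AB] := cont V (open_nbhs_nbhs (conj oV (xV _ erefl))).
  exists (A^° `&` B^°); split; first by apply: openI; exact: open_interior.
  - by split.
  - by move=> u v [/interior_subset Au _] [_ /interior_subset Bv]; exact: (AB (u, v)).
have mU := borel_open oU; have L0 := hx U oU Ux; set L := lam m U in L0.
have [B [mB BU LB]] := lam_concentrated mU L0.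
have [p pE] := restriction_exists m mB.
have dp : diffuse p.
  move=> y; rewrite pE; last exact: borel_point.
  have [->|->] : [set y] `&` B = set0 \/ [set y] `&` B = [set y].
    by apply: subset_set1; exact: subIsetl.
  - exact: mu0.
  - exact: dm.
(* This is B x0. *)
pose E := rtrans B (x0^-1)%g.
have mE : mborel E by exact: rtrans_measurable.
pose g (y : borel) := p (rtrans E y).
have gb : cbounded_measurable g by exact: mu_translate_cbounded.
have gE y : g y = m (rtrans E y `&` B) by rewrite /g pE//; exact: rtrans_measurable.
have gx0 : g x0 = m B.
  rewrite gE; congr (cmeasure m _); apply/seteqP; split => z; first by case.
  by move=> Bz; split => //; rewrite /rtrans/= /E /rtrans/= mulgK.
have gV y : ~ V y -> g y = 0.
  move=> nV; rewrite gE (_ : _ `&` _ = set0) ?mu0//; apply/seteqP; split => // z [].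
  rewrite /rtrans/= /E /rtrans/= => Bzy Bz; apply: nV.
  by have := UV z _ (BU _ Bz) (BU _ Bzy); rewrite !mulgA mulVg mul1g mulgVK.
have gL y : Re `|g y| <= L.
  rewrite gE; have mr : mborel (rtrans E y `&` B) by apply: measurableI => //; exact: rtrans_measurable.
  apply: le_trans (le_lam m mr) _; apply: lam_mono => //.
  by move=> z [_ /BU].
have J0 : J nu g = 0.
  transitivity ((p * nu) E); first by apply/esym; exact: convolutionE.
  by rewrite ann.
have xb : cbounded_measurable (fun y : borel => (\1_[set x0] y : R)%:C).
  exact: cbounded_measurable_indic.
have : Re `|J nu (fun y => g y + - m B * (\1_[set x0] y)%:C)| <=
    2 * (0 * lam nu setT + L * lam nu (V `\` [set x0])).
  apply: J_le_split => //.
  - by apply: cbounded_measurableD => //; exact: cbounded_measurableZ.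
  - exact: ltW.
  - move=> y nVx; rewrite indicE; have [->|yx] := eqVneq y x0.
      by rewrite mem_set// mulr1 gx0 subrr normr0.
    rewrite memNset; last by move=> /eqP; rewrite (negbTE yx).
    rewrite mulr0 addr0 gV ?normr0// => Vy; apply: nVx; split => //.
    by move=> /eqP; rewrite (negbTE yx).
  - move=> y [_ yx]; rewrite indicE memNset// mulr0 addr0 add0r; exact: gL.
rewrite JD//; last exact: cbounded_measurableZ.
rewrite JZ// J_indic// J0 add0r normReM normrN -/a mul0r add0r.
have : L * lam nu (V `\` [set x0]) <= L * (a / 16) by rewrite ler_wpM2l// ltW.
have : L * a < 5 * Re `|m B| * a by rewrite ltr_pM2r.
have : 0 < L * a by rewrite mulr_gt0.
by rewrite mulrA; lra.
Qed.

End concentration.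

(** * Left ideals and the socle of the measure algebra *)
Section ideals.
Context (R : realType) (G : lcGroupType).
Local Notation borel := (g_sigma_algebraType (@open G)).
Local Notation mborel := (@open G).-sigma.-measurable.
Local Notation M := (measure_algebra R G).
Implicit Types (mu nu m : M) (I L : set M).

Lemma diffuse_lideal : lideal (@diffuse R G).
Proof.
split.
- by move=> x.
- by move=> mu nu dmu dnu x; change (mu [set x] + nu [set x] = 0); rewrite dmu dnu addr0.
- by move=> mu m; exact: diffuse_left.
Qed.

Lemma total_mass_mul mu nu : (mu * nu) setT = mu setT * nu setT.
Proof.
transitivity (J nu (fun y => mu (rtrans setT y))).
  exact: convolutionE.
rewrite -(J_indic nu measurableT) -JZ; last exact: cbounded_measurable_indic.
congr (J nu _); apply/funext => y; rewrite indicE in_setT mulr1.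
by congr (cmeasure mu _).
Qed.

Lemma augmentation_lideal : lideal [set mu : M | mu setT = 0].
Proof.
split => //=.
- by move=> mu nu /= h1 h2; change (mu setT + nu setT = 0); rewrite h1 h2 addr0.
- by move=> mu nu /= h; rewrite total_mass_mul h mulr0.
Qed.

Lemma left_idealE I : left_ideal I <-> lideal I.
Proof.
split => [[I0 IZ IM]|[I0 ID IM]]; split => //.
- by move=> mu nu h1 h2; rewrite -[mu]scale1r; exact: IZ.
- by move=> a mu nu h1 h2; apply: ID => //; rewrite -[mu]mul1r -scaleAl; exact: IM.
Qed.

Lemma minimal_left_idealE L : minimal_left_ideal L <-> minimal_lideal L.
Proof.
by split => -[/left_idealE hL nL mL]; split => // J /left_idealE hJ; exact: mL.
Qed.

Lemma left_socleE : left_socle R G = @socle M.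
Proof.
apply/seteqP; split.
  apply: smallest_sub; first by apply/left_idealE; exact: socle_lideal.
  by move=> mu [L /minimal_left_idealE mL Lmu]; exact: socle_minimal Lmu.
move=> _ [s hs ->] I [/left_idealE[I0 ID _] sub].
elim: s hs => [|mu s IH] hs; first by rewrite big_nil.
rewrite big_cons; apply: ID; last by apply: IH => nu ns; apply: hs; rewrite inE ns orbT.
have [L mL Lmu] := hs mu (mem_head _ _); apply: sub; exists L => //.
exact/minimal_left_idealE.
Qed.

(** The ideal [L] is minimal, and its part in [I] is a smaller ideal. *)
Lemma minimal_outside L I mu nu : minimal_lideal L -> lideal I -> L mu -> ~ I mu ->
  L nu -> I nu -> nu = 0.
Proof.
move=> [hL _ mL] hI Lmu nImu Lnu Inu.
have [h|h] := mL _ (lidealI hL hI) (@subIsetl _ _ _).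
  by have : [set 0] nu by rewrite -h.
by have : L mu by []; rewrite -h => -[].
Qed.

Lemma socle_outside I : socle (1 : M) -> lideal I -> ~ I 1 ->
  exists L mu, [/\ minimal_lideal L, L mu & ~ I mu].
Proof.
move=> [s hs s1] [I0 ID _] nI1; apply: contrapT => h; apply: nI1; rewrite s1.
elim: s hs {s1} => [|mu s IH] hs; first by rewrite big_nil.
rewrite big_cons; apply: ID; last by apply: IH => nu ns; apply: hs; rewrite inE ns orbT.
have [L mL Lmu] := hs mu (mem_head _ _); apply: contrapT => nI.
by apply: h; exists L, mu.
Qed.

Lemma one_atom E : mborel E -> E 1%g -> (1 : M) E = 1.
Proof. by move=> mE E1; rewrite oneE deltaE// indicE mem_set. Qed.

(** Applied to the diffuse measures, the unit in the socle shows that they are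
    all [0]; applied to the measures of total mass [0], it yields a left
    invariant measure, whose atoms all have the same mass. *)
Theorem unit_in_socle_finite : socle (1 : M) -> finite_set [set: G].
Proof.
move=> s1.
have [L [nu [mL Lnu dnu]]] : exists L nu, [/\ minimal_lideal L, L nu & ~ diffuse nu].
  apply: (socle_outside s1 diffuse_lideal) => /(_ 1%g) /eqP.
  by rewrite one_atom; [rewrite oner_eq0|exact: borel_point|].
have noD : forall m, diffuse m -> m = 0.
  apply: (diffuse_annihilates dnu) => m dm.
  apply: (minimal_outside mL diffuse_lideal Lnu dnu); last exact: diffuse_right.
  by case: mL => -[_ _ LM] _ _; exact: LM.
have [L' [rho [mL' Lrho wrho]]] : exists L rho, [/\ minimal_lideal L, L rho & ~ [set mu : M | mu setT = 0] rho].
  apply: (socle_outside s1 augmentation_lideal); apply/eqP.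
  by rewrite one_atom// oner_eq0.
have inv x : delta R x * rho = rho.
  apply/eqP; rewrite -subr_eq0 -[X in _ - X]mul1r -mulrBl; apply/eqP.
  apply: (minimal_outside mL' augmentation_lideal Lrho wrho).
    by case: mL' => -[_ _ LM] _ _; exact: LM.
  rewrite /= total_mass_mul (_ : (delta R x - 1) setT = 0) ?mul0r//.
  change (delta R x setT - (1 : M) setT = 0).
  by rewrite one_atom// deltaE// indicE mem_set// subrr.
have [z rz] : exists z, rho [set z] != 0.
  apply: contrapT => h; apply: wrho => /=.
  suff -> : rho = 0 by [].
  by apply: noD => x; apply/eqP; apply: contrapT => /negP rx; apply: h; exists x.
have same w : rho [set w] = rho [set z].
  rewrite -[in LHS](inv (w * z^-1)%g).
  transitivity (rho [set y | [set w] (w * z^-1 * y)%g]).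
    by apply: convolution_deltal; exact: borel_point.
  congr (cmeasure rho _); apply/seteqP; split => y /=; last by move=> ->; rewrite mulgVK.
  by move=> h; rewrite -[y]mul1g -(mulVg (w * z^-1)%g) -mulgA h invgM invgK mulgVK.
have e0 : 0 < Re `|rho [set z]| by rewrite -ltcR -normRe normr_gt0.
apply: sub_finite_set (finite_atoms rho e0) => w _.
by rewrite /mkset same.
Qed.

End ideals.

Theorem corollary3 (R : realType) (G : lcGroupType)
    (min_ideals : forall I : set (measure_algebra R G),
      left_ideal I -> I <> [set 0] ->
      exists2 J : set (measure_algebra R G),
        minimal_left_ideal J & J `<=` I)
    (socle_closed : closed (left_socle R G)) :
  finite_set [set: G].
Proof.
apply: (@unit_in_socle_finite R G); apply: one_in_socle.
- exact: measure_algebra_semiprime.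
- move=> I /left_idealE hI nI; have [L /minimal_left_idealE mL LI] := min_ideals I hI nI.
  by exists L.
rewrite left_socleE in socle_closed; have [S0 SD SM] := @socle_lideal (measure_algebra R G).
move=> e Se e0 ee eo; apply: orthogonal_limit => //.
by move=> a mu Smu; rewrite -[mu]mul1r -scaleAl; exact: SM.
Qed.
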